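(* Let $p$ be a prime. (1) Let $a=(a_0,a_1,\dots)\in S_p$, $b\in[0,\infty)$, and let $\eta$ be a Lévy measure on $S_p$. For $n\in\mathbb{Z}_+$ let $\eta_{n+1}$ be the measure on $\mathbb{R}\times\mathbb{Z}^n$ defined by $\eta_{n+1}(\{0\}):=0$ and $$\eta_{n+1}(B\times\{\ell\}):=\eta\big(\{x\in S_p:\tau(x)_0\in B,\ (\tau(x)_1,\dots,\tau(x)_n)=\ell\}\big)$$ for all Borel subsets $B$ of $\mathbb{R}$ and all $\ell\in\mathbb{Z}^n$ with $0\notin B\times\{\ell\}$. Then there exist real random variables $X_0$, $Y_0$ and integer-valued random variables $Y_1,Y_2,\dots$ such that - $X_0$ is independent of the sequence $Y_0,Y_1,\dots$; - $X_0$ has a normal distribution with zero mean and variance $b$; - for all $n\in\mathbb{Z}_+$, the distribution of $(Y_0,\dots,Y_n)$ is the generalized Poisson measure $\pi_{\eta_{n+1},\,g_{\mathbb{R}\times\mathbb{Z}^n}}$ on $\mathbb{R}\times\mathbb{Z}^n$; and for any such random variables, $$\varphi(\tau(a)_0+X_0+Y_0,\,\tau(a)_1+Y_1,\,\tau(a)_2+Y_2,\dots)=\Big(a_0\mathrm{e}^{i(X_0+Y_0)},\,a_1\mathrm{e}^{i(X_0+Y_0+2\pi Y_1)/p},\,a_2\mathrm{e}^{i(X_0+Y_0+2\pi Y_1+2\pi Y_2p)/p^2},\dots\Big),$$ and the distribution of this $S_p$-valued random element is $$\delta_a*\gamma_{\psi_b}*\pi_{\eta,\,g_{S_p}}.$$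 (2) Moreover, if $U_0,U_1,\dots$ are independent real random variables such that $U_0$ is uniformly distributed on $[0,2\pi]$ and $U_1,U_2,\dots$ are uniformly distributed on $\{0,1,\dots,p-1\}$, then the distribution of $\varphi(U_0,U_1,\dots)$ is the normalized Haar measure $\omega_{S_p}$ on $S_p$.
   Context: $\mathbb{Z}_+$ is the set of nonnegative integers; $\mathbb{T}=\{\mathrm{e}^{ix}:-\pi\le x<\pi\}$ is the multiplicative group of complex numbers of modulus one; $\arg:\mathbb{T}\to[-\pi,\pi)$ is $\arg(\mathrm{e}^{ix}):=x$ for $-\pi\le x<\pi$. The function $h:\mathbb{R}\to\mathbb{R}$ is defined by $h(x)=0$ if $x<-\pi$ or $x\ge\pi$; $h(x)=-x-\pi$ if $-\pi\le x<-\pi/2$; $h(x)=x$ if $-\pi/2\le x<\pi/2$; $h(x)=-x+\pi$ if $\pi/2\le x<\pi$. The $p$-adic solenoid is $S_p=\{(y_0,y_1,\dots)\in\mathbb{T}^\infty:y_j=y_{j+1}^p\text{ for all }j\in\mathbb{Z}_+\}$, a compact Abelian group with coordinatewise multiplication and the relative topology from the product topology of $\mathbb{T}^\infty$. The map $\varphi:\mathbb{R}\times\mathbb{Z}^\infty\to S_p$ (product topology on $\mathbb{R}\times\mathbb{Z}^\infty$) is $$\varphi(y_0,y_1,y_2,\dots):=\big(\mathrm{e}^{iy_0},\,\mathrm{e}^{i(y_0+2\pi y_1)/p},\,\mathrm{e}^{i(y_0+2\pi y_1+2\pi y_2p)/p^2},\,\mathrm{e}^{i(y_0+2\pi y_1+2\pi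 y_2p+2\pi y_3p^2)/p^3},\dots\big),$$ a continuous homomorphism onto $S_p$. The map $\tau:S_p\to\mathbb{R}\times\mathbb{Z}^\infty$ is $$\tau(x):=\Big(\arg x_0,\,\frac{p\arg x_1-\arg x_0}{2\pi},\,\frac{p\arg x_2-\arg x_1}{2\pi},\dots\Big),$$ with coordinates $\tau(x)_0,\tau(x)_1,\dots$. General notions. Let $G$ be a locally compact Abelian $T_0$-topological group with a countable basis of its topology and with identity $e$. Measures on $G$ are Borel measures. $\widehat{G}$ is the group of characters (continuous homomorphisms $\chi:G\to\mathbb{T}$), and $\widehat{\mu}(\chi)=\int_G\chi\,\mathrm{d}\mu$ for a bounded measure $\mu$; a probability measure on $G$ is determined by $\widehat{\mu}$. A Lévy measure on $G$ is a measure $\eta$ with values in $[0,+\infty]$ such that $\eta(\{e\})=0$, $\eta(G\setminus U)<\infty$ for every Borel neighbourhood $U$ of $e$, and $\int_G(1-\mathrm{Re}\,\chi(x))\,\mathrm{d}\eta(x)<\infty$ for all $\chi\in\widehat{G}$. For a Lévy measure $\eta$ and a local inner product $g:G\times\widehat{G}\to\mathbb{R}$ (only the specific functions given below are needed), the generalized Poisson measure $\pi_{\eta,g}$ is the probability measure on $G$ with $\widehat{\pi}_{\eta,g}(\chi)=\exp\{\int_G(\chi(x)-1-ig(x,\chi))\,\mathrm{d}\eta(x)\}$ for all $\chi\in\widehat{G}$. $\delta_a$ is the Dirac measure at $a$ and $*$ is convolution. $\omega_{S_p}$ is the Haar measure on $S_p$ with $\omega_{S_p}(S_p)=1$. For $G=S_p$: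 $\widehat{S}_p=\{\chi_{d,\ell}:d\in\mathbb{Z}_+,\ \ell\in\mathbb{Z}\}$ with $\chi_{d,\ell}(y)=y_d^\ell$; $g_{S_p}(y,\chi_{d,\ell}):=\ell\,h(\arg y_0)/p^d$; for $b\ge0$, $\psi_b(\chi_{d,\ell}):=b\ell^2/p^{2d}$, and $\gamma_{\psi_b}$ is the (symmetric Gauss) probability measure on $S_p$ with $\widehat{\gamma}_{\psi_b}(\chi)=\mathrm{e}^{-\psi_b(\chi)/2}$ for all $\chi\in\widehat{S}_p$. For $G=\mathbb{R}\times\mathbb{Z}^n$ ($n\in\mathbb{Z}_+$, with $\mathbb{R}\times\mathbb{Z}^0=\mathbb{R}$): the characters are $\chi_{y,z}(x,\ell)=\mathrm{e}^{iyx}z_1^{\ell_1}\cdots z_n^{\ell_n}$ for $y\in\mathbb{R}$, $z\in\mathbb{T}^n$, and $g_{\mathbb{R}\times\mathbb{Z}^n}((x,\ell),\chi_{y,z}):=y\,h(x)$. The normal distribution with mean zero and variance $0$ is $\delta_0$. *)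

(* Defs.v *)
From HB Require Import structures.
From mathcomp Require Import all_boot all_order all_algebra.
From mathcomp Require Import all_classical all_reals all_analysis.
From mathcomp Require Import complex ring lra.

Set Implicit Arguments.
Unset Strict Implicit.
Unset Printing Implicit Defensive.

Import Order.TTheory GRing.Theory Num.Theory.
Import numFieldNormedType.Exports.

Local Open Scope classical_set_scope.
Local Open Scope ring_scope.

HB.instance Definition _ (R : realType) := NormedModule.copy R[i] R[i]^o.

(* Z carries the discrete topology and the discrete sigma-algebra. *)
HB.instance Definition _ := isPointed.Build int 0.
HB.instance Definition _ := hasNbhs.Build int principal_filter.
HB.instance Definition _ := Discrete_ofNbhs.Build int erefl.
HB.instance Definition _ := @isMeasurable.Build default_measure_display
  int discrete_measurable discrete_measurable0
  discrete_measurableC discrete_measurableU.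

Section circle.
Context {R : realType}.

Definition circle_set : set R[i] := [set z | `|z| = 1].
Definition circle : Type := set_type circle_set.
HB.instance Definition _ := Topological.copy circle (set_type circle_set).

(* The point e^{it}. *)
Definition cis (t : R) : R[i] := Complex (cos t) (sin t).

Lemma cis_circle t : circle_set (cis t).
Proof. by rewrite /circle_set/= normc_def/= cos2Dsin2 sqrtr1. Qed.

Definition expi (t : R) : circle := SigSub (mem_set (cis_circle t)).

Lemma norm_circle (z : circle) : `|val z| = 1.
Proof. exact: (set_mem (valP z)). Qed.

Lemma circle1_subproof : circle_set 1.
Proof. exact: normr1. Qed.

Lemma circleM_subproof (z w : circle) : circle_set (val z * val w).
Proof. by rewrite /circle_set/= normrM !norm_circle mulr1. Qed.

Lemma circleV_subproof (z : circle) : circle_set (val z)^-1.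
Proof. by rewrite /circle_set/= normfV norm_circle invr1. Qed.

Definition circle1 : circle := SigSub (mem_set circle1_subproof).
Definition circleM (z w : circle) : circle :=
  SigSub (mem_set (circleM_subproof z w)).
Definition circleV (z : circle) : circle :=
  SigSub (mem_set (circleV_subproof z)).

(* arg z is the x in [-pi, pi[ with e^{ix} = z; see [expi_arg]. *)
Definition arg (z : circle) : R := get [set x | - pi <= x < pi /\ expi x = z].

Lemma circle_neq0 (z : circle) : val z != 0.
Proof. by rewrite -normr_gt0 norm_circle. Qed.

Lemma cisD s t : cis (s + t) = cis s * cis t.
Proof.
by rewrite /cis cosD sinD; apply/eqP; rewrite eq_complex/=; apply/andP; split;
  apply/eqP; ring.
Qed.

Lemma cisMn t n : cis (t *+ n) = cis t ^+ n.
Proof.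
elim: n => [|n IH]; last by rewrite mulrS cisD IH exprS.
by rewrite mulr0n expr0 /cis cos0 sin0.
Qed.

Lemma arg_ex (z : circle) : exists x, - pi <= x < pi /\ expi x = z.
Proof.
case: z => z zC; have := set_mem zC; case: z zC => a b zC.
rewrite /circle_set/= normc_def/= => /(congr1 (@complex.Re R))/= ab1.
have {}ab1 : a ^+ 2 + b ^+ 2 = 1.
  by rewrite -[LHS]sqr_sqrtr ?ab1 ?expr1n// addr_ge0 ?sqr_ge0.
have a1 : -1 <= a <= 1 by have := sqr_ge0 b; nra.
have sa : Num.sqrt (1 - a ^+ 2) = `|b|.
  by rewrite -sqrtr_sqr; congr Num.sqrt; rewrite -ab1; ring.
have [b0|b0] := leP b 0; last first.
  exists (acos a); split; last first.
    apply: val_inj => /=; rewrite /cis acosK ?in_itv//= sin_acos// sa.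
    by rewrite gtr0_norm.
  have a0 : -1 < a <= 1 by have := mulr_gt0 b0 b0; nra.
  by rewrite acos_ltpi// andbT (le_trans _ (acos_ge0 a1))// oppr_le0 pi_ge0.
have [aN1|aN1] := eqVneq a 1.
  exists 0; split; first by rewrite oppr_le0 pi_ge0 pi_gt0.
  apply: val_inj => /=; rewrite /cis cos0 sin0 aN1; congr Complex.
  by move: ab1; rewrite aN1; nra.
exists (- acos a); split; last first.
  apply: val_inj => /=; rewrite /cis cosN sinN acosK ?in_itv//= sin_acos// sa.
  by rewrite ler0_norm// opprK.
have a2 : -1 <= a < 1 by move: a1 aN1; lra.
rewrite lerN2 acos_lepi//=.
by rewrite (lt_trans _ (pi_gt0 R))// oppr_lt0 acos_gt0.
Qed.

Lemma expi_arg z : expi (arg z) = z.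
Proof. by have /getPex[] := arg_ex z. Qed.

Lemma arg_itv z : - pi <= arg z < pi.
Proof. by have /getPex[] := arg_ex z. Qed.

Lemma cis_2pi (k : int) : cis (k%:~R * (2 * pi)) = 1.
Proof.
have H n : cis (n%:R * (2 * pi)) = 1.
  rewrite [2 * _]mulr_natl [n%:R * _]mulr_natl cisMn.
  by rewrite /cis cos2pi sin2pi expr1n.
case: k => n; first exact: H.
rewrite NegzE mulrNz mulNr.
have : cis (n.+1%:R * (2 * pi) - n.+1%:R * (2 * pi)) = 1.
  by rewrite subrr /cis cos0 sin0.
by rewrite cisD H mul1r.
Qed.

Lemma cis_eq1 (t : R) : cis t = 1 -> exists k : int, t = k%:~R * (2 * pi).
Proof.
move=> t1; have pi0 := pi_gt0 R; have p2 : 0 < 2 * pi :> R by lra.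
exists (Num.floor (t / (2 * pi))); set k := Num.floor _.
have /andP[k1 k2] := floor_itv (t / (2 * pi)); rewrite -/k in k1 k2.
set s := t - k%:~R * (2 * pi).
have s0 : 0 <= s by rewrite subr_ge0 -ler_pdivlMr.
have s2 : s < 2 * pi.
  have : t < (k + 1)%:~R * (2 * pi) by rewrite -ltr_pdivrMr.
  by rewrite intrD mulrDl mul1r ltrBlDr addrC.
have /(congr1 (@complex.Re R))/= cs : cis s = 1.
  rewrite /s cisD t1 mul1r; have := cis_2pi (- k).
  by rewrite mulrNz mulNr.
suff : s = 0 by move/eqP; rewrite subr_eq0 => /eqP.
have [spi|spi] := leP s pi.
  by apply: cos_inj; rewrite ?in_itv/= ?lexx ?s0 ?(ltW pi0)// cs cos0.
have : 2 * pi - s = 0.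
  apply: cos_inj; rewrite ?in_itv/= ?lexx ?(ltW pi0)//.
    by apply/andP; split; lra.
  by rewrite [2 * _]mulr_natl addrC cosD2pi cosN cs cos0.
lra.
Qed.

End circle.

Arguments circle R : clear implicits.
Arguments circle_set R : clear implicits.

Section solenoid.
Context {R : realType} (p : nat).

Definition solenoid_set : set {ptws nat -> circle R} :=
  [set y | forall j, val (y j) = val (y j.+1) ^+ p].

Definition solenoid : Type := set_type solenoid_set.
HB.instance Definition _ := Topological.copy solenoid (set_type solenoid_set).

Implicit Types x y : solenoid.

(* The coordinate y_j. *)
Definition scoord y (j : nat) : circle R := val y j.

Lemma scoordE y j : val (scoord y j) = val (scoord y j.+1) ^+ p.
Proof. exact: (set_mem (valP y)). Qed.

Lemma solenoid_eq x y : (forall j, val (scoord x j) = val (scoord y j)) -> x = y.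
Proof. by move=> xy; apply/val_inj/funext => j; apply/val_inj/xy. Qed.

Lemma solenoid0_subproof : solenoid_set (fun=> circle1).
Proof. by move=> j /=; rewrite expr1n. Qed.

Lemma solenoidD_subproof x y :
  solenoid_set (fun j => circleM (scoord x j) (scoord y j)).
Proof. by move=> j /=; rewrite scoordE [X in _ * X]scoordE exprMn. Qed.

Lemma solenoidN_subproof x : solenoid_set (fun j => circleV (scoord x j)).
Proof. by move=> j /=; rewrite scoordE exprVn. Qed.

(* The library's topological abelian groups are additive: the group law "+" of
   the solenoid is coordinatewise multiplication, its identity is "0". *)
Definition solenoid0 : solenoid := SigSub (mem_set solenoid0_subproof).
Definition solenoidD x y : solenoid := SigSub (mem_set (solenoidD_subproof x y)).
Definition solenoidN x : solenoid := SigSub (mem_set (solenoidN_subproof x)).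

Lemma solenoidDA : associative solenoidD.
Proof. by move=> x y z; apply: solenoid_eq => j /=; rewrite mulrA. Qed.
Lemma solenoidDC : commutative solenoidD.
Proof. by move=> x y; apply: solenoid_eq => j /=; rewrite mulrC. Qed.
Lemma solenoid0D : left_id solenoid0 solenoidD.
Proof. by move=> x; apply: solenoid_eq => j /=; rewrite mul1r. Qed.
Lemma solenoidND : left_inverse solenoid0 solenoidN solenoidD.
Proof.
by move=> x; apply: solenoid_eq => j /=; rewrite mulVf// circle_neq0.
Qed.

HB.instance Definition _ := GRing.isZmodule.Build solenoid
  solenoidDA solenoidDC solenoid0D solenoidND.
HB.instance Definition _ := isPointed.Build solenoid 0.

Lemma scoord_continuous j : continuous (fun y => val (scoord y j)).
Proof.
move=> y; apply: (@continuous_comp _ _ _ (fun y : solenoid => scoord y j)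
  (val : circle R -> R[i])); last first.
  exact: (@initial_continuous _ _ (set_val : set_type (circle_set R) -> R[i])).
apply: (@continuous_comp _ _ _ (val : solenoid -> {ptws nat -> circle R})
  (fun g : {ptws nat -> circle R} => g j)).
  exact: (@initial_continuous _ _ (set_val : set_type solenoid_set -> _)).
exact: (@proj_continuous nat (fun=> circle R) j).
Qed.

Lemma solenoid_continuousP (T : topologicalType) (f : T -> solenoid) :
  (forall j, continuous (fun t => val (scoord (f t) j) : R[i])) -> continuous f.
Proof.
move=> fc.
apply: (@continuous_comp_initial _ T _
  (set_val : set_type solenoid_set -> {ptws nat -> circle R}) f) => t.
apply/cvg_sup => j; move: t.
apply: (@continuous_comp_initial _ T _
  (fun g : {ptws nat -> circle R} => g j) (set_val \o f)).
apply: (@continuous_comp_initial _ T _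
  (set_val : set_type (circle_set R) -> R[i]) (fun t => scoord (f t) j)).
exact: fc.
Qed.

Lemma solenoid_sub_continuous :
  continuous (fun x : solenoid * solenoid => x.1 - x.2).
Proof.
apply: solenoid_continuousP => j x /=.
apply: cvgM.
  apply: (@cvg_comp _ _ _ fst (fun y => val (scoord y j))); first exact: cvg_fst.
  exact: scoord_continuous.
apply: cvgV; first exact: circle_neq0.
apply: (@cvg_comp _ _ _ snd (fun y => val (scoord y j))); first exact: cvg_snd.
exact: scoord_continuous.
Qed.

HB.instance Definition _ :=
  PreTopologicalNmodule_isTopologicalZmodule.Build solenoid
    solenoid_sub_continuous.

End solenoid.

Arguments solenoid R p : clear implicits.
Arguments solenoid_set R p : clear implicits.

Section real_times_Zn.
Context {R : realType} (n : nat).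

(* The group R x Z^n; 'rV[int]_0 is a singleton, so that R x Z^0 is R. *)
Definition realZ : Type := (R * 'rV[int]_n)%type.
HB.instance Definition _ := Topological.copy realZ (R * 'rV[int]_n)%type.
HB.instance Definition _ := GRing.Zmodule.copy realZ (R * 'rV[int]_n)%type.
HB.instance Definition _ := isPointed.Build realZ 0.

Lemma nbhs_rV_int (v : 'rV[int]_n) : nbhs v [set v].
Proof.
exists (fun i j => [set v i j]) => /= [i j|w vw].
  by rewrite nbhs_principalE.
by apply/matrixP => i j; have := vw i j.
Qed.

Lemma realZ_sub_continuous : continuous (fun x : realZ * realZ => x.1 - x.2).
Proof.
move=> x.
have f1 : (fun z : realZ * realZ => z.1.1) @ x --> x.1.1.
  by apply: (@cvg_comp _ _ _ fst (fst : realZ -> R)); exact: cvg_fst.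
have f2 : (fun z : realZ * realZ => z.2.1) @ x --> x.2.1.
  by apply: (@cvg_comp _ _ _ snd (fst : realZ -> R)); [exact: cvg_snd|exact: cvg_fst].
have g1 : (fun z : realZ * realZ => z.1.2) @ x --> x.1.2.
  by apply: (@cvg_comp _ _ _ fst (snd : realZ -> _)); [exact: cvg_fst|exact: cvg_snd].
have g2 : (fun z : realZ * realZ => z.2.2) @ x --> x.2.2.
  by apply: (@cvg_comp _ _ _ snd (snd : realZ -> _)); exact: cvg_snd.
have h1 : (fun z : realZ * realZ => z.1.1 - z.2.1) @ x --> x.1.1 - x.2.1.
  exact: cvgB.
have h2 : (fun z : realZ * realZ => z.1.2 - z.2.2) @ x --> x.1.2 - x.2.2.
  move=> A /nbhs_singleton /= Ax.
  have H1 : \forall z \near x, z.1.2 = x.1.2 by exact: (g1 _ (nbhs_rV_int _)).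
  have H2 : \forall z \near x, z.2.2 = x.2.2 by exact: (g2 _ (nbhs_rV_int _)).
  by apply: filterS2 H1 H2 => z /= -> ->.
exact: (cvg_pair h1 h2).
Qed.

HB.instance Definition _ :=
  PreTopologicalNmodule_isTopologicalZmodule.Build realZ realZ_sub_continuous.

End real_times_Zn.

Arguments realZ R n : clear implicits.

Section maps.
Context {R : realType} (p : nat).

(* phi and tau use the pairs of R * (nat -> int) for the elements of R x Z^oo:
   (y, z) stands for (y_0, y_1, y_2, ...) with y_0 = y and y_{k+1} = z k. *)
Definition phi_angle (y : R * (nat -> int)) (j : nat) : R :=
  (y.1 + \sum_(k < j) 2 * pi * (y.2 k)%:~R * p%:R ^+ k) / p%:R ^+ j.

Lemma phi_subproof : prime p -> forall y : R * (nat -> int),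
  solenoid_set R p (fun j => expi (phi_angle y j)).
Proof.
move=> pp y j /=; have p0 : p%:R != 0 :> R by rewrite pnatr_eq0 -lt0n prime_gt0.
rewrite -cisMn.
have -> : phi_angle y j.+1 *+ p = phi_angle y j + (y.2 j)%:~R * (2 * pi).
  rewrite /phi_angle big_ord_recr/= -mulr_natr exprS; field.
  by rewrite p0 expf_neq0.
by rewrite cisD cis_2pi mulr1.
Qed.

Definition phi (pp : prime p) (y : R * (nat -> int)) : solenoid R p :=
  SigSub (mem_set (phi_subproof pp y)).

(* The floor is exact, see [tauE]. *)
Definition tau (x : solenoid R p) : R * (nat -> int) :=
  (arg (scoord x 0),
   fun k => Num.floor ((p%:R * arg (scoord x k.+1) - arg (scoord x k)) / (2 * pi))).

Lemma tauE x k : ((tau x).2 k)%:~R =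
  (p%:R * arg (scoord x k.+1) - arg (scoord x k)) / (2 * pi).
Proof.
rewrite /tau/=; set t := p%:R * _ - _.
have pi2 : 2 * pi != 0 :> R by rewrite mulf_neq0// gt_eqF// pi_gt0.
have [m tm] : exists m : int, t = m%:~R * (2 * pi).
  apply: cis_eq1; rewrite /t mulr_natl cisD cisMn.
  have e j : cis (arg (scoord x j)) = val (scoord x j).
    by rewrite -[in RHS](expi_arg (scoord x j)).
  rewrite e -scoordE -e -cisD subrr /cis cos0 sin0//.
by rewrite tm mulfK// intrKfloor.
Qed.

End maps.

Section borel.
Context {G : topologicalZmodType}.

(* G with its Borel sigma-algebra. *)
Definition borel : Type := g_sigma_algebraType (@open G).
HB.instance Definition _ := Choice.copy borel G.
HB.instance Definition _ := isPointed.Build borel (0 : G).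

Lemma borelC (A : set borel) : <<s @open G >> A -> <<s @open G >> (~` A).
Proof. by move=> sGA; rewrite -setTD; exact: sigma_algebraCD. Qed.

HB.instance Definition _ := @isMeasurable.Build (sigma_display (@open G))
  borel <<s @open G >> (@sigma_algebra0 _ setT (@open G)) borelC
  (@sigma_algebra_bigcup _ setT (@open G)).

End borel.

Arguments borel G : clear implicits.

Section measures_on_groups.
Context {R : realType} {G : topologicalZmodType}.
Implicit Types (mu : probability (borel G) R)
  (eta : {measure set (borel G) -> \bar R}).

Definition is_character (chi : G -> circle R) :=
  continuous chi /\ forall x y, val (chi (x + y)) = val (chi x) * val (chi y).

Definition is_levy eta :=
  [/\ eta [set (0 : G)] = 0%E,
      forall U : set (borel G), measurable U -> nbhs (0 : G) U ->
        (eta (~` U) < +oo)%E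
    & forall chi : G -> circle R, is_character chi ->
        (\int[eta]_x (1 - complex.Re (val (chi x)))%:E < +oo)%E].

Definition cintegral eta (f : G -> R[i]) : R[i] :=
  Complex (\int[eta]_x complex.Re (f x)) (\int[eta]_x complex.Im (f x)).

Definition cexp (z : R[i]) : R[i] :=
  (expR (complex.Re z))%:C%C * cis (complex.Im z).

(* In the next two definitions, (chi i)_i is a parametrization of the dual
   group of G, on which functions of a character are expressed. *)
Definition is_gauss (I : Type) (chi : I -> G -> R[i]) (psi : I -> R) mu :=
  forall i, cintegral mu (chi i) = (expR (- psi i / 2))%:C%C.

Definition is_generalized_poisson (I : Type) (chi : I -> G -> R[i])
    (g : G -> I -> R) eta mu :=
  is_levy eta /\
  forall i, cintegral mu (chi i) =
    cexp (cintegral eta (fun x => chi i x - 1 - Complex 0 (g x i))).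

Definition convolution (mu nu : set (borel G) -> \bar R) (A : set (borel G)) :
  \bar R := (\int[mu]_x nu [set y : G | A ((x : G) + y)%R])%E.

Definition is_normalized_haar mu :=
  forall (x : G) (A : set (borel G)), measurable A ->
    mu [set x + (y : G) | y in A] = mu A.

End measures_on_groups.

Definition h {R : realType} (x : R) : R :=
  if (x < - pi) || (pi <= x) then 0
  else if x < - (pi / 2) then - x - pi
  else if x < pi / 2 then x
  else - x + pi.

Section solenoid_characters.
Context {R : realType} {p : nat}.

Definition solenoid_char (dl : nat * int) (y : solenoid R p) : R[i] :=
  val (scoord y dl.1) ^ dl.2.

Definition solenoid_g (y : solenoid R p) (dl : nat * int) : R :=
  dl.2%:~R * h (arg (scoord y 0)) / p%:R ^+ dl.1.

Definition solenoid_psi (b : R) (dl : nat * int) : R :=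
  b * dl.2%:~R ^+ 2 / p%:R ^+ (2 * dl.1).

End solenoid_characters.

Arguments solenoid_psi {R} p b dl.

Section realZ_characters.
Context {R : realType} {n : nat}.

Definition realZ_char (yz : R * ('I_n -> circle R)) (x : realZ R n) : R[i] :=
  cis (yz.1 * x.1) * \prod_(k < n) val (yz.2 k) ^ (x.2 ord0 k).

Definition realZ_g (x : realZ R n) (yz : R * ('I_n -> circle R)) : R :=
  yz.1 * h x.1.

End realZ_characters.

Definition is_tau_image {R : realType} {p : nat}
    (eta : {measure set (borel (solenoid R p)) -> \bar R}) (n : nat)
    (etan : {measure set (borel (realZ R n)) -> \bar R}) :=
  etan [set (0 : realZ R n)] = 0%E /\
  forall (B : set R) (l : 'rV[int]_n), measurable B ->
    ~ (B `*` [set l]) (0 : realZ R n) ->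
    etan (B `*` [set l]) =
      eta [set x | B (tau x).1 /\ \row_(k < n) (tau x).2 k = l].

Section random_variables.
Context {R : realType} {d : measure_display} {T : measurableType d}.
Implicit Types P : probability T R.

Definition has_distribution P {d'} {T' : measurableType d'} (X : T -> T')
    (mu : set T' -> \bar R) :=
  measurable_fun [set: T] X /\
  forall A, measurable A -> P (X @^-1` A) = mu A.

Definition sigma_rv {d'} {T' : measurableType d'} (X : T -> T') :
    set (set T) :=
  preimage_set_system [set: T] X measurable.

(* The n-th term is the sigma-algebra generated by the n-th term of the
   sequence X, Z 0, Z 1, ... *)
Definition sigma_seq (X : T -> R) (Z : nat -> T -> int) (n : nat) :
    set (set T) :=
  if n is k.+1 then sigma_rv (Z k) else sigma_rv X.

Definition independent P (F1 F2 : set (set T)) :=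
  forall A B, F1 A -> F2 B -> P (A `&` B) = (P A * P B)%E.

Definition mutually_independent P (F : nat -> set (set T)) :=
  forall (J : seq nat) (A : nat -> set T), uniq J ->
    (forall j, j \in J -> F j (A j)) ->
    P (\bigcap_(j in [set` J]) A j) = (\prod_(j <- J) P (A j))%E.

Definition normal_law (b : R) : set R -> \bar R :=
  if b == 0 then \d_(0 : R) else normal_prob 0 (Num.sqrt b).

(* Y k stands for the variable Y_{k+1}, and etan n for the measure eta_{n+1}
   on R x Z^n. *)
Definition representing_variables P (b : R)
    (etan : forall n, {measure set (borel (realZ R n)) -> \bar R})
    (X0 Y0 : {RV P >-> R}) (Y : nat -> {RV P >-> int}) :=
  [/\ independent P (sigma_rv X0)
        <<s \bigcup_n sigma_seq Y0 (fun k => Y k : T -> int) n >>,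
      has_distribution P X0 (normal_law b)
    & forall n, exists pi_n : probability (borel (realZ R n)) R,
        is_generalized_poisson realZ_char realZ_g (etan n) pi_n /\
        has_distribution P
          (fun w => (Y0 w, \row_(k < n) Y k w) : borel (realZ R n)) pi_n].

(* U is Z-valued, since phi is defined on R x Z^oo only. *)
Definition uniform_digit P (p : nat) (U : T -> int) :=
  forall k : nat, (k < p)%N -> P (U @^-1` [set k%:Z]) = (p%:R^-1)%:E.

End random_variables.

Lemma pi2_gt0 (R : realType) : 0 < 2 * pi :> R.
Proof. by rewrite mulr_gt0// pi_gt0. Qed.

(* Main.v *)
(** The variables (Y_0, Y_1, ...) are built as a Poisson integral of tau with
    respect to eta. The complements of a sequence of neighbourhoods decreasing to
    the identity cut the solenoid into shells of finite mass, and on each shell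
    one takes a compound Poisson variable. Each integer coordinate only involves
    finitely many shells, and the compensated real coordinates form a series of
    independent variables with summable moments, since a Levy measure integrates
    the square of arg x_0; the characteristic functions converge by dominated
    convergence. For arbitrary representing variables, phi is additive and the
    composition of chi_{d,l} with phi is a character of R x Z^d, so that the laws
    of phi(X_0, 0) and phi(Y_0, Y_1, ...) have the required transforms, and
    phi(tau(a)) = a. For the Haar measure, U_0 + 2 pi (U_1 + p U_2 + ...) with n
    digits is uniform on [0, 2 pi p^n], so that each coordinate is uniform on the
    circle, and sets depending on one coordinate are stable under intersection. *)

Require Import Defs.
From HB Require Import structures.
From mathcomp Require Import all_boot all_order all_algebra.
From mathcomp Require Import all_classical all_reals all_analysis.
From mathcomp Require Import measurable_realfun complex ring lra zify.

Set Implicit Arguments.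
Unset Strict Implicit.
Unset Printing Implicit Defensive.

Import Order.TTheory GRing.Theory Num.Theory.
Import numFieldNormedType.Exports.

Local Open Scope classical_set_scope.
Local Open Scope ring_scope.

Import ComplexField.Normc.

(** * Infinite products of probabilities *)

(** That [pi_n] exists as a probability is itself part of the claim, and the laws for all [n] must
    come from one sequence. Both are obtained by realizing a single random family of jumps in the
    solenoid and reading every coordinate of [tau] off the same jumps; this takes countably many
    independent compound Poisson variables on one space, hence infinite products. The obstacle is
    that [tau] is neither continuous nor additive, because [arg] jumps at -1: a character of R x Z^n
    composed with [tau] is in general not a character, so the conditions defining a Levy measure do
    not apply to it directly. They are exploited through the characters [x_d], which bound the mass
    away from the identity and, for [d = 0], integrate the square of [arg x_0]. Close to the
    identity the integer coordinates vanish and every integrand that occurs is of the order of that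
    square. In the other direction [phi] is additive and turns characters into characters, and the
    local inner products of the two groups correspond exactly, so that no drift has to be
    corrected. *)

Definition coord_sets d (T : measurableType d) : set (set (nat -> T)) :=
  \bigcup_n preimage_set_system setT (fun x : nat -> T => x n) measurable.

Arguments coord_sets {d} T.

Definition seqspace d (T : measurableType d) : Type :=
  g_sigma_algebraType (coord_sets T).

Arguments seqspace {d} T.

HB.instance Definition _ d (T : measurableType d) :=
  Measurable.copy (seqspace T) (g_sigma_algebraType (coord_sets T)).

Definition scons T (t : T) (x : nat -> T) (n : nat) : T :=
  if n is k.+1 then x k else t.

Section seqspace_measurable.
Context d (T : measurableType d).

Lemma measurable_coord n : measurable_fun [set: seqspace T] (fun x => x n).
Proof.
by move=> _ B mB; apply: sub_sigma_algebra; exists n => //; exists B.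
Qed.

Lemma measurable_seqspace d' (S : measurableType d') (f : S -> seqspace T) :
  (forall n, measurable_fun setT (fun s => f s n)) -> measurable_fun setT f.
Proof.
move=> mf; apply: (@measurability _ _ S (seqspace T) setT f (coord_sets T)) => //.
by move=> _ [_ [n _ [B mB <-]] <-]; have := mf n measurableT _ mB; rewrite !setTI.
Qed.

Lemma measurable_scons d' (S : measurableType d') (f : S -> T)
    (g : S -> seqspace T) :
  measurable_fun setT f -> measurable_fun setT g ->
  measurable_fun setT (fun s => scons (f s) (g s) : seqspace T).
Proof.
move=> mf mg; apply: measurable_seqspace => -[|n]//=.
exact: (measurableT_comp (measurable_coord n) mg).
Qed.

End seqspace_measurable.

Section content.
Context d (T : measurableType d) (R : realType).
Implicit Types (m : nat -> probability T R) (A B : set (seqspace T)).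

(** The coordinates from [N] on are frozen at [point], so the value is the intended one only for
    sets determined by their first [N] coordinates; for these, [cont_dep] makes it independent of
    [N]. *)
Fixpoint cyl_content (N : nat) m A {struct N} : \bar R :=
  if N is N'.+1 then
    (\int[m 0%N]_t cyl_content N' (fun n => m n.+1) [set y | A (scons t y)])%E
  else (\1_A (point : seqspace T))%:E.

Lemma measurable_slice A t : measurable A ->
  measurable ([set y | A (scons t y)] : set (seqspace T)).
Proof.
move=> mA; have mt : measurable_fun setT (fun y : seqspace T => scons t y : seqspace T).
  by apply: measurable_seqspace => -[|n]//=; exact: measurable_coord.
by rewrite -[X in measurable X]setTI; exact: mt.
Qed.

Lemma cont_ge0 N m A : (0 <= cyl_content N m A)%E.
Proof.
elim: N m A => [|N IH] m A/=; first by rewrite lee_fin.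
by apply: integral_ge0 => t _.
Qed.

(** The parameter space is arbitrary so that the induction goes through: the coordinate about to be
    integrated joins the parameter, and Tonelli's theorem integrates it out. *)
Lemma measurable_cont N m d' (S : measurableType d') (A : set (S * seqspace T)) :
  measurable A -> measurable_fun setT (fun s => cyl_content N m [set y | A (s, y)] : \bar R).
Proof.
elim: N m d' S A => [|N IH] m d' S A mA /=.
  apply/measurable_EFinP.
  have mB : measurable [set s : S | A (s, point)].
    rewrite -[X in measurable X]setTI.
    by apply: (pair2_measurable (point : seqspace T)).
  apply: eq_measurable_fun (measurable_indic mB) => s _.
  by rewrite /indic; do 2 congr (_%:R); apply/idP/idP; rewrite !inE.
pose A' : set ((S * T) * seqspace T) := [set sty | A (sty.1.1, scons sty.1.2 sty.2)].
have mA' : measurable A'.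
  rewrite -[X in measurable X]setTI.
  have mf : measurable_fun [set: (S * T) * seqspace T]
      (fun sty => (sty.1.1, scons sty.1.2 sty.2 : seqspace T)).
    apply: measurable_fun_pair => /=.
      by apply: measurableT_comp => //; exact: measurable_fst.
    apply: measurable_scons; last exact: measurable_snd.
    by apply: measurableT_comp; [exact: measurable_snd|exact: measurable_fst].
  exact: mf.
have := IH (fun n => m n.+1) _ _ A' mA' => mI.
exact: (measurable_fun_fubini_tonelli_F _ mI (fun=> cont_ge0 _ _ _)).
Qed.

Lemma measurable_cont_slice N m A : measurable A ->
  measurable_fun setT (fun t => cyl_content N m [set y | A (scons t y)]).
Proof.
move=> mA; apply: (@measurable_cont N m _ T [set ty | A (scons ty.1 ty.2)]).
rewrite -[X in measurable X]setTI.
have mf : measurable_fun [set: T * seqspace T]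
    (fun ty => scons ty.1 ty.2 : seqspace T).
  by apply: measurable_scons; [exact: measurable_fst|exact: measurable_snd].
exact: mf.
Qed.

Lemma contT N m : cyl_content N m setT = 1%E.
Proof.
elim: N m => [|N IH] m/=; first by rewrite indicE in_setT.
under eq_integral do rewrite IH.
by rewrite integral_cst//= mul1e probability_setT.
Qed.

Lemma cont0 N m : cyl_content N m set0 = 0%E.
Proof.
elim: N m => [|N IH] m/=; first by rewrite indicE in_set0.
under eq_integral do rewrite IH.
by rewrite integral0.
Qed.

Lemma contU N m A B : measurable A -> measurable B -> A `&` B = set0 ->
  cyl_content N m (A `|` B) = (cyl_content N m A + cyl_content N m B)%E.
Proof.
elim: N m A B => [|N IH] m A B mA mB AB0 /=.
  rewrite -EFinD !indicE in_setU; congr (_%:E).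
case: (boolP (_ \in A)) => [|_]; last by rewrite add0r.
case: (boolP (_ \in B)) => [|_]; last by rewrite addr0.
by rewrite !inE => Bp Ap; have : (A `&` B) point by []; rewrite AB0.
rewrite -ge0_integralD//=; last 4 first.
- by move=> t _; exact: cont_ge0.
- exact: measurable_cont_slice.
- by move=> t _; exact: cont_ge0.
- exact: measurable_cont_slice.
apply: eq_integral => t _; apply: IH.
- exact: measurable_slice.
- exact: measurable_slice.
- by rewrite -subset0 => y [Ay By]; have : (A `&` B) (scons t y) by []; rewrite AB0.
Qed.

Definition depends_below (N : nat) A :=
  forall x y, (forall i, (i < N)%N -> x i = y i) -> A x -> A y.

Lemma dep_le N M A : (N <= M)%N -> depends_below N A -> depends_below M A.
Proof. by move=> NM dA x y xy; apply: dA => i iN; apply: xy; exact: leq_trans NM. Qed.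

Lemma dep_slice N A t : depends_below N A -> depends_below N.-1 [set y | A (scons t y)].
Proof.
move=> dA x y xy /=; apply: dA => -[|i]//= iN; apply: xy.
by case: N iN.
Qed.

Lemma dep0 A : depends_below 0 A -> A = set0 \/ A = setT.
Proof.
move=> dA; have [->|/set0P[x Ax]] := eqVneq A set0; first by left.
by right; rewrite -subTset => y _; apply: dA Ax.
Qed.

Lemma cont_dep N m A : depends_below N A -> cyl_content N.+1 m A = cyl_content N m A.
Proof.
elim: N m A => [|N IH] m A dA.
  by have [->|->] := dep0 dA; rewrite ?cont0 ?contT.
by apply: eq_integral => t _; exact: IH (dep_slice dA).
Qed.

Lemma cont_dep_le N M m A : (N <= M)%N -> depends_below N A -> cyl_content M m A = cyl_content N m A.
Proof.
move=> /subnK <-; elim: (M - N)%N => [//|k IH] dA.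
by rewrite addSn cont_dep ?IH//; apply: dep_le dA; rewrite leq_addl.
Qed.

(** Measurability refers to the whole product sigma-algebra; finite dependence is kept as a separate
    condition, which spares finite products of spaces. *)
Definition is_cyl A := measurable A /\ exists N, depends_below N A.

(** Some admissible rank, not necessarily the least; [cylcontE] shows that the choice is
    immaterial. *)
Definition cyl_rank A : nat := get [set N | depends_below N A].

Definition cylcont m A : \bar R := cyl_content (cyl_rank A) m A.

Lemma cylcontE m A N : depends_below N A -> cylcont m A = cyl_content N m A.
Proof.
move=> dA; have dr : depends_below (cyl_rank A) A.
  exact: (@getPex nat [set N | depends_below N A] (ex_intro _ N dA)).
by case: (leqP N (cyl_rank A)) => [|/ltnW] NM; rewrite /cylcont;
  [rewrite (cont_dep_le _ NM)|rewrite -(cont_dep_le _ NM)].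
Qed.

Lemma cylcont_ge0 m A : (0 <= cylcont m A)%E.
Proof. exact: cont_ge0. Qed.

Lemma depC N A : depends_below N A -> depends_below N (~` A).
Proof. by move=> dA x y xy /= nA Ay; apply: nA; apply: dA Ay => i /xy. Qed.
Lemma depU N A B : depends_below N A -> depends_below N B -> depends_below N (A `|` B).
Proof. by move=> dA dB x y xy [/(dA _ _ xy)|/(dB _ _ xy)]; [left|right]. Qed.

Lemma is_cylT : is_cyl setT. Proof. by split; [|exists 0%N]. Qed.
Lemma is_cyl0 : is_cyl set0. Proof. by split; [|exists 0%N]. Qed.
Lemma is_cylC A : is_cyl A -> is_cyl (~` A).
Proof. by move=> [mA [N dA]]; split; [exact: measurableC|exists N; exact: depC]. Qed.
Lemma is_cylU A B : is_cyl A -> is_cyl B -> is_cyl (A `|` B).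
Proof.
move=> [mA [N dA]] [mB [M dB]]; split; first exact: measurableU.
exists (maxn N M); apply: depU; first by apply: dep_le dA; exact: leq_maxl.
by apply: dep_le dB; exact: leq_maxr.
Qed.
Lemma is_cyl_slice A t : is_cyl A -> is_cyl [set y | A (scons t y)].
Proof.
by move=> [mA [N dA]]; split;
  [exact: measurable_slice|exists N.-1; exact: dep_slice].
Qed.

Lemma cylcont0 m : cylcont m set0 = 0%E. Proof. exact: cont0. Qed.
Lemma cylcontT m : cylcont m setT = 1%E. Proof. exact: contT. Qed.

Lemma cylcontU m A B : is_cyl A -> is_cyl B -> A `&` B = set0 ->
  cylcont m (A `|` B) = (cylcont m A + cylcont m B)%E.
Proof.
move=> [mA [N dA]] [mB [M dB]] AB0.
have dA' : depends_below (maxn N M) A by apply: dep_le dA; exact: leq_maxl.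
have dB' : depends_below (maxn N M) B by apply: dep_le dB; exact: leq_maxr.
by rewrite (cylcontE _ dA') (cylcontE _ dB') (cylcontE _ (depU dA' dB')) contU.
Qed.

Lemma cylcont_le m A B : is_cyl A -> is_cyl B -> A `<=` B ->
  (cylcont m A <= cylcont m B)%E.
Proof.
move=> cA cB AB.
have cD : is_cyl (B `\` A).
  rewrite setDE -[X in is_cyl X]setCK setCI setCK.
  by apply: is_cylC; apply: is_cylU => //; exact: is_cylC.
rewrite -(setDUK AB) cylcontU//; first by rewrite leeDl// cylcont_ge0.
by rewrite setIC setDE -setIA setICl setI0.
Qed.

Lemma cylcont_le1 m A : is_cyl A -> (cylcont m A <= 1)%E.
Proof. by move=> cA; rewrite -(cylcontT m) cylcont_le//; exact: is_cylT. Qed.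

Lemma cylcont_slice m A : is_cyl A -> cylcont m A =
  (\int[m 0%N]_t cylcont (fun n => m n.+1) [set y | A (scons t y)])%E.
Proof.
move=> [mA [N dA]]; have dA1 := dep_le (leqnSn N) dA.
rewrite (cylcontE _ dA1) /=; apply: eq_integral => t _.
by rewrite (cylcontE _ (dep_slice dA1)).
Qed.

Lemma measurable_cylcont_slice m A : is_cyl A ->
  measurable_fun setT (fun t => cylcont m [set y | A (scons t y)]).
Proof.
move=> [mA [N dA]].
apply: eq_measurable_fun (measurable_cont_slice N.-1 m mA) => t _.
by rewrite (cylcontE _ (dep_slice dA)).
Qed.

(* As in the extension theorem for product measures, continuity at the empty set
   is proved by choosing the coordinates of a common point one at a time. *)
Definition large m (A : nat -> set (seqspace T)) :=
  [/\ forall n, is_cyl (A n), forall n, A n.+1 `<=` A n &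
      exists2 e : R, 0 < e & forall n, (e%:E <= cylcont m (A n))%E].

(** With [D n] the set of [t] whose slice of [A n] has content at least [e / 2], the slice contents
    are bounded by the indicator of [D n] plus [e / 2]. Hence [D n] has mass at least [e / 2]; these
    sets decrease, so continuity from above gives a point common to all of them. *)
Lemma large_slice m (A : nat -> set (seqspace T)) : large m A ->
  exists t, large (fun n => m n.+1) (fun n => [set y | A n (scons t y)]).
Proof.
move=> [cA ndA [e e0 Ae]].
pose f n t := cylcont (fun n => m n.+1) [set y | A n (scons t y)].
have mf n : measurable_fun setT (f n) by exact: measurable_cylcont_slice.
have f1 n t : (f n t <= 1)%E by apply: cylcont_le1; exact: is_cyl_slice.
have e20 : 0 < e / 2 by rewrite divr_gt0.
pose D n := [set t | ((e / 2)%:E <= f n t)%E].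
have mD n : measurable (D n).
  by rewrite -[X in measurable X]setTI; exact: emeasurable_fun_c_infty.
have De n : ((e / 2)%:E <= m 0%N (D n))%E.
  have : (e%:E <= \int[m 0%N]_t ((\1_(D n) t)%:E + (e / 2)%:E))%E.
    rewrite (le_trans (Ae n))// cylcont_slice//.
    apply: ge0_le_integral => //.
    - by move=> t _; exact: cylcont_ge0.
    - exact: mf.
    - apply: emeasurable_funD => //; apply/measurable_EFinP; exact: measurable_indic.
    - move=> t _; rewrite indicE; case: (boolP (t \in D n)) => tD /=.
        by rewrite (le_trans (f1 n t))// leeDl// lee_fin ltW.
      rewrite add0e ltW// ltNge; apply: contra tD => tD.
      by rewrite inE.
  rewrite ge0_integralD//=; last 2 first.
  - exact/measurable_EFinP.
  - by move=> t _; rewrite lee_fin ltW.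
  rewrite integral_indic// setIT integral_cst//= probability_setT mule1 => ee.
  rewrite -(@leeD2rE _ (e / 2)%:E)//.
  by rewrite -EFinD -splitr.
have ndD : {homo D : n p / (n <= p)%N >-> (p <= n)%O}.
  apply/nonincreasing_seqP => n; apply/subsetPset => t /le_trans; apply.
  by apply: cylcont_le; [exact: is_cyl_slice|exact: is_cyl_slice|move=> y; exact: ndA].
have [t Dt] : \bigcap_n D n !=set0.
  apply/set0P/eqP => D0.
  have /cvg_lim : m 0%N \o D @ \oo --> m 0%N (\bigcap_n D n).
    apply: nonincreasing_cvg_mu => //.
    - by rewrite (le_lt_trans (probability_le1 _ _))// ltry.
    - exact: bigcapT_measurable.
  rewrite D0 measure0 => /(_ (@ereal_hausdorff R)) lim0.
  have : ((e / 2)%:E <= limn (m 0%N \o D))%E.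
    apply: lime_ge; last exact: nearW.
    apply: ereal_nonincreasing_is_cvgn => a b ab; apply: le_measure; rewrite ?inE//.
    by apply/subsetPset; exact: ndD.
  by rewrite lim0 lee_fin leNgt e20.
exists t; split.
- by move=> n; exact: is_cyl_slice.
- by move=> n y; exact: ndA.
- by exists (e / 2) => // n; exact: Dt.
Qed.

(** Iterating [large_slice] yields a sequence [x] along which all slices stay large, in particular
    nonempty. As [A n] depends on finitely many coordinates, one nonempty slice along a long enough
    prefix of [x] already puts [x] in [A n]. *)
Lemma large_neq0 m (A : nat -> set (seqspace T)) : large m A -> \bigcap_n A n !=set0.
Proof.
move=> lA.
pose next k (B : nat -> set (seqspace T)) : T :=
  get [set t | large (fun n => m (k + n).+1) (fun n => [set y | B n (scons t y)])].
pose B := fix B k : nat -> set (seqspace T) := if k is k'.+1 then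
  fun n => [set y | B k' n (scons (next k' (B k')) y)] else A.
have lB k : large (fun n => m (k + n)%N) (B k).
  elim: k => [//|k IH]; have [t lt] := large_slice IH.
  have Pt : [set t | large (fun n => m (k + n).+1) (fun n => [set y | B k n (scons t y)])] t.
    by rewrite /=; under [X in large X _]eq_fun do rewrite -addnS.
  have := getPex (ex_intro _ _ Pt); rewrite -/(next k (B k)) /=.
  by under [X in large X _]eq_fun do rewrite -addSn.
pose x k := next k (B k).
pose pre k (y : nat -> T) i := if (i < k)%N then x i else y (i - k)%N.
(* [B k n] is the section of [A n] at the first [k] chosen coordinates. *)
have BE k n y : B k n y = A n (pre k y).
  elim: k y => [|k IH] y; first by congr A; apply/funext => i; rewrite /pre/= subn0.
  rewrite /= IH; congr A; apply/funext => i; rewrite /pre ltnS.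
  case: (ltngtP i k) => // [ki|->]; last by rewrite subnn.
  by rewrite -(subnSK ki).
exists x => n _; have [cA _ _] := lA; have [_ [N dN]] := cA n.
have [cB _ [e e0 eB]] := lB N.
have /set0P[y By] : B N n != set0.
  apply/eqP => B0; have := eB n; rewrite B0 cylcont0 lee_fin leNgt e0 //.
move: By; rewrite BE; apply: dN => i iN.
by rewrite /pre iN.
Qed.

End content.

Section product.
Context d (T : measurableType d) (R : realType).

(** A copy of the sequence space carrying the algebra of cylinder sets instead of the sigma-algebra,
    as the Caratheodory extension requires. *)
Definition cylspace : Type := seqspace T.
HB.instance Definition _ := Pointed.on cylspace.
HB.instance Definition _ := isAlgebraOfSets.Build default_measure_display
  cylspace (@is_cyl0 _ T) (@is_cylU _ T) (@is_cylC _ T).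

Variable m : nat -> probability T R.

Let mu : set cylspace -> \bar R := cylcont m.

Let mu0 : mu set0 = 0%E. Proof. exact: cylcont0. Qed.
Let mu_ge0 A : (0 <= mu A)%E. Proof. exact: cylcont_ge0. Qed.

(** The remainders [A n] of a countable disjoint union decrease to the empty set. If their contents
    stayed above some [e > 0], [large_neq0] would produce a point in all of them; so they tend to
    0. *)
Let mu_sigma_additive : semi_sigma_additive mu.
Proof.
move=> F mF tF mU.
pose A n := \bigcup_n F n `\` \big[setU/set0]_(i < n) F i.
have mA n : measurable (A n).
  by apply: measurableD => //; exact: bigsetU_measurable.
have muf B : measurable B -> mu B \is a fin_num.
  by move=> mB; rewrite ge0_fin_numE// (le_lt_trans (cylcont_le1 _ mB)) ?ltry.
have AS n : A n = F n `|` A n.+1.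
  rewrite /A big_ord_recr/= -setDDl setDUK// => x Fx; split; first by exists n.
  rewrite -bigcup_mkord => -[k /= kn Fkx].
  have /trivIsetP/(_ k n I I) := tF; rewrite ltn_eqF// => /(_ isT).
  by rewrite -subset0 => /(_ x); apply.
have muS n : mu (\bigcup_n F n) = (\sum_(0 <= i < n) mu (F i) + mu (A n))%E.
  elim: n => [|n IH]; first by rewrite big_geq// add0e /A big_ord0 setD0.
  rewrite IH big_nat_recr//= -addeA; congr (_ + _)%E.
  rewrite AS /mu cylcontU//; first exact: mF.
  - exact: mA.
  - rewrite /A big_ord_recr/= -setDDl; apply/seteqP; split=> x //= [Fx [_]].
    by [].
have muA0 : mu (A n) @[n --> \oo] --> 0%E.
  have ndA : {homo A : n p / (n <= p)%N >-> p `<=` n}.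
    move=> n p /subnK <-; elim: (p - n)%N => [//|k IH]; apply: subset_trans IH.
    by rewrite [X in _ `<=` X]AS addSn; exact: subsetUr.
  have nmu : {homo mu \o A : n p / (n <= p)%N >-> (p <= n)%E}.
    by move=> n p np; apply: cylcont_le; [exact: mA|exact: mA|exact: ndA].
  have := ereal_nonincreasing_cvgn nmu.
  suff -> : ereal_inf (range (mu \o A)) = 0%E by [].
  apply/eqP; rewrite eq_le; apply/andP; split; last first.
    by apply: le_ereal_inf_tmp => _ [n _ <-]; exact: mu_ge0.
  apply/lee_addgt0Pr => e e0; rewrite add0e.
  have [[n An]|nA] := pselect (exists n, (mu (A n) < e%:E)%E).
    by apply: le_trans (ltW An); apply: ereal_inf_lbound; exists n.
  have [x Ax] : \bigcap_n A n !=set0.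
    apply: (@large_neq0 _ _ _ m); split => // [n|]; first exact: ndA.
    exists e => // n; rewrite leNgt; apply/negP => An; apply: nA.
    by exists n.
  have [[k _ Fkx]] := Ax 0%N I.
  by have [_] := Ax k.+1 I; case; rewrite -bigcup_mkord; exists k => /=.
have -> : (fun n => \sum_(0 <= i < n) mu (F i))%E =
    (fun n => mu (\bigcup_n F n) - mu (A n))%E.
  by apply/funext => n; rewrite (muS n) addeK// muf.
rewrite -[X in _ --> X]sube0; apply: cvgeB => //; last exact: cvg_cst.
by rewrite fin_num_adde_defl.
Qed.

HB.instance Definition _ := isMeasure.Build _ _ _ mu mu0 mu_ge0 mu_sigma_additive.

Lemma cyl_sigmaE : (measurable : set (set (seqspace T))) =
  <<s (measurable : set (set cylspace)) >>.
Proof.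
apply/seteqP; split.
  apply: smallest_sub; first exact: smallest_sigma_algebra.
  move=> _ [n _ [B mB <-]]; apply: sub_sigma_algebra; split.
    by have := measurable_coord n measurableT mB.
  exists n.+1 => x y xy [_ Bx]; split => //.
  by rewrite /preimage/= -xy.
by apply: smallest_sub; [exact: sigma_algebra_measurable|move=> A []].
Qed.

Definition infprod (A : set (seqspace T)) : \bar R := measure_extension mu A.

Let infprod0 : infprod set0 = 0%E. Proof. exact: measure0. Qed.
Let infprod_ge0 A : (0 <= infprod A)%E. Proof. exact: measure_ge0. Qed.
Let infprod_sigma_additive : semi_sigma_additive infprod.
Proof.
move=> F mF tF mU; apply: (@measure_semi_sigma_additive _ _ _ (measure_extension mu)) => //.
  by move=> i; have := mF i; rewrite cyl_sigmaE.
by move: mU; rewrite cyl_sigmaE.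
Qed.
HB.instance Definition _ := isMeasure.Build _ _ _ infprod
  infprod0 infprod_ge0 infprod_sigma_additive.

Lemma infprod_cyl A : is_cyl A -> infprod A = cylcont m A.
Proof. by move=> cA; rewrite /infprod /measure_extension measurable_mu_extE. Qed.

Let infprodT : infprod setT = 1%E.
Proof. by rewrite infprod_cyl ?cylcontT//; exact: is_cylT. Qed.
HB.instance Definition _ := Measure_isProbability.Build _ _ _ infprod infprodT.

End product.

Arguments infprod {d T R} m.

(** Both sides are finite measures that agree on cylinder sets by [cylcont_slice]. Splitting off the
    first factor is the recursion behind every expectation computed under [infprod]. *)
Lemma infprod_scons d (T : measurableType d) (R : realType)
    (m : nat -> probability T R) (A : set (seqspace T)) : measurable A ->
  infprod m A = pushforward (m 0%N \x infprod (fun n => m n.+1))%E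
    (fun ty : T * seqspace T => scons ty.1 ty.2 : seqspace T) A.
Proof.
move: A; have mc : measurable_fun [set: T * seqspace T]
    (fun ty => scons ty.1 ty.2 : seqspace T).
  by apply: measurable_scons; [exact: measurable_fst|exact: measurable_snd].
pose c (ty : T * seqspace T) : seqspace T := scons ty.1 ty.2.
pose P := (m 0%N \x infprod (fun n => m n.+1))%E.
move=> A mA; change (infprod m A = pushforward P c A).
apply: (@measure_unique _ _ _ (@is_cyl _ T) (fun=> setT)) => //.
- exact: cyl_sigmaE.
- by move=> B C ? ?; exact: (@measurableI _ (cylspace T)).
- by move=> _; exact: is_cylT.
- by rewrite bigcup_const.
- move=> {mA}A cA; have [mA _] := cA.
  change (infprod m A = pushforward P c A).
  rewrite infprod_cyl// cylcont_slice//.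
  rewrite /pushforward /P /product_measure1; apply: eq_integral => t _ /=.
  rewrite -infprod_cyl; last exact: is_cyl_slice.
  by congr (infprod _ _); apply/seteqP; split => y; rewrite /xsection/= inE.
- by move=> _; change (infprod m setT < +oo)%E; rewrite probability_setT ltry.
Qed.

(** * Complex-valued integrals *)

Section integrable_real.
Context {R : realType} d (T : measurableType d) (mu : {measure set T -> \bar R}).
Implicit Types f g : T -> R.

Lemma integrableRD f g : mu.-integrable setT (EFin \o f) ->
  mu.-integrable setT (EFin \o g) ->
  mu.-integrable setT (EFin \o (fun x => f x + g x)).
Proof.
move=> If Ig; rewrite (_ : _ \o _ = ((EFin \o f) \+ (EFin \o g))%E).
  exact: integrableD.
by apply/funext => x /=; rewrite EFinD.
Qed.

Lemma integrableRZ c f : mu.-integrable setT (EFin \o f) ->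
  mu.-integrable setT (EFin \o (fun x => c * f x)).
Proof.
move=> If; rewrite (_ : _ \o _ = (fun x => c%:E * (EFin \o f) x)%E).
  exact: integrableZl.
by apply/funext => x /=; rewrite EFinM.
Qed.

Lemma integrableRB f g : mu.-integrable setT (EFin \o f) ->
  mu.-integrable setT (EFin \o g) ->
  mu.-integrable setT (EFin \o (fun x => f x - g x)).
Proof.
move=> If Ig; rewrite (_ : _ \o _ = ((EFin \o f) \- (EFin \o g))%E).
  exact: integrableB.
by apply/funext => x /=; rewrite EFinB.
Qed.

End integrable_real.

Section complex_integral.
Context {R : realType}.
Implicit Types z w : R[i].

Lemma creD z w : complex.Re (z + w) = complex.Re z + complex.Re w.
Proof. by case: z => a b; case: w. Qed.
Lemma cimD z w : complex.Im (z + w) = complex.Im z + complex.Im w.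
Proof. by case: z => a b; case: w. Qed.
Lemma creM z w : complex.Re (z * w) =
  complex.Re z * complex.Re w - complex.Im z * complex.Im w.
Proof. by case: z => a b; case: w. Qed.
Lemma cimM z w : complex.Im (z * w) =
  complex.Re z * complex.Im w + complex.Im z * complex.Re w.
Proof. by case: z => a b; case: w. Qed.

Lemma normc_ge_absRe z : `|complex.Re z| <= normc z.
Proof.
case: z => a b /=; rewrite -sqrtr_sqr ler_wsqrtr// lerDl sqr_ge0//.
Qed.

Lemma normc_ge_absIm z : `|complex.Im z| <= normc z.
Proof.
case: z => a b /=; rewrite -sqrtr_sqr ler_wsqrtr// lerDr sqr_ge0//.
Qed.

Lemma normc_ge0 z : 0 <= normc z.
Proof. by case: z => a b; exact: sqrtr_ge0. Qed.

Lemma normc_cis (t : R) : normc (cis t) = 1.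
Proof. by rewrite /cis/= cos2Dsin2 sqrtr1. Qed.

Lemma cis0 : cis 0 = 1 :> R[i].
Proof. by rewrite /cis cos0 sin0. Qed.

Lemma cisN (t : R) : cis (- t) = (cis t)^-1.
Proof.
have n0 : cis t != 0.
  by apply/eqP => /(congr1 (@normc R)); rewrite normc_cis normc0 => /eqP; rewrite oner_eq0.
by apply: (mulfI n0); rewrite divff// -cisD subrr cis0.
Qed.

Context d (T : measurableType d).
Implicit Types (f g : T -> R[i]).

Definition cmeas f := measurable_fun setT (fun x => complex.Re (f x)) /\
  measurable_fun setT (fun x => complex.Im (f x)).

Lemma cmeasM f g : cmeas f -> cmeas g -> cmeas (fun x => f x * g x).
Proof.
move=> [rf mf] [rg mg]; split.
  by under eq_fun do rewrite creM; apply: measurable_funB; exact: measurable_funM.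
by under eq_fun do rewrite cimM; apply: measurable_funD; exact: measurable_funM.
Qed.

Lemma cmeasD f g : cmeas f -> cmeas g -> cmeas (fun x => f x + g x).
Proof.
move=> [rf mf] [rg mg]; split.
  by under eq_fun do rewrite creD; exact: measurable_funD.
by under eq_fun do rewrite cimD; exact: measurable_funD.
Qed.

Lemma cmeas_cst z : cmeas (fun=> z).
Proof. by split; exact: measurable_cst. Qed.

Lemma cmeas_prod I (r : seq I) (F : I -> T -> R[i]) :
  (forall i, cmeas (F i)) -> cmeas (fun x => \prod_(i <- r) F i x).
Proof.
move=> mF; elim: r => [|i r IH].
  by under [X in cmeas X]eq_fun do rewrite big_nil; exact: cmeas_cst.
by under [X in cmeas X]eq_fun do rewrite big_cons; exact: cmeasM.
Qed.

Lemma cmeas_cis (u : T -> R) : measurable_fun setT u -> cmeas (fun x => cis (u x)).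
Proof.
move=> mu; split => /=.
  by apply: measurableT_comp => //; apply: continuous_measurable_fun; exact: continuous_cos.
by apply: measurableT_comp => //; apply: continuous_measurable_fun; exact: continuous_sin.
Qed.

(** [cintegral] over an arbitrary measurable space; for measures on [borel G] the two are
    convertible. *)
Definition cint (mu : {measure set T -> \bar R}) f : R[i] :=
  Complex (\int[mu]_x complex.Re (f x)) (\int[mu]_x complex.Im (f x)).

Definition cintble (mu : {measure set T -> \bar R}) f :=
  mu.-integrable setT (EFin \o (fun x => complex.Re (f x))) /\
  mu.-integrable setT (EFin \o (fun x => complex.Im (f x))).

Lemma cintble_meas mu f : cintble mu f -> cmeas f.
Proof. by move=> [/measurable_int/measurable_EFinP rf /measurable_int/measurable_EFinP mf]. Qed.

Lemma eq_cint mu f g : f =1 g -> cint mu f = cint mu g.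
Proof. by move=> /funext ->. Qed.

Variable mu : {measure set T -> \bar R}.

Lemma cintD f g : cintble mu f -> cintble mu g ->
  cint mu (fun x => f x + g x) = cint mu f + cint mu g.
Proof.
move=> [f1 f2] [g1 g2]; apply/eqP; rewrite eq_complex /=.
under eq_Rintegral do rewrite creD.
under [X in _ && (X == _)]eq_Rintegral do rewrite cimD.
by rewrite !RintegralD// !eqxx.
Qed.

Lemma cintZ z f : cintble mu f -> cint mu (fun x => z * f x) = z * cint mu f.
Proof.
move=> [f1 f2]; apply/eqP; rewrite eq_complex creM cimM /=.
under eq_Rintegral do rewrite creM.
under [X in _ && (X == _)]eq_Rintegral do rewrite cimM.
rewrite RintegralB//; [|exact: integrableRZ|exact: integrableRZ].
rewrite RintegralD//; [|exact: integrableRZ|exact: integrableRZ].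
by rewrite !RintegralZl// !eqxx.
Qed.

Lemma cintbleD f g : cintble mu f -> cintble mu g -> cintble mu (fun x => f x + g x).
Proof.
move=> [f1 f2] [g1 g2]; split.
  by under [X in EFin \o X]eq_fun do rewrite creD; exact: integrableRD.
by under [X in EFin \o X]eq_fun do rewrite cimD; exact: integrableRD.
Qed.

Lemma cintbleZ z f : cintble mu f -> cintble mu (fun x => z * f x).
Proof.
move=> [f1 f2]; split.
  under [X in EFin \o X]eq_fun do rewrite creM.
  by apply: integrableRB; exact: integrableRZ.
under [X in EFin \o X]eq_fun do rewrite cimM.
by apply: integrableRD; exact: integrableRZ.
Qed.

Lemma cintbleP (b : T -> R) f : cmeas f -> (forall x, normc (f x) <= b x) ->
  mu.-integrable setT (EFin \o b) -> cintble mu f.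
Proof.
move=> [mf1 mf2] fb ib; split; apply: le_integrable ib => //.
- exact/measurable_EFinP.
- move=> x _ /=; rewrite lee_fin (le_trans (normc_ge_absRe _))// (le_trans (fb x))//.
  exact: ler_norm.
- exact/measurable_EFinP.
- move=> x _ /=; rewrite lee_fin (le_trans (normc_ge_absIm _))// (le_trans (fb x))//.
  exact: ler_norm.
Qed.

End complex_integral.

Lemma bounded_integrable d (T : measurableType d) (R : realType)
    (mu : {measure set T -> \bar R}) (f : T -> R) (M : R) :
  (mu setT < +oo)%E -> measurable_fun setT f -> (forall x, `|f x| <= M) ->
  mu.-integrable setT (EFin \o f).
Proof.
move=> muT mf fM; apply: (le_integrable measurableT (g := cst M%:E)).
- exact/measurable_EFinP.
- by move=> x _ /=; rewrite lee_fin (le_trans (fM x))// ler_norm.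
- apply/integrableP; split; first exact: measurable_cst.
  rewrite integral_cst//=; case: (mu setT) muT => //= [r _|_].
    by rewrite -EFinM ltry.
  have [->|M0] := eqVneq M 0; first by rewrite normr0 mul0e ltry.
  by rewrite gt0_muleNy ?ltNyr// lte_fin normr_gt0.
Qed.

Lemma bounded_cintble d (T : measurableType d) (R : realType)
    (mu : {measure set T -> \bar R}) (f : T -> R[i]) (M : R) :
  (mu setT < +oo)%E -> cmeas f -> (forall x, normc (f x) <= M) -> cintble mu f.
Proof.
move=> muT mf fM; apply: (cintbleP (b := fun=> M)) => //.
exact: (@bounded_integrable _ _ _ _ _ `|M|).
Qed.

Lemma cint_cst d (T : measurableType d) (R : realType) (P : probability T R) (z : R[i]) :
  cint P (fun=> z) = z.
Proof.
apply/eqP; rewrite eq_complex /= !Rintegral_cst//.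
have -> : fine (P setT) = 1 by rewrite probability_setT.
by rewrite !mulr1 !eqxx.
Qed.

Lemma cmeas_comp (R : realType) d d' (T : measurableType d) (X : measurableType d')
    (f : T -> R[i]) (g : X -> T) :
  cmeas f -> measurable_fun setT g -> cmeas (fun x => f (g x)).
Proof.
by move=> [f1 f2] mg; split; [exact: measurableT_comp f1 mg|exact: measurableT_comp f2 mg].
Qed.

(** * Image measures and product measures *)

Section transfer.
Context d d' (X : measurableType d) (Y : measurableType d') (R : realType).
Variables (phi : X -> Y) (mphi : measurable_fun setT phi).
Variables (mu : {measure set X -> \bar R}) (nu : {measure set Y -> \bar R}).
Hypothesis nuE : forall A, measurable A -> nu A = mu (phi @^-1` A).

Lemma ge0_integral_transfer (f : Y -> \bar R) : measurable_fun setT f ->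
  (forall y, 0 <= f y)%E -> (\int[nu]_y f y = \int[mu]_x f (phi x))%E.
Proof.
move=> mf f0; rewrite (eq_measure_integral (pushforward mu phi)).
  by rewrite ge0_integral_pushforward//= => y _.
by move=> A mA _; exact: nuE.
Qed.

Lemma integral_transfer (f : Y -> \bar R) : measurable_fun setT f ->
  (\int[nu]_y f y = \int[mu]_x f (phi x))%E.
Proof.
move=> mf; rewrite integralE [RHS]integralE; congr (_ - _)%E.
  transitivity (\int[mu]_x f^\+ (phi x))%E.
    by apply: ge0_integral_transfer => [|y]; [exact: measurable_funepos|exact: funepos_ge0].
  by apply: eq_integral => x _; rewrite !funeposE.
transitivity (\int[mu]_x f^\- (phi x))%E.
  by apply: ge0_integral_transfer => [|y]; [exact: measurable_funeneg|exact: funeneg_ge0].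
by apply: eq_integral => x _; rewrite !funenegE.
Qed.

Lemma cint_transfer (f : Y -> R[i]) : cmeas f ->
  cint nu f = cint mu (fun x => f (phi x)).
Proof.
move=> [mf1 mf2]; rewrite /cint /Rintegral; congr Complex; congr fine.
  by rewrite integral_transfer//; exact/measurable_EFinP.
by rewrite integral_transfer//; exact/measurable_EFinP.
Qed.

End transfer.

Lemma probability_lty d (T : measurableType d) (R : realType)
  (P : probability T R) : (P setT < +oo)%E.
Proof. by rewrite probability_setT ltry. Qed.

Section product.
Context d d' (X : measurableType d) (Y : measurableType d') (R : realType).
Variables (P : probability X R) (Q : probability Y R).

Lemma product_probT : (P \x Q)%E setT = 1%E.
Proof.
rewrite -setXTT; transitivity (P setT * Q setT)%E; first exact: product_measure1E.
by rewrite !probability_setT mule1.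
Qed.

HB.instance Definition _ := Measure_isProbability.Build _ _ _ (P \x Q)%E product_probT.

Definition prodprob : probability (X * Y)%type R := (P \x Q)%E.

Lemma Rintegral_prodM (f : X -> R) (g : Y -> R) (M : R) :
  measurable_fun setT f -> measurable_fun setT g ->
  (forall x, `|f x| <= M) -> (forall y, `|g y| <= M) ->
  \int[(P \x Q)%E]_z (f z.1 * g z.2) = \int[P]_x f x * \int[Q]_y g y.
Proof.
move=> mf mg fM gM.
have mfg : measurable_fun [set: X * Y] (fun z => f z.1 * g z.2).
  by apply: measurable_funM; apply: measurableT_comp.
have M0 (x : X) : 0 <= M by exact: le_trans (normr_ge0 (f x)) (fM x).
have ifg : (P \x Q)%E.-integrable setT (EFin \o (fun z : X * Y => f z.1 * g z.2)).
  apply: (@bounded_integrable _ _ _ (P \x Q)%E _ (M * M)) => [|//|z].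
    exact: (probability_lty prodprob).
  by rewrite normrM ler_pM.
rewrite /Rintegral -(integral12_prod_meas1 ifg) /fubini_F /=.
have ig : Q.-integrable setT (EFin \o g) by exact: bounded_integrable (probability_lty _) mg gM.
have if_ : P.-integrable setT (EFin \o f) by exact: bounded_integrable (probability_lty _) mf fM.
under eq_integral.
  move=> x _; under eq_integral do rewrite EFinM.
  rewrite integralZl//; over.
have [r ->] : exists r : R, (\int[Q]_y (g y)%:E)%E = r%:E.
  by exists (fine (\int[Q]_y (g y)%:E)%E); rewrite fineK// integrable_fin_num.
rewrite integralZr// fineM// integrable_fin_num//.
Qed.

Lemma cint_prodM (f : X -> R[i]) (g : Y -> R[i]) : cmeas f -> cmeas g ->
  (forall x, normc (f x) <= 1) -> (forall y, normc (g y) <= 1) ->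
  cint (P \x Q)%E (fun z => f z.1 * g z.2) = cint P f * cint Q g.
Proof.
move=> [f1 f2] [g1 g2] fM gM; apply/eqP; rewrite eq_complex creM cimM /=.
have rf x : `|complex.Re (f x)| <= 1 by exact: le_trans (normc_ge_absRe _) (fM x).
have mf x : `|complex.Im (f x)| <= 1 by exact: le_trans (normc_ge_absIm _) (fM x).
have rg x : `|complex.Re (g x)| <= 1 by exact: le_trans (normc_ge_absRe _) (gM x).
have mg x : `|complex.Im (g x)| <= 1 by exact: le_trans (normc_ge_absIm _) (gM x).
have K (u : X -> R) (v : Y -> R) : measurable_fun setT u -> measurable_fun setT v ->
    (forall x, `|u x| <= 1) -> (forall x, `|v x| <= 1) ->
    (P \x Q)%E.-integrable setT (EFin \o (fun z : X * Y => u z.1 * v z.2)).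
  move=> mu mv u1 v1; apply: (@bounded_integrable _ _ _ (P \x Q)%E _ 1) => [||z].
  - exact: (probability_lty prodprob).
    by apply: measurable_funM; apply: measurableT_comp.
  by rewrite normrM mulr_ile1.
rewrite (_ : (fun z : X * Y => complex.Re (f z.1 * g z.2)) = (fun z =>
    complex.Re (f z.1) * complex.Re (g z.2) -
    complex.Im (f z.1) * complex.Im (g z.2))); last first.
  by apply/funext => z; rewrite creM.
rewrite (_ : (fun z : X * Y => complex.Im (f z.1 * g z.2)) = (fun z =>
    complex.Re (f z.1) * complex.Im (g z.2) +
    complex.Im (f z.1) * complex.Re (g z.2))); last first.
  by apply/funext => z; rewrite cimM.
rewrite RintegralB//; [|exact: (K _ _ f1 g1 rf rg)|exact: (K _ _ f2 g2 mf mg)].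
rewrite RintegralD//; [|exact: (K _ _ f1 g2 rf mg)|exact: (K _ _ f2 g1 mf rg)].
by rewrite (Rintegral_prodM f1 g1 rf rg) (Rintegral_prodM f2 g2 mf mg)
  (Rintegral_prodM f1 g2 rf mg) (Rintegral_prodM f2 g1 mf rg) !eqxx.
Qed.

End product.

(** * The complex exponential and the Poisson law *)

Section complex_exponential_series.
Context {R : realType}.
Implicit Types z w : R[i].

Lemma cexpD z w : cexp (z + w) = cexp z * cexp w.
Proof.
rewrite /cexp creD cimD expRD cisD rmorphM/=; ring.
Qed.

Lemma cexp0 : cexp 0 = 1 :> R[i].
Proof. by rewrite /cexp /= expR0 cis0 mul1r. Qed.

Lemma Re_cexp z : complex.Re (cexp z) = expR (complex.Re z) * cos (complex.Im z).
Proof. by rewrite /cexp creM /= mul0r subr0. Qed.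

Lemma Im_cexp z : complex.Im (cexp z) = expR (complex.Re z) * sin (complex.Im z).
Proof. by rewrite /cexp cimM /= mul0r addr0. Qed.

Lemma normc_exp z n : normc (z ^+ n) = normc z ^+ n.
Proof. by elim: n => [|n IH]; rewrite ?expr0 ?normc1// !exprS normcM IH. Qed.

Section series.
Variable z : R[i].
Let al := complex.Re z.
Let be := complex.Im z.
Let a n : R := complex.Re (z ^+ n) * n`!%:R^-1.
Let b n : R := complex.Im (z ^+ n) * n`!%:R^-1.

Let bound (u : nat -> R) (x : R) : (forall n, `|u n| <= normc z ^+ n) ->
  cvgn (pseries (fun n => u n * n`!%:R^-1) x).
Proof.
move=> uz; apply: normed_cvg.
apply: series_le_cvg (is_cvg_series_exp_coeff (normc z * `|x|)) => [n|n|n].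
- exact: normr_ge0.
- by rewrite /exp_coeff/= divr_ge0// exprn_ge0// mulr_ge0// normc_ge0.
- rewrite /exp_coeff /= !normrM normrX exprMn mulrAC.
  by rewrite normfV normr_nat ler_wpM2r// ler_wpM2r ?exprn_ge0.
Qed.

Let cva x : cvgn (pseries a x).
Proof. by apply: bound => n; rewrite -normc_exp normc_ge_absRe. Qed.
Let cvb x : cvgn (pseries b x).
Proof. by apply: bound => n; rewrite -normc_exp normc_ge_absIm. Qed.

Let lin (c e : R) x : pseries (fun n => c * a n + e * b n) x @ \oo -->
  c * limn (pseries a x) + e * limn (pseries b x).
Proof.
have -> : pseries (fun n => c * a n + e * b n) x =
    (fun n => c * pseries a x n + e * pseries b x n).
  apply/funext => n; rewrite /pseries /series /= !mulr_sumr -big_split /=.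
  by apply: eq_bigr => i _; ring.
by apply: cvgD; (apply: cvgM; [exact: cvg_cst|]); [exact: cva|exact: cvb].
Qed.

Let da : pseries_diffs a = (fun n => al * a n + (- be) * b n).
Proof.
apply/funext => n; rewrite /pseries_diffs /a /b exprS creM factS natrM invfM.
have n0 : n.+1%:R != 0 :> R by rewrite pnatr_eq0.
have f0 : n`!%:R != 0 :> R by rewrite pnatr_eq0 -lt0n fact_gt0.
rewrite -/al -/be; move: (n.+1%:R) n0 (n`!%:R) f0 => s s0 t t0.
by field; rewrite ?s0 ?t0.
Qed.

Let db : pseries_diffs b = (fun n => be * a n + al * b n).
Proof.
apply/funext => n; rewrite /pseries_diffs /a /b exprS cimM factS natrM invfM.
have n0 : n.+1%:R != 0 :> R by rewrite pnatr_eq0.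
have f0 : n`!%:R != 0 :> R by rewrite pnatr_eq0 -lt0n fact_gt0.
rewrite -/al -/be; move: (n.+1%:R) n0 (n`!%:R) f0 => s s0 t t0.
by field; rewrite ?s0 ?t0.
Qed.

Let dlin c e : pseries_diffs (fun n => c * a n + e * b n) =
  (fun n => c * pseries_diffs a n + e * pseries_diffs b n).
Proof. by apply/funext => n; rewrite /pseries_diffs; ring. Qed.

Let cvlin c e x : cvgn (pseries (fun n => c * a n + e * b n) x).
Proof. by apply/cvg_ex; eexists; exact: lin. Qed.

Let A x := limn (pseries a x).
Let B x := limn (pseries b x).

Let cvdd c e x : cvgn (pseries (pseries_diffs (fun n => c * a n + e * b n)) x).
Proof.
rewrite dlin da db.
under [X in pseries X]eq_fun => n.
  rewrite (_ : _ + _ = (c * al + e * be) * a n + (c * - be + e * al) * b n); last by ring.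
  over.
exact: cvlin.
Qed.

Let dA x : is_derive x (1 : R) A (al * A x - be * B x).
Proof.
rewrite -mulNr; have <- := cvg_lim (@Rhausdorff R) (@lin al (- be) x).
rewrite -da; apply: (@pseries_snd_diffs _ _ (`|x| + 1)) => //.
- by rewrite da; exact: cvlin.
- by rewrite da; exact: cvdd.
- by rewrite [ltRHS]ger0_norm// ltrDl.
Qed.

Let dB x : is_derive x (1 : R) B (be * A x + al * B x).
Proof.
have <- := cvg_lim (@Rhausdorff R) (@lin be al x).
rewrite -db; apply: (@pseries_snd_diffs _ _ (`|x| + 1)) => //.
- by rewrite db; exact: cvlin.
- by rewrite db; exact: cvdd.
- by rewrite [ltRHS]ger0_norm// ltrDl.
Qed.

(* [A] and [B] solve the linear system satisfied by [expR (al * x) * cos (be * x)]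
   and [expR (al * x) * sin (be * x)], so that rotating back gives constants. *)
Let G x := expR (- al * x) * (cos (be * x) * A x + sin (be * x) * B x).
Let H x := expR (- al * x) * (cos (be * x) * B x - sin (be * x) * A x).

Let dlinear (c x : R) : is_derive x (1 : R) (fun x => c * x) c.
Proof. by apply: is_derive_eq; rewrite ?mulr0 ?scaler0 ?addr0 /GRing.scale/= ?mulr1. Qed.

Let dE x : is_derive x (1 : R) (fun x => expR (- al * x)) (- al * expR (- al * x)).
Proof.
have := is_derive1_comp (is_derive_expR (- al * x)) (dlinear (- al) x).
by rewrite mulrC.
Qed.

Let dC x : is_derive x (1 : R) (fun x => cos (be * x)) (- be * sin (be * x)).
Proof.
have := is_derive1_comp (is_derive_cos (be * x)) (dlinear be x).
by rewrite mulrC mulrN mulNr.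
Qed.

Let dS x : is_derive x (1 : R) (fun x => sin (be * x)) (be * cos (be * x)).
Proof.
have := is_derive1_comp (is_derive_sin (be * x)) (dlinear be x).
by rewrite mulrC.
Qed.

Let dG x : is_derive x (1 : R) G 0.
Proof.
have := dA x; have := dB x; have := dE x; have := dC x; have := dS x => *.
apply: is_derive_eq; rewrite /GRing.scale /=; ring.
Qed.

Let dH x : is_derive x (1 : R) H 0.
Proof.
have := dA x; have := dB x; have := dE x; have := dC x; have := dS x => *.
apply: is_derive_eq; rewrite /GRing.scale /=; ring.
Qed.

Let at0 (u : nat -> R) : limn (pseries u 0) = u 0%N.
Proof.
apply/cvg_lim => //; apply: cvg_near_cst; near=> n; rewrite /pseries /series /=.
have n0 : (0 < n)%N by near: n; exists 1%N.
rewrite -(prednK n0) big_nat_recl// expr0 mulr1 big1 ?addr0// => i _.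
by rewrite expr0n/= mulr0.
Unshelve. all: by end_near. Qed.

(** The series is the value at 1 of [A + iB], the sum of [z ^ n x ^ n / n!] as a power series in a
    real variable [x], so real differentiation suffices. The constants [G] and [H] are evaluated at
    0, and [cos ^ 2 + sin ^ 2 = 1] solves for [A 1] and [B 1]. *)
Lemma cexp_series :
  (series (fun n => complex.Re (z ^+ n) * n`!%:R^-1) @ \oo --> complex.Re (cexp z)) /\
  (series (fun n => complex.Im (z ^+ n) * n`!%:R^-1) @ \oo --> complex.Im (cexp z)).
Proof.
have G1 : G 1 = 1.
  rewrite (@is_derive_0_is_cst _ G 1 0 dG) /G !mulr0 expR0 cos0 sin0.
  by rewrite /A at0 /a expr0 fact0 /= invr1; ring.
have H1 : H 1 = 0.
  rewrite (@is_derive_0_is_cst _ H 1 0 dH) /H !mulr0 expR0 cos0 sin0.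
  by rewrite /A /B !at0 /a /b expr0 fact0 /= invr1; ring.
have E1 : expR al * expR (- al * 1) = 1 by rewrite -expRD mulr1 subrr expR0.
have CS := cos2Dsin2 be.
have A1 : A 1 = expR al * cos be.
  transitivity (expR al * (cos be * G 1 - sin be * H 1)); last by rewrite G1 H1; ring.
  rewrite /G /H !mulr1 in E1 *.
  transitivity ((expR al * expR (- al)) * (cos be ^+ 2 + sin be ^+ 2) * A 1).
    by rewrite E1 CS !mul1r.
  by ring.
have B1 : B 1 = expR al * sin be.
  transitivity (expR al * (sin be * G 1 + cos be * H 1)); last by rewrite G1 H1; ring.
  rewrite /G /H !mulr1 in E1 *.
  transitivity ((expR al * expR (- al)) * (cos be ^+ 2 + sin be ^+ 2) * B 1).
    by rewrite E1 CS !mul1r.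
  by ring.
have E u : series u = pseries u (1 : R).
  by rewrite /pseries; congr series; apply/funext => n /=; rewrite expr1n mulr1.
rewrite Re_cexp Im_cexp -/al -/be -A1 -B1 !E; split; [exact: cva|exact: cvb].
Qed.

End series.
End complex_exponential_series.

Lemma series_cvg_Rintegral_nat (R : realType) (mu : probability nat R) (f : nat -> R) (M : R) :
  (forall n, `|f n| <= M) ->
  series (fun n => f n * fine (mu [set n])) @ \oo --> \int[mu]_n f n.
Proof.
move=> fM.
have If : mu.-integrable setT (EFin \o f).
  exact: bounded_integrable (probability_lty mu) _ fM.
have S0 : \bigcup_n [set n] = [set: nat].
  by apply/seteqP; split => // n _; exists n.
have := @integral_bigcup _ _ R mu (fun n => [set n]) (EFin \o f).
rewrite S0 => /(_ _ _ If) IE.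
have {}IE : (\int[mu]_n (f n)%:E = \sum_(i <oo) (f i * fine (mu [set i]))%:E)%E.
  rewrite [LHS]IE//; last first.
    by apply/trivIsetP => i j _ _ /eqP ij; rewrite -subset0 => x [/= -> /ij].
  apply: eq_eseriesr => i _; transitivity (\int[mu]_(x in [set i]) (f i)%:E)%E.
    by apply: eq_integral => x; rewrite inE => ->.
  by rewrite integral_cst//= EFinM fineK// fin_num_measure.
have cmu : cvgn (series (fun n => fine (mu [set n]))).
  have : (fun n => \sum_(0 <= i < n) mu [set i])%E @ \oo --> mu setT.
    rewrite -S0; apply: measure_semi_sigma_additive => //.
    by apply/trivIsetP => i j _ _ /eqP ij; rewrite -subset0 => x [/= -> /ij].
  rewrite probability_setT => /fine_cvg cv; apply/cvg_ex; exists 1.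
  apply: cvg_trans cv; apply: near_eq_cvg; near=> n.
  rewrite /series/= -sum_fine// => i _; exact: fin_num_measure.
have cf : cvgn (series (fun n => f n * fine (mu [set n]))).
  have cM : cvgn (series (fun n => M * fine (mu [set n]))).
    apply/cvg_ex; exists (M * limn (series (fun n => fine (mu [set n])))).
    rewrite (_ : series _ = (fun n => M * series (fun n => fine (mu [set n])) n)).
      by apply: cvgM => //; exact: cvg_cst.
    by apply/funext => n; rewrite /series/= mulr_sumr.
  apply: normed_cvg; apply: series_le_cvg cM => n.
  - exact: normr_ge0.
  - apply: mulr_ge0; last by apply: fine_ge0.
    exact: le_trans (normr_ge0 (f n)) (fM n).
  - by rewrite /= normrM (@ger0_norm _ (fine _)) ?fine_ge0// ler_wpM2r ?fine_ge0.
rewrite /Rintegral IE.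
have -> : (\sum_(i <oo) (f i * fine (mu [set i]))%:E)%E =
    (limn (series (fun n => f n * fine (mu [set n]))))%:E.
  rewrite -EFin_lim//; congr (limn _); apply/funext => n.
  by rewrite /series/= sumEFin.
exact: cf.
Unshelve. all: by end_near. Qed.

(** The generating function of the Poisson law on the closed unit disc: its real and imaginary parts
    are the series of [cexp_series] at [la w], multiplied by [expR (- la)]. *)
Lemma cint_poisson (R : realType) (la : R) (w : R[i]) : 0 < la -> normc w <= 1 ->
  cint (poisson_prob la 0) (fun n => w ^+ n) = cexp (la%:C%C * (w - 1)).
Proof.
move=> la0 w1.
have pE n : fine (poisson_prob la 0 [set n]) = la ^+ n * n`!%:R^-1 * expR (- la).
  rewrite /poisson_prob la0 esum_set1/= ?/poisson_pmf ?la0//.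
  by rewrite lee_fin mulr_ge0 ?expR_ge0// divr_ge0// exprn_ge0// ltW.
have wn n : normc (w ^+ n) <= 1 by rewrite normc_exp exprn_ile1// normc_ge0.
have [cr ci] := cexp_series (la%:C%C * w).
have crE n : complex.Re (w ^+ n) * fine (poisson_prob la 0 [set n]) =
    expR (- la) * (complex.Re ((la%:C%C * w) ^+ n) * n`!%:R^-1).
  by rewrite pE exprMn -rmorphXn creM /= mul0r subr0; ring.
have ciE n : complex.Im (w ^+ n) * fine (poisson_prob la 0 [set n]) =
    expR (- la) * (complex.Im ((la%:C%C * w) ^+ n) * n`!%:R^-1).
  by rewrite pE exprMn -rmorphXn cimM /= mul0r addr0; ring.
have sZ (u : nat -> R) c : series (fun n => c * u n) = (fun n => c * series u n).
  by apply/funext => n; rewrite /series/= mulr_sumr.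
have hr : \int[poisson_prob la 0]_n complex.Re (w ^+ n) =
    expR (- la) * complex.Re (cexp (la%:C%C * w)).
  apply: (@cvg_unique _ _ (series (fun n => complex.Re (w ^+ n) * fine (poisson_prob la 0 [set n])) @ \oo)) => //.
    apply: (@series_cvg_Rintegral_nat _ _ _ 1) => n.
    exact: le_trans (normc_ge_absRe _) (wn n).
  rewrite /= (funext crE) sZ; apply: cvgM => //; exact: cvg_cst.
have hi : \int[poisson_prob la 0]_n complex.Im (w ^+ n) =
    expR (- la) * complex.Im (cexp (la%:C%C * w)).
  apply: (@cvg_unique _ _ (series (fun n => complex.Im (w ^+ n) * fine (poisson_prob la 0 [set n])) @ \oo)) => //.
    apply: (@series_cvg_Rintegral_nat _ _ _ 1) => n.
    exact: le_trans (normc_ge_absIm _) (wn n).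
  rewrite /= (funext ciE) sZ; apply: cvgM => //; exact: cvg_cst.
rewrite mulrBr mulr1 addrC cexpD; apply/eqP; rewrite eq_complex creM cimM /= hr hi.
by rewrite Re_cexp Im_cexp /= oppr0 cos0 sin0; apply/andP; split; apply/eqP; ring.
Qed.

(** * Expectations under infinite products and compound Poisson laws *)

Lemma cint_Fubini d d' (X : measurableType d) (Y : measurableType d') (R : realType)
    (P : probability X R) (Q : probability Y R) (f : X * Y -> R[i]) (M : R) :
  cmeas f -> (forall z, normc (f z) <= M) ->
  cint (P \x Q)%E f = cint P (fun x => cint Q (fun y => f (x, y))).
Proof.
have K (u : X * Y -> R) : measurable_fun setT u -> (forall z, `|u z| <= M) ->
    \int[(P \x Q)%E]_z u z = \int[P]_x \int[Q]_y u (x, y).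
  move=> mu uM.
  have iu : (P \x Q)%E.-integrable setT (EFin \o u).
    exact: bounded_integrable (probability_lty (prodprob P Q)) mu uM.
  rewrite {1}/Rintegral -(integral12_prod_meas1 iu) /fubini_F /= /Rintegral.
  congr fine; apply: eq_integral => x _; rewrite fineK// integrable_fin_num//.
  apply: (@bounded_integrable _ _ _ _ (fun y => u (x, y)) M) => //.
    exact: probability_lty.
  exact: (measurableT_comp mu (measurable_pair1 x)).
move=> [f1 f2] fM; apply/eqP; rewrite eq_complex /=; apply/andP; split; apply/eqP.
  by rewrite K// => z; exact: le_trans (normc_ge_absRe _) (fM z).
by rewrite K// => z; exact: le_trans (normc_ge_absIm _) (fM z).
Qed.

Lemma measurable_fun_nat_prod d d' (X : measurableType d) (Y : measurableType d')
    (f : nat * X -> Y) :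
  (forall n, measurable_fun setT (fun x => f (n, x))) -> measurable_fun setT f.
Proof.
move=> mf _ B mB; rewrite setTI.
have -> : f @^-1` B = \bigcup_n ([set n] `*` ((fun x => f (n, x)) @^-1` B)).
  apply/seteqP; split => [[n x] Bx|[n x] [m _ [/= -> Bx]]] //.
  by exists n.
apply: bigcupT_measurable => n; apply: measurableX => //.
by have := mf n measurableT B mB; rewrite setTI.
Qed.

Section infprod_expectation.
Context d (T : measurableType d) (R : realType).

Lemma normc_prod_le1 I (r : seq I) (F : I -> R[i]) : (forall i, normc (F i) <= 1) ->
  normc (\prod_(i <- r) F i) <= 1.
Proof.
move=> F1; elim: r => [|i r IH]; first by rewrite big_nil normc1.
by rewrite big_cons normcM mulr_ile1// normc_ge0.
Qed.

Lemma cint_infprod (m : nat -> probability T R) (F : nat -> T -> R[i]) K :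
  (forall k, cmeas (F k)) -> (forall k t, normc (F k t) <= 1) ->
  cint (infprod m) (fun x => \prod_(k < K) F k (x k)) =
  \prod_(k < K) cint (m k) (F k).
Proof.
move=> mF F1; elim: K m F mF F1 => [|K IH] m F mF F1.
  rewrite big_ord0; transitivity (cint (infprod m) (fun=> 1)); last exact: cint_cst.
  by apply: eq_cint => x; rewrite big_ord0.
have mp (m' : nat -> T -> R[i]) n : (forall k, cmeas (m' k)) ->
    cmeas (fun x : seqspace T => \prod_(k < n) m' k (x k)).
  move=> mm'; apply: cmeas_prod => k; apply: cmeas_comp => //; exact: measurable_coord.
have mc : measurable_fun [set: T * seqspace T]
    (fun ty => scons ty.1 ty.2 : seqspace T).
  by apply: measurable_scons; [exact: measurable_fst|exact: measurable_snd].
rewrite (cint_transfer (phi := fun ty : T * seqspace T => scons ty.1 ty.2 : seqspace T)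
  mc (mu := prodprob (m 0%N) (infprod (fun n => m n.+1)))); last 2 first.
- by move=> A mA; exact: infprod_scons.
- exact: mp.
rewrite big_ord_recl -(IH (fun n => m n.+1) (fun n => F n.+1))//.
rewrite -cint_prodM//=; last 2 first.
- exact: (mp (fun n => F n.+1)).
- by move=> y; apply: normc_prod_le1.
by apply: eq_cint => z; rewrite big_ord_recl.
Qed.

End infprod_expectation.

(** If [w] is the integral, then [|w| ^ 2] is the integral of the real part of [w^* F], hence at
    most [|w|]. The bound places the transform of a jump law in the disc where [cint_poisson]
    applies. *)
Lemma normc_cint_le1 d (T : measurableType d) (R : realType) (P : probability T R)
    (F : T -> R[i]) : cmeas F -> (forall x, normc (F x) <= 1) ->
  normc (cint P F) <= 1.
Proof.
move=> mF F1; set w := cint P F.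
have IF : cintble P F by exact: bounded_cintble (probability_lty P) mF F1.
have w2 : normc w * normc w <= normc w.
  have -> : normc w * normc w = complex.Re (w^*%C * w).
    case: (w) => a b; rewrite creM /= -expr2 sqr_sqrtr ?addr_ge0 ?sqr_ge0//; ring.
  have -> : w^*%C * w = cint P (fun x => w^*%C * F x) by rewrite cintZ.
  rewrite [X in X <= _]/=.
  have -> : normc w = \int[P]_x normc w.
    rewrite Rintegral_cst//; have -> : fine (P setT) = 1 by rewrite probability_setT.
    by rewrite mulr1.
  apply: le_Rintegral => //.
  - by have [] := cintbleZ w^*%C IF.
  - exact: (bounded_integrable (M := `|normc w|) (probability_lty P)).
  - move=> x _; apply: le_trans (ler_norm _) _.
    apply: le_trans (normc_ge_absRe _) _.
    rewrite normcM -[leRHS]mulr1 (_ : normc w^*%C = normc w) ?ler_wpM2l ?normc_ge0//.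
    by case: (w) => a b /=; rewrite sqrrN.
have := normc_ge0 w; rewrite le_eqVlt => /orP[/eqP <-//|w0].
by rewrite -(ler_pM2l w0) mulr1.
Qed.

Section compound_poisson.
Context d (S : measurableType d) (R : realType) (la : R) (nu : probability S R).

(** A point is a number of jumps together with an infinite sequence of jumps, of which only the
    first [w.1] count. Keeping the jumps rather than their sum allows several functions of the same
    jumps to be summed jointly. *)
Definition compound_poisson : probability (nat * seqspace S)%type R :=
  prodprob (poisson_prob la 0) (infprod (fun=> nu)).

Lemma cmeas_compound (F : S -> R[i]) : cmeas F ->
  cmeas (fun w : nat * seqspace S => \prod_(i < w.1) F (w.2 i)).
Proof.
move=> mF; have mp n : cmeas (fun x : seqspace S => \prod_(i < n) F (x i)).
  by apply: cmeas_prod => k; apply: cmeas_comp => //; exact: measurable_coord.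
by split; apply: measurable_fun_nat_prod => n; have [] := mp n.
Qed.

Lemma measurable_compound_sum (J : S -> R) : measurable_fun setT J ->
  measurable_fun setT (fun w : nat * seqspace S => \sum_(i < w.1) J (w.2 i)).
Proof.
move=> mJ; apply: measurable_fun_nat_prod => n /=.
apply: measurable_sum => i; apply: measurableT_comp => //; exact: measurable_coord.
Qed.

(** Given the number [n] of jumps, the expectation is the [n]-th power of the transform of one jump,
    to which the Poisson generating function applies. *)
Lemma cint_compound_poisson (F : S -> R[i]) : 0 < la -> cmeas F ->
  (forall x, normc (F x) <= 1) ->
  cint compound_poisson (fun w => \prod_(i < w.1) F (w.2 i)) =
  cexp (la%:C%C * (cint nu F - 1)).
Proof.
move=> la0 mF F1.
rewrite (@cint_Fubini _ _ _ _ _ _ _ _ 1)//; last 2 first.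
- exact: cmeas_compound.
- by move=> z; exact: normc_prod_le1.
rewrite -cint_poisson//; last exact: normc_cint_le1.
apply: eq_cint => n /=.
by rewrite (cint_infprod (fun=> nu) (F := fun=> F))// prodr_const card_ord.
Qed.

End compound_poisson.

(** * Borel structure of the solenoid *)

Lemma bigcup_countType_measurable d (T : measurableType d) (I : countType)
    (P : set I) (F : I -> set T) : (forall i, P i -> measurable (F i)) ->
  measurable (\bigcup_(i in P) F i).
Proof.
move=> mF.
rewrite (_ : \bigcup_(i in P) F i = \bigcup_n
    (if unpickle n is Some i then [set x | P i /\ F i x] else set0)).
  apply: bigcupT_measurable => n; case: (unpickle n) => [i|]; last exact: measurable0.
  have [Pi|nPi] := pselect (P i).
    by rewrite (_ : mkset _ = F i); [exact: mF|apply/seteqP; split => x // []].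
  by rewrite (_ : mkset _ = set0); [exact: measurable0|apply/seteqP; split => x // []].
apply/seteqP; split => [x [i Pi Fix]|x [n _]].
  by exists (pickle i) => //; rewrite pickleK.
by case: (unpickle n) => // i [Pi Fix]; exists i.
Qed.

Section circle_facts.
Context {R : realType}.

Lemma cvg_complex T (F : set_system T) {FF : Filter F} (f : T -> R[i]) (z : R[i]) :
  (fun t => complex.Re (f t)) @ F --> complex.Re z ->
  (fun t => complex.Im (f t)) @ F --> complex.Im z -> f @ F --> z.
Proof.
move=> /cvgrPdist_lt rf /cvgrPdist_lt mf; apply/cvgrPdist_lt => e.
case: e => e e'; rewrite ltcE /= => /andP[/eqP -> e0].
have e20 : 0 < e / 2 by rewrite divr_gt0.
near=> t.
have : `|complex.Re z - complex.Re (f t)| < e / 2 by near: t; exact: rf.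
have : `|complex.Im z - complex.Im (f t)| < e / 2 by near: t; exact: mf.
move: (f t) => [a b]; case: (z) => c d /= h1 h2.
rewrite -[_ - _]/((c - a) +i* (d - b))%C normc_def ltcR /=.
rewrite -(ger0_norm (ltW e0)) -sqrtr_sqr ltr_sqrt ?exprn_gt0//.
have := ltr_norml; rewrite -(@real_normK _ (c - a)) ?num_real// -(@real_normK _ (d - b)) ?num_real//.
move: (normr_ge0 (c - a)) (normr_ge0 (d - b)) h1 h2; nra.
Unshelve. all: by end_near. Qed.

Lemma continuous_Re : continuous (@complex.Re R).
Proof.
move=> z; apply/(@cvgrPdist_lt _ _ _ (nbhs z) (nbhs_filter z)) => e e0; near=> w.
have : `|z - w| < e%:C%C.
  by near: w; exists e%:C%C; rewrite //= ltcR.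
rewrite -[X in X < _ -> _]/((normc (z - w))%:C)%C ltcR; apply: le_lt_trans.
by case: (z) (w) => a b [c d]; exact: (normc_ge_absRe ((a - c) +i* (b - d))%C).
Unshelve. all: by end_near. Qed.

Lemma continuous_Im : continuous (@complex.Im R).
Proof.
move=> z; apply/(@cvgrPdist_lt _ _ _ (nbhs z) (nbhs_filter z)) => e e0; near=> w.
have : `|z - w| < e%:C%C.
  by near: w; exists e%:C%C; rewrite //= ltcR.
rewrite -[X in X < _ -> _]/((normc (z - w))%:C)%C ltcR; apply: le_lt_trans.
by case: (z) (w) => a b [c d]; exact: (normc_ge_absIm ((a - c) +i* (b - d))%C).
Unshelve. all: by end_near. Qed.

Lemma continuous_borel_measurable (G : topologicalZmodType) (f : G -> R) :
  continuous f -> measurable_fun [set: borel G] f.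
Proof.
move=> /continuousP cf; apply: (measurability _ (RGenOpens.measurableE R)).
move=> _ [_ [a [b ->] <-]]; rewrite setTI; apply: sub_sigma_algebra.
by apply: cf; exact: interval_open.
Qed.

Lemma cvg_initial (Y : choiceType) (Z : topologicalType) (w : Y -> Z) (X : Type)
    (F : set_system X) {FF : Filter F} (f : X -> initial_topology w)
    (l : initial_topology w) :
  (w \o f) @ F --> w l -> f @ F --> l.
Proof.
move=> cf U [?/= [[W oW <-]]] /= Wl /filterS; apply; apply: cf.
exact: open_nbhs_nbhs.
Qed.

Lemma expi_val (z : circle R) : cis (arg z) = val z.
Proof. by rewrite -[in RHS](expi_arg z). Qed.

Lemma cos_arg (z : circle R) : cos (arg z) = complex.Re (val z).
Proof. by rewrite -expi_val. Qed.

Lemma sin_arg (z : circle R) : sin (arg z) = complex.Im (val z).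
Proof. by rewrite -expi_val. Qed.

Lemma cis_inj (s t : R) : - pi <= s < pi -> - pi <= t < pi -> cis s = cis t -> s = t.
Proof.
move=> /andP[s1 s2] /andP[t1 t2] st.
have : cis (s - t) = 1 by rewrite cisD cisN st divff// -[cis t]/(val (expi t)) circle_neq0.
move=> /cis_eq1 [k]; have pi0 := pi_gt0 R => sk.
have k1 : -1 < k.
  by rewrite -(ltr_int R) -(ltr_pM2r (pi2_gt0 R)) -sk; lra.
have k2 : k < 1.
  by rewrite -(ltr_int R) -(ltr_pM2r (pi2_gt0 R)) -sk; lra.
have k0 : k = 0 by lia.
by apply/eqP; rewrite -subr_eq0 sk k0 mul0r.
Qed.

Lemma argE (t : R) (z : circle R) : - pi <= t < pi -> cis t = val z -> arg z = t.
Proof. by move=> tpi tz; apply: cis_inj (arg_itv z) tpi _; rewrite expi_val tz. Qed.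

(** The half-angle formula [tan (t / 2) = sin t / (1 + cos t)]; it exhibits the discontinuous [arg]
    as a measurable function of the two real coordinates. *)
Lemma arg_atan (z : circle R) : arg z =
  if complex.Re (val z) == -1 then - pi
  else 2 * atan (complex.Im (val z) / (1 + complex.Re (val z))).
Proof.
have pi0 := pi_gt0 R.
case: ifPn => [/eqP rz|rz].
  apply: argE; first by lra.
  rewrite -expi_val /cis cosN sinN cospi sinpi oppr0 cos_arg rz sin_arg.
  congr Complex; have := cos2Dsin2 (arg z); rewrite cos_arg sin_arg rz => h.
  by apply/esym/eqP; rewrite -sqrf_eq0; apply/eqP; lra.
have /andP[a1 a2] := arg_itv z.
have a1' : - pi < arg z.
  rewrite lt_neqAle a1 andbT; apply: contra rz => /eqP e.
  by rewrite -cos_arg -e cosN cospi.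
rewrite -cos_arg -sin_arg; set t := arg z in a1' a2 *.
have c0 : cos (t / 2) != 0.
  by rewrite gt_eqF// cos_gt0_pihalf//; apply/andP; split; lra.
have tE : t = t / 2 + t / 2 by rewrite -splitr.
have -> : sin t / (1 + cos t) = tan (t / 2).
  have s2 := cos2Dsin2 (t / 2).
  rewrite tE sinD cosD -tE /tan.
  have -> : 1 + (cos (t / 2) * cos (t / 2) - sin (t / 2) * sin (t / 2)) =
    2 * cos (t / 2) ^+ 2 by rewrite -[X in X + _ = _]s2; ring.
  by field.
rewrite tanK; first by field.
by rewrite in_itv/=; apply/andP; split; lra.
Qed.

Lemma measurable_fun_invr : measurable_fun setT (fun x : R => x^-1).
Proof.
have -> : [set: R] = [set x | x != 0] `|` [set 0].
  by apply/seteqP; split => // x _; have [->|x0] := eqVneq x 0; [right|left].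
have o : open [set x : R | x != 0].
  by rewrite (_ : mkset _ = ~` [set 0]); [apply: closed_openC; exact: (accessible_closed_set1 (hausdorff_accessible (@Rhausdorff R)))|apply/seteqP; split => x /eqP].
apply/measurable_funU => //; first exact: open_measurable.
split; last exact: measurable_fun_set1.
by apply: open_continuous_measurable_fun => // x; rewrite inE /= => x0; exact: inv_continuous.
Qed.

Lemma measurable_arg d (T : measurableType d) (f : T -> circle R) :
  cmeas (fun t => val (f t)) -> measurable_fun setT (fun t => arg (f t)).
Proof.
move=> [f1 f2]; under eq_fun do rewrite arg_atan.
apply: measurable_fun_ifT => //.
  apply: (measurable_fun_bool true); rewrite setTI.
  rewrite (_ : _ @^-1` _ = (fun t => complex.Re (val (f t))) @^-1` [set -1]).
    by rewrite -[X in measurable X]setTI; exact: f1.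
  by apply/seteqP; split => t /= /eqP.
apply: measurable_funM => //; apply: measurableT_comp.
  by apply: continuous_measurable_fun => x; exact: continuous_atan.
apply: measurable_funM => //; apply: (measurableT_comp measurable_fun_invr).
exact: measurable_funD.
Qed.

End circle_facts.

Section solenoid_borel.
Context {R : realType} {p : nat}.

Lemma cvg_solenoid T (F : set_system T) {FF : Filter F} (f : T -> solenoid R p) x :
  (forall j, (fun t => val (scoord (f t) j)) @ F --> val (scoord x j)) ->
  f @ F --> x.
Proof.
move=> fx.
apply: (@cvg_initial _ _ (set_val : set_type (solenoid_set R p) -> {ptws nat -> circle R})).
apply/cvg_sup => j.
apply: (@cvg_initial _ _ (fun g : {ptws nat -> circle R} => g j)).
apply: (@cvg_initial _ _ (set_val : set_type (circle_set R) -> R[i])).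
exact: fx.
Qed.

(** Boxes with rational centres constraining finitely many coordinates. The index type is countable,
    which is what makes open sets countable unions of boxes. *)
Let box (mq : nat * seq (rat * rat)) : set (solenoid R p) :=
  [set y | forall j, (j < size mq.2)%N ->
    `|complex.Re (val (scoord y j)) - ratr (nth 0 mq.2 j).1| < mq.1.+1%:R^-1 /\
    `|complex.Im (val (scoord y j)) - ratr (nth 0 mq.2 j).2| < mq.1.+1%:R^-1].

(** Otherwise for each [n] some point outside [O] would lie within [2 / (n + 1)] of [x] in its first
    [n] coordinates; these points converge to [x], although [O] is open. *)
Let box_base (O : set (solenoid R p)) x : open O -> O x ->
  exists2 mq, box mq x & box mq `<=` O.
Proof.
move=> oO Ox; apply: contrapT => nO.
have rq (a e : R) : 0 < e -> exists q : rat, `|a - ratr q| < e.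
  move=> e0; have ae : a - e < a + e by lra.
  have [q] := rat_in_itvoo ae; rewrite in_itv/= => /andP[h1 h2]; exists q.
  by rewrite ltr_norml; apply/andP; split; lra.
have N (n : nat) : exists y, (forall j, (j < n)%N ->
    `|complex.Re (val (scoord x j)) - complex.Re (val (scoord y j))| < 2 * n.+1%:R^-1 /\
    `|complex.Im (val (scoord x j)) - complex.Im (val (scoord y j))| < 2 * n.+1%:R^-1) /\ ~ O y.
  have n0 : 0 < n.+1%:R^-1 :> R by rewrite invr_gt0.
  have [q1 q1P] := choice (fun j => rq (complex.Re (val (scoord x j))) _ n0).
  have [q2 q2P] := choice (fun j => rq (complex.Im (val (scoord x j))) _ n0).
  pose mq := (n, mkseq (fun j => (q1 j, q2 j)) n).
  have bx : box mq x.
    by move=> j; rewrite size_mkseq => jn; rewrite /= nth_mkseq//=; split; [exact: q1P|exact: q2P].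
  have : ~ (box mq `<=` O) by move=> bO; apply: nO; exists mq.
  move=> /existsNP [y /not_implyP [yb nOy]]; exists y; split => // j jn.
  have [] := yb j; first by rewrite size_mkseq.
  have [] := bx j; first by rewrite size_mkseq.
  rewrite /= nth_mkseq//= !ltr_norml; move: (n.+1%:R^-1 : R) => e.
  move=> /andP[? ?] /andP[? ?] /andP[? ?] /andP[? ?].
  by split; apply/andP; split; lra.
have [y yP] := choice N.
have c2 : (fun n => 2 * n.+1%:R^-1 : R) @ \oo --> (0 : R).
  rewrite -[X in _ --> X](mulr0 2); apply: cvgM; first exact: cvg_cst.
  exact: cvg_harmonic.
have yx : y @ \oo --> x.
  apply: cvg_solenoid => j; apply: cvg_complex; apply/cvgrPdist_lt => e e0; near=> n.
    apply: lt_trans ((yP n).1 j _).1 _; first by near: n; exists j.+1.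
    by near: n; move/cvgrPdist_lt : c2 => /(_ _ e0); apply: filterS => n;
      rewrite sub0r normrN ger0_norm// mulr_ge0.
  apply: lt_trans ((yP n).1 j _).2 _; first by near: n; exists j.+1.
  by near: n; move/cvgrPdist_lt : c2 => /(_ _ e0); apply: filterS => n;
      rewrite sub0r normrN ger0_norm// mulr_ge0.
have [n _ /(_ n (leqnn n))] := yx O (open_nbhs_nbhs (conj oO Ox)).
exact: (yP n).2.
Unshelve. all: by end_near. Qed.

(** The Borel sigma-algebra of the solenoid is thus generated by the coordinates, open sets being
    countable unions of boxes. *)
Lemma measurable_solenoid d (T : measurableType d) (f : T -> borel (solenoid R p)) :
  (forall j, cmeas (fun t => val (scoord (f t) j))) -> measurable_fun setT f.
Proof.
move=> mf; apply: (@measurability _ _ T (borel (solenoid R p)) setT f open) => //.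
move=> _ [V oV <-]; rewrite setTI.
have -> : f @^-1` V = \bigcup_(mq in [set mq | box mq `<=` V]) (f @^-1` (box mq)).
  apply/seteqP; split => [t /= Vt|t [mq bV bt]]; last exact: bV.
  by have [mq bt bV] := box_base oV Vt; exists mq.
apply: bigcup_countType_measurable => mq _.
rewrite (_ : _ @^-1` _ = \bigcap_(j in [set j | (j < size mq.2)%N])
   ((fun t => `|complex.Re (val (scoord (f t) j)) - ratr (nth 0 mq.2 j).1|) @^-1` `]-oo, mq.1.+1%:R^-1[ `&`
    (fun t => `|complex.Im (val (scoord (f t) j)) - ratr (nth 0 mq.2 j).2|) @^-1` `]-oo, mq.1.+1%:R^-1[)).
  apply: bigcap_measurableType => j _.
  have [mr mi] := mf j; apply: measurableI; rewrite -[X in measurable X]setTI.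
    have : measurable_fun setT (fun t => `|complex.Re (val (scoord (f t) j)) - ratr (nth 0 mq.2 j).1|).
      by apply: measurableT_comp => //; exact: measurable_funB.
    by apply => //; exact: measurable_itv.
  have : measurable_fun setT (fun t => `|complex.Im (val (scoord (f t) j)) - ratr (nth 0 mq.2 j).2|).
    by apply: measurableT_comp => //; exact: measurable_funB.
  by apply => //; exact: measurable_itv.
apply/seteqP; split => t /= bt j jn; have := bt j jn; rewrite /= !in_itv/=.
all: by [].
Qed.

Lemma cmeas_scoord j : cmeas (fun y : borel (solenoid R p) => val (scoord y j)).
Proof.
split; apply: continuous_borel_measurable => y.
  apply: (@continuous_comp _ _ _ (fun y : solenoid R p => val (scoord y j)) (@complex.Re R) y);
    [exact: scoord_continuous|exact: continuous_Re].
apply: (@continuous_comp _ _ _ (fun y : solenoid R p => val (scoord y j)) (@complex.Im R) y);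
    [exact: scoord_continuous|exact: continuous_Im].
Qed.

Lemma measurable_arg_scoord j :
  measurable_fun setT (fun y : borel (solenoid R p) => arg (scoord y j)).
Proof. by apply: measurable_arg; exact: cmeas_scoord. Qed.

Lemma measurable_tau j :
  measurable_fun setT (fun x : borel (solenoid R p) => (tau x).2 j).
Proof.
pose u (x : borel (solenoid R p)) : R :=
  (p%:R * arg (scoord x j.+1) - arg (scoord x j)) / (2 * pi).
have mu : measurable_fun setT u.
  apply: measurable_funM => //; apply: measurable_funB; last exact: measurable_arg_scoord.
  by apply: measurable_funM => //; exact: measurable_arg_scoord.
move=> _ B _; rewrite setTI.
have -> : (fun x : borel (solenoid R p) => (tau x).2 j) @^-1` B =
    \bigcup_(k in B) (u @^-1` [set k%:~R]).
  apply/seteqP; split => [x Bx|x [k Bk ux]].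
    by exists ((tau x).2 j) => //=; rewrite tauE.
  have := tauE x j; rewrite -/(u x) (ux : u x = _) => /intr_inj xk.
  by rewrite /preimage/= -[X in B X]/((tau x).2 j) xk.
apply: bigcup_countType_measurable => k _.
by rewrite -[X in measurable X]setTI; exact: mu.
Qed.

End solenoid_borel.

(** * Elementary trigonometric inequalities *)

Section trigonometric_bounds.
Context {R : realType}.
Implicit Types x : R.

Let mvt (f df : R -> R) x : 0 <= x -> (forall t, is_derive t (1 : R) f (df t)) ->
  exists2 c, 0 <= c <= x & f x - f 0 = df c * x.
Proof.
move=> x0 fd.
have cf : {within `[0, x], continuous f}.
  apply: continuous_subspaceT => t; apply: differentiable_continuous.
  by apply/derivable1_diffP; have := fd t; case.
have [c] := @MVT_segment _ f df 0 x x0 (fun t _ => fd t) cf.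
by rewrite in_itv/= subr0 => cx E; exists c.
Qed.

Lemma sin_le_id x : 0 <= x -> sin x <= x.
Proof.
move=> x0; have [c _] := mvt x0 (fun t => is_derive_sin t).
rewrite sin0 subr0 => ->; rewrite -[leRHS]mul1r ler_wpM2r// cos_le1.
Qed.

Lemma norm_sin_le x : `|sin x| <= `|x|.
Proof.
wlog x0 : x / 0 <= x => [hw|].
  have [/hw//|/ltW x0] := leP 0 x.
  by have := hw (- x); rewrite sinN !normrN; apply; rewrite oppr_ge0.
have h : - sin x <= x.
  have [c _] := mvt x0 (fun t => is_derive_sin t); rewrite sin0 subr0 => ->.
  by rewrite -mulNr -[leRHS]mul1r ler_wpM2r// lerNl cos_geN1.
by rewrite (ger0_norm x0) ler_norml sin_le_id// lerNl h.
Qed.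

Lemma one_minus_cosE x : 1 - cos x = 2 * sin (x / 2) ^+ 2.
Proof.
have cE : cos x = cos (x / 2) * cos (x / 2) - sin (x / 2) * sin (x / 2).
  by rewrite -cosD -splitr.
by have := cos2Dsin2 (x / 2); rewrite cE; lra.
Qed.

Lemma one_minus_cos_ge0 x : 0 <= 1 - cos x.
Proof. by rewrite subr_ge0 cos_le1. Qed.

Lemma one_minus_cos_le x : 1 - cos x <= x ^+ 2 / 2.
Proof.
rewrite one_minus_cosE; have := norm_sin_le (x / 2); set s := sin _ => h.
have : `|s| ^+ 2 <= `|x / 2| ^+ 2 by rewrite lerXn2r// nnegrE.
rewrite !real_normK ?num_real//; lra.
Qed.

Lemma one_minus_cos_ge x : `|x| <= 1 -> x ^+ 2 / 4 <= 1 - cos x.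
Proof.
wlog x0 : x / 0 <= x => [hw|].
  have [/hw//|/ltW x0] := leP 0 x.
  by have := hw (- x); rewrite cosN sqrrN normrN; apply; rewrite oppr_ge0.
rewrite ger0_norm// => x1; rewrite one_minus_cosE.
have x20 : 0 <= x / 2 by rewrite divr_ge0.
have [c /andP[c0 cx]] := mvt x20 (fun t => is_derive_sin t); rewrite sin0 subr0 => ->.
(* Here [c <= x / 2 <= 1 / 2], so [cos c >= 1 - 1 / 8], whose square exceeds [1 / 2]. *)
have c8 : 7 / 8 <= cos c by have := one_minus_cos_le c; nra.
have : 1 / 2 <= cos c ^+ 2 by nra.
by rewrite exprMn; have := sqr_ge0 x; nra.
Qed.

Lemma norm_sinB_le x : `|sin x - x| <= 2 * x ^+ 2.
Proof.
wlog x0 : x / 0 <= x => [hw|].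
  have [/hw//|/ltW x0] := leP 0 x.
  by have := hw (- x); rewrite sinN sqrrN -opprD normrN; apply; rewrite oppr_ge0.
have [c /andP[c0 cx]] := mvt x0 (fun t => is_derive_sin t); rewrite sin0 subr0 => ->.
rewrite -[X in _ - X]mul1r -mulrBl -opprB mulNr normrN normrM (ger0_norm x0).
rewrite (ger0_norm (one_minus_cos_ge0 _)).
have h1 := one_minus_cos_le c; have h2 := cos_geN1 c.
(* Up to 1 the bound on [1 - cos c] is quadratic in [x]; beyond 1 the trivial bound 2 and
   [x <= x ^ 2] suffice. *)
have [x1|x1] := leP x 1; last by nra.
have : c ^+ 2 <= x ^+ 2 by rewrite lerXn2r// nnegrE.
nra.
Qed.

Lemma normc_le (z : R[i]) : normc z <= `|complex.Re z| + `|complex.Im z|.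
Proof.
case: z => a b /=; rewrite -(@ger0_norm _ (`|a| + `|b|)) ?addr_ge0// -sqrtr_sqr.
rewrite ler_wsqrtr// -(@real_normK _ a) ?num_real// -(@real_normK _ b) ?num_real//.
move: (normr_ge0 a) (normr_ge0 b); nra.
Qed.

Lemma normc_cisB_le x : normc (cis x - 1 - Complex 0 x) <= 3 * x ^+ 2.
Proof.
apply: le_trans (normc_le _) _; rewrite /= !subr0.
have := norm_sinB_le x; have := one_minus_cos_le x.
rewrite -(ger0_norm (one_minus_cos_ge0 x)) distrC; have := sqr_ge0 x; lra.
Qed.

(** The constant 4 serves [|x| <= 1]; on the rest of the interval [1 - cos x] is at least
    [1 - cos 1] and the square at most [pi ^ 2]. This converts the integrability of [1 - Re chi]
    into that of a square. *)
Lemma sqr_le_one_minus_cos x : `|x| <= pi ->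
  x ^+ 2 <= (4 + pi ^+ 2 / (1 - cos 1)) * (1 - cos x).
Proof.
move=> xpi; have pi1 := pi_ge2 R; have pi0 := pi_gt0 R.
have c1 : cos 1 < 1 :> R.
  by rewrite -[ltRHS]cos0 ltr_cos ?in_itv/= ?lexx ?ltr01//; lra.
have d0 : 0 < 1 - cos 1 :> R by lra.
have D0 : 0 <= pi ^+ 2 / (1 - cos 1) :> R by rewrite divr_ge0 ?sqr_ge0// ltW.
have q0 := one_minus_cos_ge0 x.
have [x1|x1] := leP `|x| 1.
  have := one_minus_cos_ge x1; have := mulr_ge0 D0 q0; lra.
have cx : cos x <= cos 1.
  rewrite -[x in cos x]/(x) (_ : cos x = cos `|x|); last first.
    by case: (ger0P x); rewrite ?cosN.
  by rewrite ltW// ltr_cos ?in_itv/= ?normr_ge0 ?ler01//; lra.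
have x2 : x ^+ 2 <= pi ^+ 2.
  by rewrite -real_normK ?num_real// lerXn2r// nnegrE// ltW.
have : pi ^+ 2 <= pi ^+ 2 / (1 - cos 1) * (1 - cos x).
  rewrite -mulrA ler_peMr ?sqr_ge0// mulrC ler_pdivlMr// mul1r; lra.
lra.
Qed.

End trigonometric_bounds.

(** * Additivity of [phi] and its right inverse [tau] *)

Section phi_tau.
Context {R : realType} {p : nat} (pp : prime p).

Lemma natr_prime_neq0 : p%:R != 0 :> R.
Proof. by rewrite pnatr_eq0 -lt0n prime_gt0. Qed.

Lemma measurable_int_fun d (T : measurableType d) (f : T -> int) (g : int -> R) :
  measurable_fun setT f -> measurable_fun setT (fun t => g (f t)).
Proof. by move=> mf; apply: (@measurableT_comp _ _ _ _ _ _ g _ f). Qed.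

Lemma measurable_phi_angle d (T : measurableType d) (Y0 : T -> R) (Y : nat -> T -> int) j :
  measurable_fun setT Y0 -> (forall k, measurable_fun setT (Y k)) ->
  measurable_fun setT (fun w => phi_angle p (Y0 w, fun k => Y k w) j).
Proof.
move=> m0 mY; apply: measurable_funM => //; apply: measurable_funD => //=.
apply: measurable_sum => k; apply: measurable_funM => //; apply: measurable_funM => //.
exact: (measurable_int_fun (fun z => z%:~R)).
Qed.

Lemma measurable_phi d (T : measurableType d) (Y0 : T -> R) (Y : nat -> T -> int) :
  measurable_fun setT Y0 -> (forall k, measurable_fun setT (Y k)) ->
  measurable_fun setT (fun w => phi pp (Y0 w, fun k => Y k w) : borel (solenoid R p)).
Proof.
move=> m0 mY; apply: measurable_solenoid => j.
exact: cmeas_cis (measurable_phi_angle j m0 mY).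
Qed.

Lemma phi_angleD (x y : R) (u v : nat -> int) j :
  phi_angle p (x + y, fun k => u k + v k) j = phi_angle p (x, u) j + phi_angle p (y, v) j.
Proof.
rewrite /phi_angle /= -mulrDl addrACA -big_split /=; congr (_ / _); congr (_ + _).
by apply: eq_bigr => k _; rewrite intrD; ring.
Qed.

Lemma phiD (x y : R) (u v : nat -> int) :
  phi pp (x + y, fun k => u k + v k) = phi pp (x, u) + phi pp (y, v).
Proof. by apply: solenoid_eq => j /=; rewrite phi_angleD cisD. Qed.

(** After multiplication by [p ^ j] the sum telescopes: the digit of index [k] contributes
    [p ^ (k + 1) arg a_(k+1) - p ^ k arg a_k]. *)
Lemma phi_angle_tau (a : solenoid R p) j : phi_angle p (tau a) j = arg (scoord a j).
Proof.
have pj i : p%:R ^+ i != 0 :> R by rewrite expf_neq0// natr_prime_neq0.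
rewrite /phi_angle; apply: (mulIf (pj j)); rewrite mulfVK//.
elim: j => [|j IH]; first by rewrite big_ord0 addr0 expr0 mulr1.
rewrite big_ord_recr/= addrA IH tauE exprS.
have pi2 : pi != 0 :> R by rewrite gt_eqF// pi_gt0.
by rewrite [2 * pi * _]mulrC divfK ?mulf_neq0//; ring.
Qed.

Lemma phi_tauK (a : solenoid R p) : phi pp (tau a) = a.
Proof. by apply: solenoid_eq => j /=; rewrite phi_angle_tau expi_val. Qed.

Lemma tau0 : tau (0 : solenoid R p) = (0, fun=> 0).
Proof.
have a0 j : arg (scoord (0 : solenoid R p) j) = 0.
  apply: argE; last by rewrite cis0.
  by rewrite oppr_le0 pi_ge0 pi_gt0.
have t0 k : (tau (0 : solenoid R p)).2 k = 0.
  by apply: (@intr_inj R); rewrite tauE !a0 mulr0 subrr mul0r.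
by rewrite [LHS]surjective_pairing; congr pair; [exact: a0|apply/funext].
Qed.

End phi_tau.

(** * Borel structure of R x Z^n *)

Section realZ_borel.
Context {R : realType} {n : nat}.

Lemma open_realZ_section (O : set (realZ R n)) l : open O ->
  open [set x : R | O (x, l)].
Proof.
have cx : continuous (fun x : R => (x, l) : realZ R n).
  move=> x U [[A B] [/= Ax Bl] AB]; apply: filterS Ax => y Ay.
  by apply: AB; split => //; exact: nbhs_singleton Bl.
by move/continuousP : cx => /[apply].
Qed.

Lemma measurable_realZ d (T : measurableType d) (f : T -> borel (realZ R n)) :
  measurable_fun setT (fun t => (f t).1) ->
  (forall l, measurable [set t | (f t).2 = l]) -> measurable_fun setT f.
Proof.
move=> m1 m2; apply: (@measurability _ _ T (borel (realZ R n)) setT f open) => //.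
move=> _ [V oV <-]; rewrite setTI.
have -> : f @^-1` V = \bigcup_(l in [set: 'rV[int]_n])
    ((fun t => (f t).1) @^-1` [set x | V (x, l)] `&` [set t | (f t).2 = l]).
  apply/seteqP; split => [t /= Vt|t [l _ [Vt tl]]]; last first.
    by move: Vt; rewrite /preimage /= -[in X in X -> _](tl : (f t).2 = l) -surjective_pairing.
  by exists (f t).2 => //; split => //=; rewrite -surjective_pairing.
apply: bigcup_countType_measurable => l _; apply: measurableI => //.
rewrite -[X in measurable X]setTI; apply: m1 => //.
by apply: open_measurable; exact: open_realZ_section.
Qed.

Lemma measurable_realZ_fst : measurable_fun setT (fun x : borel (realZ R n) => x.1).
Proof.
by apply: (@continuous_borel_measurable R (realZ R n) (fun x => x.1)) => x; exact: cvg_fst.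
Qed.

Lemma measurable_realZ_snd (B : set 'rV[int]_n) :
  measurable ([set x | B x.2] : set (borel (realZ R n))).
Proof.
apply: sub_sigma_algebra; rewrite openE => -[x l] Bl.
have [A AN Al] : exists2 A, nbhs l A & A `<=` B.
  by exists [set l]; [exact: nbhs_rV_int|move=> _ ->].
exists (setT, A); first by split => //; exact: filterT.
by move=> [y m] [_ /Al].
Qed.

Lemma measurable_realZ_slice (A : set (borel (realZ R n))) l :
  measurable A -> measurable [set x : R | A (x, l)].
Proof.
move=> mA.
have mf : measurable_fun [set: R] (fun x => (x, l) : borel (realZ R n)).
  apply: measurable_realZ => [|m /=]; first exact: measurable_id.
  by have [->|lm] := eqVneq l m; [rewrite (_ : mkset _ = setT)//; apply/seteqP; split
    |rewrite (_ : mkset _ = set0)//; apply/seteqP; split => // x /= /eqP; rewrite (negbTE lm)].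
by rewrite -[X in measurable X]setTI; exact: mf.
Qed.

End realZ_borel.

(** * The image of the Levy measure under [tau] *)

Section tau_image.
Context {R : realType} {p : nat} (n : nat).

Definition taun (x : solenoid R p) : realZ R n :=
  ((tau x).1, \row_(k < n) (tau x).2 k).

Lemma row_int_measurable d (T : measurableType d) (Y : nat -> T -> int) l :
  (forall k, measurable_fun setT (Y k)) ->
  measurable [set t | \row_(k < n) Y k t = l].
Proof.
move=> mY; rewrite (_ : mkset _ = \bigcap_(k in [set: 'I_n]) (Y k @^-1` [set l ord0 k])).
  apply: fin_bigcap_measurable => [|k _]; first exact: finite_finset.
  by rewrite -[X in measurable X]setTI; exact: mY.
apply/seteqP; split => t /=.
  by move=> <- k _ /=; rewrite mxE.
by move=> tl; apply/rowP => k; rewrite mxE; exact: tl.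
Qed.

Lemma measurable_taun :
  measurable_fun setT (taun : borel (solenoid R p) -> borel (realZ R n)).
Proof.
apply: measurable_realZ => [|l]; first exact: measurable_arg_scoord.
exact: (row_int_measurable l (fun k => @measurable_tau R p k)).
Qed.

Lemma taun0 : taun 0 = 0.
Proof.
rewrite /taun tau0; congr pair; apply/rowP => k; by rewrite !mxE.
Qed.

Variables (eta : {measure set (borel (solenoid R p)) -> \bar R})
  (etan : {measure set (borel (realZ R n)) -> \bar R}).
Hypothesis etanE : is_tau_image eta etan.

Let mtaun (A : set (borel (realZ R n))) : measurable A ->
  measurable ([set x | A (taun x)] : set (borel (solenoid R p))).
Proof. by move=> mA; rewrite -[X in measurable X]setTI; exact: measurable_taun. Qed.

Let mrect (B : set R) l : measurable B ->
  measurable ((B `*` [set l]) : set (borel (realZ R n))).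
Proof.
move=> mB; rewrite (_ : _ `*` _ = (fun x : borel (realZ R n) => x.1) @^-1` B `&` [set x | [set l] x.2])//.
apply: measurableI; last exact: measurable_realZ_snd.
by rewrite -[X in measurable X]setTI; exact: measurable_realZ_fst.
Qed.

Let m0 : measurable ([set (0 : realZ R n)] : set (borel (realZ R n))).
Proof.
rewrite (_ : [set 0] = [set 0 : R] `*` [set (0 : 'rV[int]_n)]); first exact: mrect.
by apply/seteqP; split => -[x l] /= => [[-> ->]//|[-> ->]].
Qed.

Let rect_eq (B : set R) l : measurable B ->
  etan (B `*` [set l]) = eta [set x | (B `*` [set l]) (taun x) /\ taun x <> 0].
Proof.
move=> mB; have [e0 eE] := etanE.
have [Bl0|nB] := pselect ((B `*` [set l]) (0 : realZ R n)); last first.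
  rewrite eE//; congr (eta _); apply/seteqP; split => x /=.
    by move=> [Bx lx]; split => // t0; apply: nB; rewrite -t0.
  by move=> [].
have l0 : l = 0 by case: Bl0.
pose Z0 : set (borel (realZ R n)) := [set (0 : realZ R n)].
have e0' : etan Z0 = 0%E by exact: e0.
have -> : B `*` [set l] = ((B `\ 0) `*` [set l]) `|` Z0.
  apply/seteqP; split => [[x m] [/= Bx ->]|[x m] /= [[[Bx _] ->]//|]].
    have [->|/eqP x0] := eqVneq x 0; first by right; rewrite l0.
    by left.
  by move=> [-> ->]; case: Bl0 => /= B0 <-.
have mB0 : measurable (B `\ 0) by apply: measurableD.
rewrite measureU//; last 2 first.
- exact: mrect.
- by rewrite -subset0 => -[x m] /= [[[_ x0] _]] [] /x0.
pose C := (B `\ 0) `*` [set l].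
transitivity (etan C + 0)%E; first by congr (_ + _)%E.
rewrite adde0 /C eE//; last by move=> /= [[_]].
congr (eta _); apply/seteqP; split => x /=.
  move=> [[Bx x0] lx]; split; first by left.
  by move=> [x00 _]; apply: x0.
by move=> [[[[Bx x0] lx]//|t0] t0']; exfalso; apply: t0'.
Qed.

(** [is_tau_image] prescribes only rectangles off the origin; a general set is the disjoint union of
    its countably many integer slices. The clause [taun x <> 0] is essential: [eta] may give
    infinite mass to nonzero [x] whose first coordinates under [tau] all vanish. *)
Lemma tau_imageE (A : set (borel (realZ R n))) : measurable A ->
  etan A = eta [set x | A (taun x) /\ taun x <> 0].
Proof.
move=> mA.
pose F k : set (borel (realZ R n)) := if @pickle_inv 'rV[int]_n k is Some l
  then [set x | A (x, l)] `*` [set l] else set0.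
have mF k : measurable (F k).
  rewrite /F; case: pickle_inv => [l|]; last exact: measurable0.
  by apply: mrect; exact: measurable_realZ_slice.
have tF : trivIset setT F.
  apply/trivIsetP => i j _ _ ij; rewrite -subset0 => x [].
  rewrite /F; case Ei : pickle_inv => [l|//] [_ /= xl].
  case Ej : pickle_inv => [m|//] [_ /= xm]; move/eqP : ij; apply.
  have := @pickle_invK 'rV[int]_n i; rewrite /oapp Ei => <-.
  by have := @pickle_invK 'rV[int]_n j; rewrite /oapp Ej => <-; rewrite -xl xm.
have AF : A = \bigcup_k F k.
  apply/seteqP; split => [[x l] Axl|x [k _]].
    by exists (pickle l) => //; rewrite /F pickleK_inv.
  by rewrite /F; case: pickle_inv => // l [/= Ax xl]; rewrite -xl -surjective_pairing in Ax.
pose G k : set (borel (solenoid R p)) := [set x | F k (taun x) /\ taun x <> 0].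
have mG k : measurable (G k).
  rewrite (_ : G k = [set x | F k (taun x)] `\` [set x | [set 0] (taun x)]); last first.
    by apply/seteqP; split => x [].
  by apply: measurableD; exact: mtaun.
have GU : [set x | A (taun x) /\ taun x <> 0] = \bigcup_k G k.
  rewrite AF; apply/seteqP; split => [x [[k _ Fx] x0]|x [k _ [Fx x0]]]; first by exists k.
  by split => //; exists k.
have tG : trivIset setT G.
  apply/trivIsetP => i j _ _ ij; rewrite -subset0 => x [[Fi _] [Fj _]].
  have /trivIsetP/(_ i j I I ij) := tF; rewrite -subset0 => /(_ (taun x)); exact.
rewrite GU [in LHS]AF measure_bigcup// measure_bigcup//.
apply: eq_eseriesr => k _; rewrite /G /F; case: pickle_inv => [l|]; last first.
  rewrite measure0 (_ : [set _ | _] = set0) ?measure0//.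
  by apply/seteqP; split => x [].
by apply: rect_eq; exact: measurable_realZ_slice.
Qed.

(** Since [f] vanishes at the origin, the points with [taun x = 0], discarded by [etan] but possibly
    charged by [eta], contribute to neither integral. *)
Lemma integral_tau_image (f : borel (realZ R n) -> \bar R) :
  measurable_fun setT f -> f 0 = 0%E ->
  (\int[etan]_x f x = \int[eta]_x f (taun x))%E.
Proof.
move=> mf f0.
have fD : f = f \_ (~` [set 0]).
  apply/funext => x; rewrite patchE; case: ifPn => //.
  by rewrite notin_setE /= => /contrapT ->.
pose tn : borel (solenoid R p) -> borel (realZ R n) := taun.
transitivity (\int[eta]_x (f \o tn) x)%E => //.
rewrite {1}fD -integral_mkcond.
rewrite (@eq_measure_integral _ _ _ _ (pushforward eta tn)).
- exact: measurable_taun.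
- by move=> mt; rewrite integral_mkcond -fD; exact: (integral_transfer mt).
- move=> mt A mA AD; rewrite tau_imageE//; congr (eta _); apply/seteqP; split => x.
    by move=> [].
  by move=> Ax; split => //; exact: AD Ax.
Qed.

Lemma cint_tau_image (f : borel (realZ R n) -> R[i]) : cmeas f -> f 0 = 0 ->
  cint etan f = cint eta (fun x => f (taun x)).
Proof.
move=> [mf1 mf2] f0; rewrite /cint /Rintegral; congr Complex; congr fine.
  by apply: (integral_tau_image (f := fun x => (complex.Re (f x))%:E)); [exact/measurable_EFinP|rewrite f0].
by apply: (integral_tau_image (f := fun x => (complex.Im (f x))%:E)); [exact/measurable_EFinP|rewrite f0].
Qed.

End tau_image.

(** * Levy measures on the solenoid *)

Lemma markov_lty d (T : measurableType d) (R : realType)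
    (mu : {measure set T -> \bar R}) (f : T -> R) (c : R) :
  measurable_fun setT f -> (forall x, 0 <= f x) -> 0 < c ->
  (\int[mu]_x (f x)%:E < +oo)%E -> (mu [set x | (c <= f x)%R] < +oo)%E.
Proof.
move=> mf f0 c0 fi; set A := [set x | _].
have mA : measurable A.
  have := mf measurableT `[c, +oo[%classic (measurable_itv _); rewrite setTI.
  by congr measurable; apply/seteqP; split => x /=; rewrite in_itv/= andbT.
have : (c%:E * mu A <= \int[mu]_x (f x)%:E)%E.
  rewrite -integral_cst//; apply: le_trans; last first.
    apply: (@ge0_subset_integral _ _ _ mu A setT) => //; first exact/measurable_EFinP.
    by move=> x _; rewrite lee_fin.
  apply: ge0_le_integral => //=; first by move=> x _; rewrite lee_fin ltW.
  by apply/measurable_EFinP; exact: measurable_funTS.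
move=> /le_lt_trans /(_ fi); case: (mu A) (measure_ge0 mu A) => [r _ _|_|//]; first exact: ltry.
by rewrite gt0_muley// ltxx.
Qed.

Lemma bigsetU_lty d (T : measurableType d) (R : realType)
    (mu : {measure set T -> \bar R}) (A : nat -> set T) n :
  (forall i, measurable (A i)) -> (forall i, (mu (A i) < +oo)%E) ->
  (mu (\big[setU/set0]_(i < n) A i) < +oo)%E.
Proof.
move=> mA Afin; elim: n => [|n IH]; first by rewrite big_ord0 measure0 ltry.
rewrite big_ord_recr /=; apply: le_lt_trans (measureU2 _ _ _) _ => //.
  exact: bigsetU_measurable.
by apply: lte_add_pinfty; [exact: IH|exact: Afin].
Qed.

Section levy_measure.
Context {R : realType} {p : nat} (pp : prime p).
Variable eta : {measure set (borel (solenoid R p)) -> \bar R}.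
Hypothesis Heta : is_levy eta.

Lemma scoord_character d : is_character (fun x : solenoid R p => scoord x d).
Proof.
split => // y.
apply: (@continuous_comp _ _ _ (val : solenoid R p -> {ptws nat -> circle R})
  (fun g : {ptws nat -> circle R} => g d)).
  exact: (@initial_continuous _ _ (set_val : set_type (solenoid_set R p) -> _)).
exact: (@proj_continuous nat (fun=> circle R) d).
Qed.

Lemma measurable_cos d (T : measurableType d) (f : T -> R) : measurable_fun setT f ->
  measurable_fun setT (fun x => cos (f x)).
Proof.
move=> mf; apply: measurableT_comp => //.
by apply: continuous_measurable_fun; exact: continuous_cos.
Qed.

Lemma levy_cos d : (\int[eta]_x (1 - cos (arg (scoord x d)))%:E < +oo)%E.
Proof.
have [_ _ h] := Heta; have := h _ (scoord_character d).
by under eq_integral do rewrite -cos_arg.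
Qed.

Let mcos d : measurable_fun setT (fun x : borel (solenoid R p) => 1 - cos (arg (scoord x d))).
Proof. by apply: measurable_funB => //; apply: measurable_cos; exact: measurable_arg_scoord. Qed.

Lemma norm_arg_le (z : circle R) : `|arg z| <= pi.
Proof. by have /andP[? ?] := arg_itv z; rewrite ler_norml; apply/andP; split; lra. Qed.

Lemma measurable_norm_arg d :
  measurable_fun setT (fun x : borel (solenoid R p) => `|arg (scoord x d)|).
Proof. by apply: measurableT_comp => //; exact: measurable_arg_scoord. Qed.

(** Markov's inequality for [1 - cos (arg x_d)], which is at least [1 - cos r] as soon as
    [|arg x_d|] lies between [r] and [pi]. *)
Lemma levy_arg_ge d r : 0 < r -> (eta [set x | (r <= `|arg (scoord x d)|)%R] < +oo)%E.
Proof.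
move=> r0; have pi0 := pi_gt0 R.
have [rpi|rpi] := leP r pi; last first.
  rewrite (_ : [set x | _] = set0) ?measure0 ?ltry//.
  apply/seteqP; split => x //= /le_trans /(_ (norm_arg_le _)).
  by rewrite leNgt rpi.
have c0 : 0 < 1 - cos r.
  by rewrite subr_gt0 -[ltRHS]cos0 ltr_cos ?in_itv/= ?lexx ?(ltW r0) ?(ltW pi0).
apply: le_lt_trans (markov_lty (mcos d) (fun=> one_minus_cos_ge0 _) c0 (levy_cos d)).
apply: le_measure; rewrite ?inE.
- have := measurable_norm_arg d measurableT (measurable_itv `[r, +oo[).
  by rewrite setTI; congr measurable; apply/seteqP; split => x /=; rewrite in_itv/= andbT.
- have := mcos d measurableT (measurable_itv `[1 - cos r, +oo[); rewrite setTI.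
  by congr measurable; apply/seteqP; split => x /=; rewrite in_itv/= andbT.
move=> x /= rx; rewrite lerB//.
rewrite (_ : cos (arg _) = cos `|arg (scoord x d)|); last by case: (ger0P (arg _)); rewrite ?cosN.
rewrite leNgt ltr_cos ?in_itv/= ?(ltW r0)//; last by rewrite normr_ge0 norm_arg_le.
by rewrite -leNgt.
Qed.

Lemma levy_sqr_integrable :
  eta.-integrable setT (EFin \o (fun x => arg (scoord x 0) ^+ 2)).
Proof.
pose K : R := 4 + pi ^+ 2 / (1 - cos 1).
have iq : eta.-integrable setT (EFin \o (fun x => 1 - cos (arg (scoord x 0)))).
  apply/integrableP; split; first exact/measurable_EFinP.
  under eq_integral => x _ do rewrite /= ger0_norm ?one_minus_cos_ge0//.
  exact: levy_cos.
apply: le_integrable (integrableRZ K iq) => //.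
  by apply/measurable_EFinP; apply: measurable_funX; exact: measurable_arg_scoord.
move=> x _ /=; rewrite lee_fin ger0_norm ?sqr_ge0//.
exact: le_trans (sqr_le_one_minus_cos (norm_arg_le _)) (ler_norm _).
Qed.

(* The sets [Vset j] decrease to the identity. On [Vset j], the first [j] integer
   coordinates of [tau] vanish and the Levy measure integrates the square of the
   real one, while the complement of [Vset j] has finite mass. *)
Definition Vset j : set (borel (solenoid R p)) :=
  [set x | `|arg (scoord x 0)| < j.+1%:R^-1 /\ forall i, (i < j)%N -> (tau x).2 i = 0].

Lemma measurable_Vset j : measurable (Vset j).
Proof.
rewrite (_ : Vset j = (fun x => `|arg (scoord x 0)|) @^-1` `]-oo, j.+1%:R^-1[ `&`
    \bigcap_(i in [set i | (i < j)%N]) ((fun x => (tau x).2 i) @^-1` [set 0])); last first.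
  by apply/seteqP; split => x /=; rewrite in_itv.
apply: measurableI.
  have := measurable_norm_arg 0 measurableT (measurable_itv `]-oo, j.+1%:R^-1[).
  by rewrite setTI.
apply: bigcap_measurableType => i _; rewrite -[X in measurable X]setTI.
exact: measurable_tau.
Qed.

Lemma Vset_le i j : (i <= j)%N -> Vset j `<=` Vset i.
Proof.
move=> ij x [x1 x2]; split; last by move=> k ki; apply: x2; exact: leq_trans ij.
by apply: lt_le_trans x1 _; rewrite lef_pV2 ?posrE// ler_nat.
Qed.

(** Outside [Vset j] one of the arguments of [x_0], ..., [x_j] is bounded away from 0, so
    [levy_arg_ge] applies to finitely many coordinates. *)
Lemma levy_Vset j : (eta (~` Vset j) < +oo)%E.
Proof.
have pi0 := pi_gt0 R; have p0 : 0 < p%:R :> R by rewrite ltr0n prime_gt0.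
(* If [|arg x_i|] and [|arg x_(i+1)|] are below [pi / p], then [|p arg x_(i+1) - arg x_i| < 2 pi],
   so the corresponding integer coordinate of [tau] has absolute value below 1 and vanishes. *)
pose r : R := Num.min j.+1%:R^-1 (pi / p%:R).
have r0 : 0 < r by rewrite lt_min invr_gt0 ltr0n/= divr_gt0.
pose A i := [set x : borel (solenoid R p) | (r <= `|arg (scoord x i)|)%R].
have mA i : measurable (A i).
  have := measurable_norm_arg i measurableT (measurable_itv `[r, +oo[).
  by rewrite setTI; congr measurable; apply/seteqP; split => x /=; rewrite in_itv/= andbT.
apply: le_lt_trans (bigsetU_lty j.+1 mA (fun i => levy_arg_ge i r0)).
apply: le_measure; rewrite ?inE.
- by apply: measurableC; exact: measurable_Vset.
- exact: bigsetU_measurable.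
rewrite -bigcup_mkord => x nV; apply: contrapT => nA.
have small i : (i < j.+1)%N -> `|arg (scoord x i)| < r.
  by move=> ij; rewrite ltNge; apply/negP => ri; apply: nA; exists i.
apply: nV; split.
  by apply: lt_le_trans (small 0%N _) _ => //; rewrite ge_min lexx.
move=> i ij.
have s1 : `|arg (scoord x i)| < pi / p%:R.
  by apply: lt_le_trans (small i _) _; rewrite ?ge_min ?lexx ?orbT// ltnW.
have s2 : `|arg (scoord x i.+1)| < pi / p%:R.
  by apply: lt_le_trans (small i.+1 _) _; rewrite ?ge_min ?lexx ?orbT.
have p1 : 1 <= p%:R :> R by rewrite ler1n prime_gt0.
have s1' : `|arg (scoord x i)| < pi.
  by apply: lt_le_trans s1 _; rewrite ler_pdivrMr// ler_peMr// ltW.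
move: s2; rewrite ltr_pdivlMr// mulrC -[X in X * _](ger0_norm (ltW p0)) -normrM => s2.
have : `|((tau x).2 i)%:~R| < 1 :> R.
  rewrite tauE normrM normfV (ger0_norm (ltW (pi2_gt0 R))) ltr_pdivrMr ?pi2_gt0// mul1r.
  by apply: le_lt_trans (ler_normB _ _) _; lra.
rewrite -intr_norm -[X in _ < X]/(1%:~R) ltr_int => t1.
by apply/eqP; rewrite -normr_eq0; apply/eqP; lia.
Qed.

Lemma Vset_cap (x : solenoid R p) : (forall j, Vset j x) -> x = 0.
Proof.
move=> Vx; rewrite -(phi_tauK pp x) -(phi_tauK pp 0); congr phi; rewrite tau0//.
rewrite [LHS]surjective_pairing; congr pair; last first.
  by apply/funext => i; have [_ ->] := Vx i.+1.
apply/eqP; rewrite -normr_eq0 eq_le normr_ge0 andbT.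
apply/ler_addgt0Pr => e e0; rewrite add0r.
have [n en] : exists n, n.+1%:R^-1 < e.
  have [n _ /(_ n (leqnn _))] := near_infty_natSinv_lt (PosNum e0).
  by exists n.
by have [h _] := Vx n; apply: ltW; exact: lt_trans h en.
Qed.

(** Dominated convergence: the sets [Vset j] shrink to the identity, where [arg x_0] is 0. *)
Lemma levy_small (e : R) : 0 < e ->
  exists j, (\int[eta]_(x in Vset j) (arg (scoord x 0) ^+ 2)%:E < e%:E)%E.
Proof.
move=> e0; pose q (x : borel (solenoid R p)) := (arg (scoord x 0) ^+ 2)%:E.
have mq : measurable_fun setT q.
  by apply/measurable_EFinP; apply: measurable_funX; exact: measurable_arg_scoord.
have q0 x : (0 <= q x)%E by rewrite lee_fin sqr_ge0.
pose f n := q \_ (Vset n).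
have dc := @dominated_convergence _ _ _ eta setT measurableT f (cst 0%E) q.
have mf n : measurable_fun setT (f n).
  by apply/(measurable_restrictT _ (measurable_Vset n)); exact: measurable_funTS.
have {}dc := dc mf (measurable_cst _).
have fcv x : f ^~ x @ \oo --> (0%E : \bar R).
  have [->|/eqP x0] := eqVneq x 0.
    rewrite (_ : f ^~ 0 = cst 0%E); first exact: cvg_cst.
    apply/funext => n; rewrite /f patchE; case: ifPn => // _.
    by rewrite /q -[arg _]/(tau (0 : solenoid R p)).1 tau0 expr0n.
  have [j nV] : exists j, ~ Vset j x.
    by apply/existsNP => Vx; apply: x0; exact: Vset_cap.
  apply: cvg_near_cst; exists j => // n jn; rewrite /f patchE ifF//.
  by apply/negbTE; rewrite notin_setE => Vn; apply: nV; exact: Vset_le jn _ Vn.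
have {}dc := dc (aeW _ (fun x _ => fcv x)) levy_sqr_integrable.
have fq x n : (`|f n x| <= q x)%E.
  rewrite /f patchE; case: ifPn => _; last by rewrite abse0.
  by rewrite gee0_abs.
have [_ _] := dc (aeW _ (fun x n _ => fq x n)); rewrite integral0 => cv.
apply: contrapT => /forallNP nj.
have : (e%:E <= limn (fun n => \int[eta]_x f n x))%E.
  apply: lime_ge; first by apply/cvg_ex; eexists; exact: cv.
  by apply: nearW => n; rewrite leNgt -integral_mkcond; apply/negP/nj.
by rewrite (cvg_lim _ cv)// lee_fin leNgt e0.
Qed.

End levy_measure.

(** * Characters of R x Z^n and the Levy integrand *)

Section realZ_character_facts.
Context {R : realType} {n : nat}.
Implicit Types (yz : R * ('I_n -> circle R)) (x : realZ R n).

Lemma normc_circle (z : circle R) : normc (val z) = 1.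
Proof. by rewrite -(expi_arg z) normc_cis. Qed.

Lemma normc_exprz (z : circle R) (m : int) : normc (val z ^ m) = 1.
Proof.
by case: m => m; rewrite -?exprz_inv /exprz/= ?normcV normc_exp normc_circle expr1n ?invr1.
Qed.

Lemma normc_realZ_char yz x : normc (realZ_char yz x) = 1.
Proof.
rewrite /realZ_char normcM normc_cis mul1r.
elim: (index_enum _) => [|k r IH]; first by rewrite big_nil normc1.
by rewrite big_cons normcM IH normc_exprz mulr1.
Qed.

Lemma realZ_char0 yz : realZ_char yz 0 = 1.
Proof.
rewrite /realZ_char /= mulr0 cis0 mul1r big1// => k _.
by rewrite mxE expr0z.
Qed.

Lemma realZ_charD yz x x' : realZ_char yz (x + x') = realZ_char yz x * realZ_char yz x'.
Proof.
rewrite /realZ_char /= mulrDr cisD mulrACA -big_split /=; congr (_ * _).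
apply: eq_bigr => k _; rewrite mxE expfzDr//; exact: circle_neq0.
Qed.

Lemma realZ_char_sum yz I (r : seq I) (F : I -> realZ R n) :
  realZ_char yz (\sum_(i <- r) F i) = \prod_(i <- r) realZ_char yz (F i).
Proof.
elim: r => [|i r IH]; first by rewrite !big_nil realZ_char0.
by rewrite !big_cons realZ_charD IH.
Qed.

Lemma cmeas_realZ_char yz : cmeas (realZ_char yz : borel (realZ R n) -> R[i]).
Proof.
apply: cmeasM.
  by apply: cmeas_cis; apply: measurable_funM => //; exact: measurable_realZ_fst.
have mg (g : 'rV[int]_n -> R) :
    measurable_fun setT (fun x : borel (realZ R n) => g x.2).
  by move=> _ B mB; rewrite setTI; exact: (measurable_realZ_snd (g @^-1` B)).
by split; [exact: (mg (fun v => complex.Re (\prod_k val (yz.2 k) ^ v ord0 k)))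
  |exact: (mg (fun v => complex.Im (\prod_k val (yz.2 k) ^ v ord0 k)))].
Qed.

Lemma h_id (u : R) : `|u| < 1 -> h u = u.
Proof.
have pi2 := pi_ge2 R; rewrite ltr_norml => /andP[u1 u2]; rewrite /h.
rewrite ifF; last by apply/negbTE; rewrite negb_or -!leNgt -ltNge; apply/andP; split; lra.
rewrite ifF; last by apply/negbTE; rewrite -leNgt; lra.
by rewrite ifT//; lra.
Qed.

Lemma norm_h_le (u : R) : `|h u| <= pi.
Proof.
have pi0 := pi_gt0 R; rewrite /h; case: ifPn => [_|]; first by rewrite normr0 ltW.
rewrite negb_or -leNgt -ltNge => /andP[u1 u2].
by case: ifPn => [|/negbTE]; [|case: ifPn]; rewrite ?ltNge => *; rewrite ler_norml; apply/andP; split; lra.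
Qed.

Lemma measurable_h : measurable_fun setT (@h R).
Proof.
rewrite /h; apply: measurable_fun_ifT => //.
  by apply: measurable_or; [exact: measurable_fun_ltr|exact: measurable_fun_ler].
apply: measurable_fun_ifT; [exact: measurable_fun_ltr| |].
  by apply: measurable_funB => //; exact: measurable_funN.
apply: measurable_fun_ifT => //; first exact: measurable_fun_ltr.
by apply: measurable_funD => //; exact: measurable_funN.
Qed.

(* The integrand of the exponent of a generalized Poisson measure. *)
Definition realZ_levy_fun yz x : R[i] := realZ_char yz x - 1 - Complex 0 (realZ_g x yz).

Lemma cmeas_realZ_levy_fun yz :
  cmeas (realZ_levy_fun yz : borel (realZ R n) -> R[i]).
Proof.
have [c1 c2] := cmeas_realZ_char yz; split.
  rewrite (_ : (fun x => _) = (fun x => complex.Re (realZ_char yz x) - 1)); last first.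
    by apply/funext => x; rewrite /realZ_levy_fun; case: realZ_char => a b /=; rewrite subr0.
  exact: measurable_funB.
rewrite (_ : (fun x => _) = (fun x => complex.Im (realZ_char yz x) - realZ_g x yz)); last first.
  by apply/funext => x; rewrite /realZ_levy_fun; case: realZ_char => a b /=; rewrite subr0.
apply: measurable_funB => //; apply: measurable_funM => //.
exact: (measurableT_comp measurable_h measurable_realZ_fst).
Qed.

Lemma realZ_levy_fun0 yz : realZ_levy_fun yz 0 = 0.
Proof.
rewrite /realZ_levy_fun realZ_char0 subrr /realZ_g h_id/= ?normr0// mulr0.
by rewrite -[Complex 0 0]/(0 : R[i]) subrr.
Qed.

Lemma normc_realZ_levy_fun_le yz x : normc (realZ_levy_fun yz x) <= 2 + `|yz.1| * pi.
Proof.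
rewrite /realZ_levy_fun; apply: le_trans (le_normcD _ _) _.
rewrite normcN; apply: lerD.
  by apply: le_trans (le_normcD _ _) _; rewrite normcN normc1 normc_realZ_char.
by rewrite /= expr0n add0r sqrtr_sqr /realZ_g normrM ler_wpM2l// norm_h_le.
Qed.

(** On the integer slice 0, and where [h] is the identity, the integrand is [e^(iu) - 1 - iu] with
    [u] the product of the two real coordinates: the compensator cancels the linear term. *)
Lemma normc_realZ_levy_fun_small yz x : `|x.1| < 1 -> x.2 = 0 ->
  normc (realZ_levy_fun yz x) <= 3 * yz.1 ^+ 2 * x.1 ^+ 2.
Proof.
move=> x1 x2; rewrite /realZ_levy_fun /realZ_char /realZ_g h_id// x2.
rewrite big1 ?mulr1; last by move=> k _; rewrite mxE expr0z.
by apply: le_trans (normc_cisB_le _) _; rewrite exprMn mulrA.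
Qed.

End realZ_character_facts.

Section levy_function.
Context {R : realType} {p : nat} (pp : prime p).
Variable eta : {measure set (borel (solenoid R p)) -> \bar R}.
Hypothesis Heta : is_levy eta.
Variable n : nat.

Lemma taun_Vset j x : (n <= j)%N -> (0 < j)%N -> @Vset R p j x ->
  `|(taun n x).1| < 1 /\ (taun n x).2 = 0.
Proof.
move=> nj j0 [x1 x2]; split.
  by apply: lt_le_trans x1 _; rewrite invf_le1 ?ler1n// ltr0n.
by apply/rowP => k; rewrite !mxE x2//; exact: leq_trans (ltn_ord k) nj.
Qed.

(** The integrability criterion used throughout: [f] is dominated by a multiple of the indicator of
    the complement of [Vset j], which has finite mass, plus a multiple of the integrable square of
    [arg x_0]. *)
Lemma levy_dominated (f : borel (solenoid R p) -> R[i]) (M c : R) j :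
  cmeas f -> (forall x, normc (f x) <= M) ->
  (forall x, Vset j x -> normc (f x) <= c * arg (scoord x 0) ^+ 2) ->
  cintble eta f.
Proof.
move=> mf fM fc.
have mV : measurable (~` @Vset R p j) by apply: measurableC; exact: measurable_Vset.
have iV : eta.-integrable setT (EFin \o (fun x => \1_(~` @Vset R p j) x : R)).
  apply/integrableP; split; first by apply/measurable_EFinP; exact: measurable_indic.
  under eq_integral => x _ do rewrite /= ger0_norm//.
  by rewrite integral_indic// setIT; exact: (levy_Vset pp Heta).
apply: (cintbleP mf (b := fun x => `|M| * \1_(~` @Vset R p j) x +
    `|c| * arg (scoord x 0) ^+ 2)); last first.
  apply: integrableRD; apply: integrableRZ => //; exact: levy_sqr_integrable.
move=> x; have s0 := sqr_ge0 (arg (scoord x 0)); rewrite indicE.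
have [Vx|nVx] := pselect (Vset j x).
  rewrite (_ : _ \in _ = false) ?mulr0 ?add0r; last by apply/negbTE; rewrite notin_setE.
  by apply: le_trans (fc x Vx) _; rewrite ler_wpM2r// ler_norm.
have -> : x \in ~` @Vset R p j by rewrite inE.
rewrite mulr1.
by apply: le_trans (fM x) _; apply: le_trans (ler_norm M) _; rewrite lerDl mulr_ge0.
Qed.

Lemma cmeas_taun (f : borel (realZ R n) -> R[i]) : cmeas f ->
  cmeas (fun x : borel (solenoid R p) => f (taun n x)).
Proof. by move=> mf; apply: (cmeas_comp mf); exact: measurable_taun. Qed.

Lemma cintble_levy_fun yz :
  cintble eta (fun x => realZ_levy_fun yz (taun n x)).
Proof.
apply: (@levy_dominated _ (2 + `|yz.1| * pi) (3 * yz.1 ^+ 2) n.+1).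
- exact: cmeas_taun (cmeas_realZ_levy_fun yz).
- by move=> x; exact: normc_realZ_levy_fun_le.
- move=> x Vx; have [x1 x2] := taun_Vset (leqnSn n) (ltn0Sn n) Vx.
  exact: normc_realZ_levy_fun_small.
Qed.

End levy_function.

(** * Behaviour of characters of R x Z^n near the origin *)

Section realZ_levy.
Context {R : realType} {n : nat}.

Lemma nbhs0_realZ (U : set (realZ R n)) : nbhs (0 : realZ R n) U ->
  exists2 r : R, 0 < r & forall x : realZ R n, `|x.1| < r -> x.2 = 0 -> U x.
Proof.
case=> -[A B] /= [nA nB] AB.
have [r r0 rA] := (nbhs_ballP _ _).1 nA; exists r => // x x1 x2; apply: AB; split => /=.
  by apply: rA; rewrite /ball /= sub0r normrN.
by rewrite x2; exact: nbhs_singleton nB.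
Qed.

(* With [w = (1 - c) / (1 + c)], i.e. [w = tan (t / 2) ^ 2] for [c = cos t], the
   duplication formula gives [4 * w(x) <= w(2 * x)], whence [w = O(x ^ 2)]. *)
Lemma double_cos_bound (c : R -> R) (r : R) : 0 < r ->
  (forall x, c (x + x) = 2 * c x ^+ 2 - 1) -> c 0 = 1 ->
  (forall x, `|x| <= r -> 0 < c x <= 1) ->
  forall x, `|x| <= r -> 1 - c x <= 8 / r ^+ 2 * x ^+ 2.
Proof.
move=> r0 c2 c0 cr.
have r2 : 0 < r ^+ 2 by rewrite exprn_gt0.
have key k : forall x, r / 2 ^+ k < `|x| -> `|x| <= r ->
    (1 - c x) / (1 + c x) <= 4 / r ^+ 2 * x ^+ 2.
  elim: k => [x|k IH x xk xr].
    by rewrite expr0 divr1 => /lt_le_trans h /h; rewrite ltxx.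
  have /andP[cx0 cx1] := cr x xr.
  have [xr2|xr2] := leP `|x + x| r.
    have /andP[c2x0 c2x1] := cr _ xr2.
    have xx : `|x + x| = 2 * `|x| by rewrite -mulr2n normrMn mulr_natl.
    have : (1 - c (x + x)) / (1 + c (x + x)) <= 4 / r ^+ 2 * (x + x) ^+ 2.
      apply: IH => //; rewrite xx; move: xk; rewrite exprS.
      by rewrite invfM mulrCA -ltr_pdivlMl ?invr_gt0// invrK.
    have -> : 4 / r ^+ 2 * (x + x) ^+ 2 = 4 * (4 / r ^+ 2 * x ^+ 2) by ring.
    have : 0 <= 4 / r ^+ 2 * x ^+ 2 by rewrite mulr_ge0 ?sqr_ge0// divr_ge0// ltW.
    move: (4 / r ^+ 2 * x ^+ 2) => K K0.
    rewrite c2 !ler_pdivrMr; [|by lra|by have := mulr_gt0 cx0 cx0; rewrite -expr2; lra] => h1.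
    have h2 : 0 <= (1 + c x) * (K * (1 + c x) - (1 - c x)).
      have : 0 <= K * ((1 + c x) ^+ 2 - 4 * c x ^+ 2) by rewrite mulr_ge0//; nra.
      by nra.
    by rewrite -subr_ge0 -(pmulr_rge0 _ (_ : 0 < 1 + c x))//; lra.
  (* Here [2 |x| > r]: the quotient is at most 1 because [c x > 0], while [4 x ^ 2 / r ^ 2] is at
     least 1. *)
  apply: (@le_trans _ _ 1); first by rewrite ler_pdivrMr; lra.
  rewrite mulrAC ler_pdivlMr// mul1r -(real_normK (num_real x)).
  have : r < 2 * `|x| by move: xr2; rewrite -mulr2n normrMn mulr_natl.
  have : 0 <= `|x| by []; nra.
move=> x xr; have [->|x0] := eqVneq x 0; first by rewrite c0 subrr expr0n mulr0.
have x0' : 0 < `|x| by rewrite normr_gt0.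
have [k xk] : exists k, r / 2 ^+ k < `|x|.
  exists (Num.truncn (r / `|x|)).+1; rewrite ltr_pdivrMr ?exprn_gt0//.
  rewrite mulrC -ltr_pdivrMr//; apply: lt_trans (truncnS_gt _) _.
  by rewrite -natrX ltr_nat ltn_expl.
have /andP[cx0 cx1] := cr x xr.
have := key k x xk xr; rewrite ler_pdivrMr; last by lra.
have : 0 <= 4 / r ^+ 2 * x ^+ 2 by rewrite mulr_ge0 ?sqr_ge0// divr_ge0// ltW.
have -> : 8 / r ^+ 2 * x ^+ 2 = 2 * (4 / r ^+ 2 * x ^+ 2) by ring.
by move: (4 / r ^+ 2 * x ^+ 2) => K; nra.
Qed.

Lemma continuous_re_character (chi : realZ R n -> circle R) : continuous chi ->
  continuous (fun x => complex.Re (val (chi x))).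
Proof.
move=> chic x.
apply: (@continuous_comp _ _ _ (fun x : realZ R n => val (chi x)) (@complex.Re R)); last exact: continuous_Re.
apply: (@continuous_comp _ _ _ chi (val : circle R -> R[i])); first exact: chic.
exact: (@initial_continuous _ _ (set_val : set_type (circle_set R) -> R[i])).
Qed.

Lemma measurable_realZ0 : measurable ([set 0] : set (borel (realZ R n))).
Proof.
rewrite (_ : [set 0] = (fun x : borel (realZ R n) => x.1) @^-1` [set 0] `&` [set x | [set 0] x.2]); last first.
  by apply/seteqP; split => -[x l] /= => [[-> ->]//|[-> ->]].
apply: measurableI; last exact: measurable_realZ_snd.
by rewrite -[X in measurable X]setTI; exact: measurable_realZ_fst.
Qed.

(** The explicit form of the characters is bypassed: along the real axis the real part of any
    continuous homomorphism satisfies the duplication formula of the cosine and is positive near 0,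
    which is all that [double_cos_bound] asks for. *)
Lemma character_quadratic (chi : realZ R n -> circle R) : is_character chi ->
  exists r C : R, 0 < r /\ forall x : realZ R n, `|x.1| <= r -> x.2 = 0 ->
    1 - complex.Re (val (chi x)) <= C * x.1 ^+ 2.
Proof.
move=> [chic chiD].
have chi0 : val (chi 0) = 1.
  apply: (mulfI (circle_neq0 (chi 0))); rewrite -chiD addr0 mulr1//.
have cvc : (fun x => complex.Re (val (chi x))) @ (0 : realZ R n) --> (1 : R).
  have <- : complex.Re (val (chi 0)) = 1 by rewrite chi0.
  exact: continuous_re_character.
have [r r0 rpos] : exists2 r : R, 0 < r & forall x : realZ R n, `|x.1| < r -> x.2 = 0 ->
    0 < complex.Re (val (chi x)).
  apply: nbhs0_realZ; have := cvgr_gt _ cvc _ (ltr01 : (0 : R) < 1).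
  exact.
exists (r / 2), (8 / (r / 2) ^+ 2); split; first by rewrite divr_gt0.
move=> -[x l] /= xr ->.
pose c (x : R) := complex.Re (val (chi ((x, 0) : realZ R n))).
have le1 (z : circle R) : complex.Re (val z) <= 1.
  by apply: le_trans (ler_norm _) _; rewrite (le_trans (normc_ge_absRe _))// normc_circle.
apply: (@double_cos_bound c _ _ _ _ _ x) => //.
- by rewrite divr_gt0.
- move=> y; rewrite /c.
  have -> : ((y + y, 0) : realZ R n) = ((y, 0) : realZ R n) + ((y, 0) : realZ R n).
    by congr pair; rewrite addr0.
  rewrite chiD creM; have := normc_circle (chi ((y, 0) : realZ R n)).
  case: (val _) => a b /= /(congr1 (fun z => z ^+ 2)).
  by rewrite sqr_sqrtr ?addr_ge0 ?sqr_ge0// expr1n; lra.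
- by rewrite /c -[(0, 0)]/(0 : realZ R n) chi0.
- move=> y yr; rewrite le1 andbT; apply: rpos => //=; apply: le_lt_trans yr _; lra.
Qed.

End realZ_levy.

Section tau_image_levy.
Context {R : realType} {p : nat} (pp : prime p) (n : nat).
Variables (eta : {measure set (borel (solenoid R p)) -> \bar R})
  (etan : {measure set (borel (realZ R n)) -> \bar R}).
Hypothesis Heta : is_levy eta.
Hypothesis etanE : is_tau_image eta etan.

(** A neighbourhood of 0 contains a segment of the slice 0, so its complement pulls back into the
    union of a set where [|arg x_0| >= r] and the complement of some [Vset]. For a character,
    [1 - Re chi] composed with [taun] is bounded by 2 and quadratic in [arg x_0] on a small [Vset],
    so [levy_dominated] applies. *)
Lemma tau_image_levy : is_levy etan.
Proof.
have [e0 _] := etanE; split => // [U mU nU|chi chich].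
  have [r r0 rU] := nbhs0_realZ nU.
  rewrite (tau_imageE etanE); last exact: measurableC.
  pose A : set (borel (solenoid R p)) := [set x | (r <= `|arg (scoord x 0)|)%R].
  have mA : measurable A.
    have := @measurable_norm_arg R p 0 measurableT _ (measurable_itv `[r, +oo[).
    by rewrite setTI; congr measurable; apply/seteqP; split => x /=; rewrite in_itv/= andbT.
  have mV : measurable (~` @Vset R p n.+1) by apply: measurableC; exact: measurable_Vset.
  have fin : (eta (A `|` ~` @Vset R p n.+1) < +oo)%E.
    apply: le_lt_trans (measureU2 _ _ _) _ => //.
    by apply: lte_add_pinfty; [exact: levy_arg_ge|exact: (levy_Vset pp Heta)].
  apply: le_lt_trans fin; apply: le_measure; rewrite ?inE.
  - rewrite (_ : [set x | _] = [set x | (~` U) (taun n x)] `\` [set x | [set 0] (taun n x)]); last first.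
      by apply/seteqP; split => x [].
    have mt (B : set (borel (realZ R n))) : measurable B ->
        measurable ([set x | B (taun n x)] : set (borel (solenoid R p))).
      by move=> mB; rewrite -[X in measurable X]setTI; exact: measurable_taun.
    apply: measurableD; apply: mt; first exact: measurableC.
    exact: measurable_realZ0.
  - exact: measurableU.
  - move=> x [nUx _]; apply: contrapT => /not_orP[nA /contrapT Vx]; apply: nUx.
    have [_ t2] := taun_Vset (leqnSn n) (ltn0Sn n) Vx.
    by apply: rU => //=; rewrite ltNge; apply/negP.
have [r [C [r0 Cr]]] := character_quadratic chich.
have [[chic chiD] mf] : is_character chi /\ measurable_fun setT
    (fun x : borel (realZ R n) => 1 - complex.Re (val (chi x))).
  split => //; apply: measurable_funB => //.
  exact: (@continuous_borel_measurable R (realZ R n) _ (continuous_re_character chich.1)).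
have chi0 : val (chi 0) = 1.
  apply: (mulfI (circle_neq0 (chi 0))); rewrite -chiD addr0 mulr1//.
rewrite (integral_tau_image etanE); last 2 first.
- exact/measurable_EFinP.
- by rewrite chi0 subrr.
have cle (z : circle R) : `|complex.Re (val z)| <= 1.
  by rewrite (le_trans (normc_ge_absRe _))// normc_circle.
have [j rj] : exists j, j.+1%:R^-1 < r.
  by have [j _ /(_ j (leqnn _))] := near_infty_natSinv_lt (PosNum r0); exists j.
pose f (x : borel (solenoid R p)) := (1 - complex.Re (val (chi (taun n x))))%:C%C.
have f2 (x : borel (solenoid R p)) : normc (f x) = `|1 - complex.Re (val (chi (taun n x)))|.
  by rewrite /f /= expr0n addr0 sqrtr_sqr.
(* The index [(n + j).+1] is large enough both to annihilate [n] integer coordinates and to force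
   [|arg x_0| < r]. *)
have [|||If _] := @levy_dominated R p pp eta Heta f 2 C (n + j).+1.
- by split => //=; exact: (measurableT_comp mf (@measurable_taun R p n)).
- move=> x; rewrite f2; apply: le_trans (ler_normB _ _) _.
  by rewrite normr1; have := cle (chi (taun n x)); lra.
- move=> x Vx; rewrite f2 ger0_norm; last first.
    by rewrite subr_ge0; exact: le_trans (ler_norm _) (cle _).
  apply: (Cr (taun n x)).
    have [/= Vx1 _] := Vx; apply: ltW; apply: lt_trans Vx1 (le_lt_trans _ rj).
    by rewrite lef_pV2 ?posrE// ler_nat; lia.
  by apply: (taun_Vset _ _ Vx).2; lia.
have /integrableP[_] := If; apply: le_lt_trans; apply: ge0_le_integral => //.
- move=> x _; rewrite lee_fin subr_ge0; exact: le_trans (ler_norm _) (cle _).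
- by apply/measurable_EFinP; exact: (measurableT_comp mf (@measurable_taun R p n)).
- by apply: measurableT_comp => //; exact: measurable_int If.
- by move=> x _; rewrite lee_fin ler_norm.
Qed.

End tau_image_levy.

(** * Realization of Poisson jumps *)

Lemma mnormalizeE d (T : measurableType d) (R : realType) (mu : {measure set T -> \bar R})
    (P : probability T R) (r : R) A : mu setT = r%:E -> r != 0 ->
  mnormalize mu P A = (mu A * (r^-1)%:E)%E.
Proof. by move=> mr r0; rewrite /mnormalize mr /= eqe (negbTE r0). Qed.

Section shell.
Context d (S : measurableType d) (R : realType).
Variables (eta : {measure set S -> \bar R}) (E : set S) (mE : measurable E) (e : S).

Definition shell_mass : R := fine (eta E) + 1.

(* The Dirac mass keeps the total mass nonzero when [eta E = 0]; jumps at [e]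
   contribute nothing because test functions are constant outside [E]. *)
Definition shell_law : probability S R :=
  mnormalize (measure_add (mrestr eta mE) (dirac e)) (dirac e).

Hypothesis finE : (eta E < +oo)%E.
Hypothesis eE : ~ E e.

Lemma shell_mass_gt0 : 0 < shell_mass.
Proof. by rewrite ltr_pwDr// fine_ge0. Qed.

Let massE : measure_add (mrestr eta mE) (dirac e) setT = shell_mass%:E.
Proof.
rewrite measure_addE; change (eta (setT `&` E) + dirac e setT = shell_mass%:E)%E.
by rewrite setTI diracT /shell_mass EFinD fineK// ge0_fin_numE.
Qed.

Lemma shell_lawE A : measurable A -> A `<=` E ->
  (shell_mass%:E * shell_law A = eta A)%E.
Proof.
move=> mA AE; have m0 := shell_mass_gt0.
have -> : shell_law A = (measure_add (mrestr eta mE) (dirac e) A * (shell_mass^-1)%:E)%E.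
  change (mnormalize (measure_add (mrestr eta mE) (dirac e)) (dirac e) A =
    (measure_add (mrestr eta mE) (dirac e) A * (shell_mass^-1)%:E)%E).
  by rewrite (mnormalizeE _ _ massE)// gt_eqF.
have -> : measure_add (mrestr eta mE) (dirac e) A = eta A.
  rewrite measure_addE; change (eta (A `&` E) + dirac e A = eta A)%E.
  by rewrite setIidl// diracE memNset ?adde0// => /AE.
by rewrite muleCA -EFinM mulfV ?gt_eqF// mule1.
Qed.

Lemma ge0_integral_shell (f : S -> \bar R) : measurable_fun setT f ->
  (forall x, 0 <= f x)%E -> (forall x, ~ E x -> f x = 0%E) ->
  (shell_mass%:E * \int[shell_law]_x f x = \int[eta]_x f x)%E.
Proof.
move=> mf f0 fE.
have fD : f = f \_ E.
  by apply/funext => x; rewrite patchE; case: ifPn => //; rewrite notin_setE => /fE.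
have m0 := shell_mass_gt0.
pose m : {nonneg R} := NngNum (ltW m0).
transitivity (\int[mscale m shell_law]_x f x)%E; first by rewrite ge0_integral_mscale.
rewrite fD -!integral_mkcond; apply: eq_measure_integral => A mA AE.
by rewrite /mscale /=; exact: shell_lawE.
Qed.

Lemma Rintegral_shell (f : S -> R) : measurable_fun setT f ->
  (forall x, ~ E x -> f x = 0) ->
  shell_mass * \int[shell_law]_x f x = \int[eta]_x f x.
Proof.
move=> mf fE; have m0 := shell_mass_gt0.
have mf' : measurable_fun setT (EFin \o f) by exact/measurable_EFinP.
have fineM' (x : \bar R) : shell_mass * fine x = fine (shell_mass%:E * x)%E.
  case: x => [x| |] //=; first by rewrite gt0_muley ?lte_fin// mulr0.
  by rewrite gt0_muleNy ?lte_fin// mulr0.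
have muleB' (x y : \bar R) : (shell_mass%:E * (x - y) = shell_mass%:E * x - shell_mass%:E * y)%E.
  by case: x y => [x| |] [y| |] //=; rewrite -?EFinB -?EFinM ?mulrBr ?gt0_muley ?gt0_muleNy ?lte_fin.
rewrite /Rintegral fineM' integralE [in RHS]integralE; congr fine.
rewrite muleB'.
  by rewrite !ge0_integral_shell//; do ?[exact: measurable_funepos|exact: measurable_funeneg];
   move=> x /fE fx; rewrite ?funeposE ?funenegE /= fx ?oppr0 ?maxxx.
Qed.

(** The left side is the exponent of a compound Poisson transform. As [F - 1] vanishes off [E],
    neither the added Dirac mass nor the possibly infinite mass of [eta] outside [E] is felt. *)
Lemma cint_shell (F : S -> R[i]) : cmeas F ->
  (forall x, normc (F x) <= 1) -> (forall x, ~ E x -> F x = 1) ->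
  shell_mass%:C%C * (cint shell_law F - 1) = cint eta (fun x => F x - 1).
Proof.
move=> mF F1 FE.
have iF : cintble shell_law F by exact: bounded_cintble (probability_lty _) mF F1.
have -> : cint shell_law F - 1 = cint shell_law (fun x => F x + (- 1)).
  rewrite cintD ?cint_cst//.
  by apply: (bounded_cintble (M := 1)); [exact: probability_lty|exact: cmeas_cst|
    move=> x; rewrite normcN normc1].
have [mF1 mF2] : cmeas (fun x => F x + (- 1)) by apply: cmeasD => //; exact: cmeas_cst.
apply/eqP; rewrite eq_complex creM cimM /= !mul0r subr0 addr0.
by rewrite !Rintegral_shell ?eqxx// => x /FE ->; rewrite subrr.
Qed.

End shell.

(** * Second moments and almost sure convergence *)

Lemma probability_integral_cst d (T : measurableType d) (R : realType)
    (P : probability T R) (r : R) : (\int[P]_x r%:E = r%:E)%E.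
Proof.
have -> : (\int[P]_x r%:E = r%:E * P setT)%E by rewrite -integral_cst.
have -> : P setT = 1%E by rewrite probability_setT.
by rewrite mule1.
Qed.

(** A second moment is read off the characteristic function at 0: where [|z| <= n + 1],
    [one_minus_cos_ge] bounds [z ^ 2] by [4 (n + 1) ^ 2 (1 - cos (z / (n + 1)))], and monotone
    convergence removes the truncation. *)
Lemma second_moment_le d (T : measurableType d) (R : realType) (P : probability T R)
    (z : T -> R) (v : R) : measurable_fun setT z ->
  (\forall n \near \oo, (\int[P]_w (1 - cos (z w / n.+1%:R))%:E <= (v / n.+1%:R ^+ 2)%:E)%E) ->
  (\int[P]_w (z w ^+ 2)%:E <= (4 * v)%:E)%E.
Proof.
move=> mz Hn.
pose A n := [set w | `|z w| <= n.+1%:R].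
have mA n : measurable (A n).
  have mz' : measurable_fun setT (fun w => `|z w|) by exact: measurableT_comp.
  have := mz' measurableT _ (measurable_itv `]-oo, n.+1%:R]).
  by rewrite setTI; congr measurable; apply/seteqP; split => x /=; rewrite in_itv.
pose q w := (z w ^+ 2)%:E.
have mq : measurable_fun setT q by apply/measurable_EFinP; exact: measurable_funX.
have q0 w : (0 <= q w)%E by rewrite lee_fin sqr_ge0.
pose f n := q \_ (A n).
have mf n : measurable_fun setT (f n).
  by apply/(measurable_restrictT _ (mA n)); exact: measurable_funTS.
have f0 n w : (0 <= f n w)%E by rewrite /f patchE; case: ifP.
have fn m n w : (m <= n)%N -> (f m w <= f n w)%E.
  move=> mn; rewrite /f !patchE; case: ifPn => [|_]; last by case: ifP.
  rewrite inE => wm; rewrite ifT// inE /A /=; apply: le_trans wm _.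
  by rewrite ler_nat.
have -> : (\int[P]_w (z w ^+ 2)%:E = \int[P]_w limn (f ^~ w))%E.
  apply: eq_integral => w _; apply/esym/cvg_lim => //.
  apply: cvg_near_cst; exists (Num.truncn `|z w|) => // n /= zn.
  rewrite /f patchE ifT// inE /A /=; apply: ltW; apply: lt_le_trans (truncnS_gt _) _.
  by rewrite ler_nat ltnS.
rewrite monotone_convergence//; last by move=> w _ m n; exact: fn.
apply: lime_le.
  by apply: ereal_nondecreasing_is_cvgn => m n mn; apply: ge0_le_integral => // w _; exact: fn.
apply: filterS Hn => n Hn.
have n0 : 0 < n.+1%:R ^+ 2 :> R by rewrite exprn_gt0.
apply: (@le_trans _ _ (\int[P]_w ((4 * n.+1%:R ^+ 2)%:E * (1 - cos (z w / n.+1%:R))%:E))%E).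
  apply: ge0_le_integral => //.
  - apply: measurable_funeM; apply/measurable_EFinP; apply: measurable_funB => //.
    apply: measurableT_comp; first by apply: continuous_measurable_fun; exact: continuous_cos.
    exact: measurable_funM.
  - move=> w _; rewrite /f patchE -EFinM; case: ifPn => [|_]; last first.
      by rewrite lee_fin mulr_ge0 ?one_minus_cos_ge0// mulr_ge0// ltW.
    rewrite inE /A /= => wn; rewrite lee_fin -mulrA mulrCA.
    rewrite -ler_pdivrMl// [_^-1 * _]mulrC.
    have : `|z w / n.+1%:R| <= 1 by rewrite normrM normfV normr_nat ler_pdivrMr// mul1r.
    by rewrite -expr_div_n; move: (z w / n.+1%:R) => x /one_minus_cos_ge; lra.
rewrite ge0_integralZl//; last first.
  apply/measurable_EFinP; apply: measurable_funB => //.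
  apply: measurableT_comp; first by apply: continuous_measurable_fun; exact: continuous_cos.
  exact: measurable_funM.
apply: le_trans (lee_wpmul2l _ Hn) _; first by rewrite lee_fin mulr_ge0// ltW.
rewrite -EFinM lee_fin; move: (n.+1%:R ^+ 2) n0 => a a0.
by rewrite -mulrA [a * _]mulrC divfK// gt_eqF.
Qed.

(** From [|z| <= 2 ^ k z ^ 2 + 2 ^ -k] (compare [|z|] with [2 ^ -k]), the mean of [|z k|] is at most
    [(C + 1) 2 ^ -k], because [2 ^ k 8 ^ -k = 4 ^ -k]. The sum of the absolute values is therefore
    integrable, hence finite almost everywhere. *)
Lemma series_cvg_ae d (T : measurableType d) (R : realType) (P : probability T R)
    (z : nat -> T -> R) (C : R) : (forall k, measurable_fun setT (z k)) ->
  (forall k, (\int[P]_w (z k w ^+ 2)%:E <= (C * 8^-1 ^+ k)%:E)%E) ->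
  {ae P, forall w, cvgn (series (z ^~ w))}.
Proof.
move=> mz Hz.
have mn k : measurable_fun setT (fun w => `|z k w|%:E).
  by apply/measurable_EFinP; exact: measurableT_comp.
have C0 : 0 <= C.
  have := Hz 0%N; rewrite expr0 mulr1 -lee_fin; apply: le_trans.
  by apply: integral_ge0 => w _; rewrite lee_fin sqr_ge0.
have H1 k : (\int[P]_w `|z k w|%:E <= ((C + 1) * 2^-1 ^+ k)%:E)%E.
  apply: (@le_trans _ _ (\int[P]_w ((2 ^+ k)%:E * (z k w ^+ 2)%:E + (2^-1 ^+ k)%:E))%E).
    have h0 : 0 <= 2^-1 ^+ k :> R by rewrite exprn_ge0.
    apply: ge0_le_integral => //.
    - apply: emeasurable_funD => //; apply: measurable_funeM; apply/measurable_EFinP.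
      exact: measurable_funX.
    - move=> w _; rewrite -EFinM -EFinD lee_fin -(real_normK (num_real (z k w))).
      have : (2 ^+ k) * (2^-1 ^+ k) = 1 :> R by rewrite -exprMn mulfV// expr1n.
      have : 0 < 2 ^+ k :> R by rewrite exprn_gt0.
      move: (2 ^+ k) (2^-1 ^+ k) h0 `|_| => a b b0 x a0 ab.
      have [x1|x1] := leP x b; first by have := mulr_ge0 (ltW a0) (sqr_ge0 x); lra.
      have : 1 <= a * x by rewrite -ab ler_pM2l// ltW.
      have : 0 <= x by exact: le_trans b0 (ltW x1).
      nra.
  rewrite ge0_integralD//; last 2 first.
  - by move=> w _; rewrite -EFinM lee_fin mulr_ge0 ?sqr_ge0 ?exprn_ge0.
  - by apply: measurable_funeM; apply/measurable_EFinP; exact: measurable_funX.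
  rewrite probability_integral_cst ge0_integralZl//; [|by apply/measurable_EFinP; exact: measurable_funX|
    by move=> w _; rewrite lee_fin sqr_ge0].
  apply: le_trans (leeD2r _ (lee_wpmul2l _ (Hz k))) _; first by rewrite lee_fin exprn_ge0.
  rewrite -EFinM -EFinD lee_fin mulrDl mul1r lerD2r mulrCA ler_wpM2l// -exprMn.
  have h : 2 * 8^-1 <= 2^-1 :> R by lra.
  by apply: lerXn2r => //; rewrite nnegrE; lra.
have fin : (\int[P]_w (\sum_(k <oo) `|z k w|%:E) < +oo)%E.
  rewrite integral_nneseries//.
  apply: (@le_lt_trans _ _ (\sum_(k <oo) ((C + 1) * 2^-1 ^+ k)%:E)%E).
    by apply: lee_nneseries => [k _ _|k _ //]; apply: integral_ge0.
  have h2 : `|2^-1| < 1 :> R by rewrite ger0_norm; lra.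
  have cv := @cvg_geometric_series _ (C + 1) _ h2.
  suff -> : (\sum_(k <oo) ((C + 1) * 2^-1 ^+ k)%:E = ((C + 1) * (1 - 2^-1)^-1)%:E)%E by exact: ltry.
  apply/cvg_lim => //.
  rewrite (_ : (fun n => _) = EFin \o series (geometric (C + 1) 2^-1)); last first.
    by apply/funext => n; rewrite /= /series /= sumEFin.
  by apply/cvg_EFin; [near=> n|exact: cv].
have ms : measurable_fun setT (fun w => (\sum_(k <oo) `|z k w|%:E)%E).
  by apply: ge0_emeasurable_sum.
have iS : P.-integrable setT (fun w => (\sum_(k <oo) `|z k w|%:E)%E).
  apply/integrableP; split => //; under eq_integral => w _ do rewrite gee0_abs ?nneseries_ge0//.
  exact: fin.
have := integrable_ae measurableT iS; apply: filterS => w /(_ I) sfin.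
apply: normed_cvg; apply: nondecreasing_is_cvgn.
  apply/nondecreasing_seqP => n.
  change (\sum_(0 <= k < n) `|z k w| <= \sum_(0 <= k < n.+1) `|z k w|).
  by rewrite big_nat_recr//= lerDl.
exists (fine (\sum_(k <oo) `|z k w|%:E)%E) => _ [n _ <-].
rewrite -lee_fin fineK// /series /= -sumEFin.
by apply: nneseries_lim_ge => k _ _; rewrite lee_fin.
Unshelve. all: by end_near. Qed.

(** * Independent compound Poisson blocks *)

Section poisson_shells.
Context d (S : measurableType d) (R : realType).
Variables (eta : {measure set S -> \bar R}) (E : nat -> set S).
Hypothesis mE : forall k, measurable (E k).
Hypothesis finE : forall k, (eta (E k) < +oo)%E.
Variable e : S.
Hypothesis eE : forall k, ~ E k e.

Definition poisson_law : probability (seqspace (nat * seqspace S)%type) R :=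
  infprod (fun k => compound_poisson (shell_mass eta (E k)) (shell_law eta (mE k) e)).

Definition block_sum (g : S -> R) k (w : seqspace (nat * seqspace S)%type) : R :=
  \sum_(i < (w k).1) g ((w k).2 i).

Lemma measurable_block_sum g k : measurable_fun setT g ->
  measurable_fun setT (block_sum g k).
Proof.
move=> mg; apply: (measurableT_comp (measurable_compound_sum mg)).
exact: (measurable_coord k).
Qed.

Lemma cint_poisson_blocks (F : nat -> S -> R[i]) K : (forall k, cmeas (F k)) ->
  (forall k x, normc (F k x) <= 1) -> (forall k x, ~ E k x -> F k x = 1) ->
  cint poisson_law (fun w => \prod_(k < K) \prod_(i < (w k).1) F k ((w k).2 i)) =
  \prod_(k < K) cexp (cint eta (fun x => F k x - 1)).
Proof.
move=> mF F1 FE.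
rewrite (cint_infprod _ (F := fun k (u : nat * seqspace S) => \prod_(i < u.1) F k (u.2 i))); last 2 first.
- by move=> k; exact: cmeas_compound.
- by move=> k u; exact: normc_prod_le1.
apply: eq_bigr => k _; rewrite cint_compound_poisson//; last first.
  by apply: shell_mass_gt0.
by congr cexp; apply: cint_shell => //; exact: FE.
Qed.

Lemma cint_poisson_block (F : S -> R[i]) k : cmeas F ->
  (forall x, normc (F x) <= 1) -> (forall x, ~ E k x -> F x = 1) ->
  cint poisson_law (fun w => \prod_(i < (w k).1) F ((w k).2 i)) =
  cexp (cint eta (fun x => F x - 1)).
Proof.
move=> mF F1 FE.
pose G j x := if j == k then F x else 1.
have := @cint_poisson_blocks G k.+1; rewrite !big_ord_recr /= big1 => [|j _]; last first.
  rewrite /G ltn_eqF//; transitivity (cexp 0 : R[i]); last exact: cexp0.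
  congr cexp; transitivity (cint eta (fun=> 0)); first by apply: eq_cint => x; rewrite subrr.
  by rewrite /cint /Rintegral /= integral0.
rewrite mul1r /G eqxx => <-.
- apply: eq_cint => w; rewrite [in RHS]big_ord_recr /= eqxx [X in _ = X * _]big1 ?mul1r// => j _.
  by rewrite ltn_eqF// big1.
- by move=> j; have [_|_] := eqVneq j k; [exact: mF|exact: cmeas_cst].
- by move=> j x; case: ifP => // _; rewrite normc1.
- by move=> j x; case: eqP => // -> /FE.
Qed.

Section one_block.
Variables (g : S -> R) (k : nat).
Hypothesis mg : measurable_fun setT g.
Hypothesis gE : forall x, ~ E k x -> g x = 0.
Hypothesis g1 : forall x, `|g x| <= pi.

Let restr_integrable (f : S -> R) (M : R) : measurable_fun setT f ->
  (forall x, `|f x| <= M) -> (forall x, ~ E k x -> f x = 0) ->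
  eta.-integrable setT (EFin \o f).
Proof.
move=> mf fM fE.
have M0 : 0 <= M by exact: le_trans (normr_ge0 _) (fM e).
have iE : eta.-integrable setT (EFin \o (fun x => \1_(E k) x : R)).
  apply/integrableP; split; first by apply/measurable_EFinP; exact: measurable_indic.
  under eq_integral => x _ do rewrite /= ger0_norm//.
  by rewrite integral_indic// setIT.
apply: le_integrable (integrableRZ M iE) => //; first exact/measurable_EFinP.
move=> x _ /=; rewrite lee_fin indicE; apply: le_trans (ler_norm _).
have [Ex|nEx] := pselect (E k x).
  by rewrite (_ : x \in E k) ?mulr1 ?inE.
by rewrite fE// normr0 mulr_ge0.
Qed.

Lemma block_integrable : eta.-integrable setT (EFin \o g).
Proof. exact: restr_integrable. Qed.

Lemma block_sqr_integrable : eta.-integrable setT (EFin \o (fun x => g x ^+ 2)).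
Proof.
apply: (@restr_integrable _ (pi ^+ 2)); first exact: measurable_funX.
  by move=> x; rewrite normrX lerXn2r// nnegrE// pi_ge0.
by move=> x /gE ->; rewrite expr0n.
Qed.

Definition centered_block w : R := block_sum g k w - \int[eta]_x g x.

Lemma cis_sum I (r : seq I) (F : I -> R) :
  cis (\sum_(i <- r) F i) = \prod_(i <- r) cis (F i).
Proof.
elim: r => [|i r IH]; first by rewrite !big_nil cis0.
by rewrite !big_cons cisD IH.
Qed.

Lemma charfun_centered_block t :
  cint poisson_law (fun w => cis (t * centered_block w)) =
  cexp (Complex (\int[eta]_x (cos (t * g x) - 1))
                (\int[eta]_x (sin (t * g x) - t * g x))).
Proof.
pose c := \int[eta]_x g x.
transitivity (cint poisson_law (fun w => cis (- (t * c)) *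
    \prod_(i < (w k).1) cis (t * g ((w k).2 i)))).
  apply: eq_cint => w; rewrite /centered_block mulrBr addrC cisD; congr (_ * _).
  by rewrite /block_sum mulr_sumr cis_sum.
have mc : cmeas (fun x => cis (t * g x)) by apply: cmeas_cis; exact: measurable_funM.
rewrite cintZ; last first.
  apply: (bounded_cintble (M := 1)); first exact: probability_lty.
    have := cmeas_compound mc => mcc.
    apply: (@cmeas_comp _ _ _ _ _ _ (fun w : seqspace (nat * seqspace S)%type => w k) mcc).
    exact: (measurable_coord k).
  by move=> w; apply: normc_prod_le1 => i; rewrite normc_cis.
rewrite (cint_poisson_block (k := k) mc); last 2 first.
- by move=> x; rewrite normc_cis.
- by move=> x /gE ->; rewrite mulr0 cis0.
have -> : cis (- (t * c)) = cexp (Complex 0 (- (t * c))).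
  by rewrite /cexp /= expR0 mul1r.
rewrite -cexpD; congr cexp; apply/eqP; rewrite eq_complex creD cimD /= add0r.
have i1 : eta.-integrable setT (EFin \o (fun x => sin (t * g x))).
  apply: (@restr_integrable _ 1).
  - by apply: measurableT_comp; [apply: continuous_measurable_fun; exact: continuous_sin|exact: measurable_funM].
  - by move=> x; rewrite ler_norml sin_geN1 sin_le1.
  - by move=> x /gE ->; rewrite mulr0 sin0.
rewrite eqxx /= addrC; apply/eqP; under eq_Rintegral do rewrite subr0.
rewrite RintegralB//; first by rewrite RintegralZl//; exact: block_integrable.
exact: (integrableRZ t block_integrable).
Qed.

(** Write the exponent of [charfun_centered_block] at [t] as [a + ib]. Then [a <= 0],
    [- a <= t ^ 2 v / 2] and [|b| <= 2 t ^ 2 v], so that [1 - e^a cos b <= - a + b ^ 2 / 2 <= t ^ 2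
    v] for small [t], as [second_moment_le] requires; the factor 4 comes from there. *)
Lemma second_moment_centered_block :
  (\int[poisson_law]_w (centered_block w ^+ 2)%:E <= (4 * \int[eta]_x g x ^+ 2)%:E)%E.
Proof.
set v := \int[eta]_x _.
have v0 : 0 <= v by apply: Rintegral_ge0 => x _; exact: sqr_ge0.
have mz : measurable_fun setT centered_block.
  by apply: measurable_funB => //; exact: measurable_block_sum.
apply: second_moment_le => //.
(* From this index on [4 t ^ 2 v <= 1], which turns the bound on [|b|] into [b ^ 2 <= t ^ 2 v]. *)
exists (Num.truncn (2 * v + 2)) => // n /= vn.
set t : R := n.+1%:R^-1.
have t0 : 0 < t by rewrite invr_gt0.
have tv : 4 * (t ^+ 2 * v) <= 1.
  have : 2 * v + 2 < n.+1%:R by apply: lt_le_trans (truncnS_gt _) _; rewrite ler_nat ltnS.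
  rewrite /t; have : 0 < n.+1%:R :> R by [].
  move: n.+1%:R => x x0 vx; rewrite exprVn mulrA mulrAC ler_pdivrMr ?exprn_gt0// mul1r.
  by nra.
have := charfun_centered_block t; set a := \int[eta]_x _; set b := \int[eta]_x _.
move=> /(congr1 (@complex.Re R)); rewrite Re_cexp /= => Hc.
have -> : (\int[poisson_law]_w (1 - cos (centered_block w / n.+1%:R))%:E =
    (1 - expR a * cos b)%:E)%E.
  have mcos : measurable_fun setT (fun w => cos (t * centered_block w)).
    apply: measurableT_comp; first by apply: continuous_measurable_fun; exact: continuous_cos.
    exact: measurable_funM.
  have icos : poisson_law.-integrable setT (EFin \o (fun w => cos (t * centered_block w))).
    apply: (bounded_integrable (M := 1)) => //; first exact: probability_lty.
    by move=> w; rewrite ler_norml cos_geN1 cos_le1.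
  have i1 : poisson_law.-integrable setT (EFin \o (fun=> 1 : R)).
    by apply: (bounded_integrable (M := 1)) => //; [exact: probability_lty|rewrite normr1].
  have -> : 1 - expR a * cos b = \int[poisson_law]_w (1 - cos (t * centered_block w)).
    by rewrite RintegralB// Hc /Rintegral probability_integral_cst.
  rewrite /Rintegral fineK; last by apply: integrable_fin_num => //; exact: integrableRB.
  by apply: eq_integral => w _; rewrite mulrC.
rewrite lee_fin.
have mcos : measurable_fun setT (fun x => cos (t * g x)).
  by apply: measurableT_comp; [apply: continuous_measurable_fun; exact: continuous_cos|exact: measurable_funM].
have msin : measurable_fun setT (fun x => sin (t * g x)).
  by apply: measurableT_comp; [apply: continuous_measurable_fun; exact: continuous_sin|exact: measurable_funM].
have icos : eta.-integrable setT (EFin \o (fun x => 1 - cos (t * g x))).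
  apply: (@restr_integrable _ 2); first exact: measurable_funB.
    move=> x; have := cos_geN1 (t * g x); have := cos_le1 (t * g x).
    by rewrite ler_norml => ? ?; apply/andP; split; lra.
  by move=> x /gE ->; rewrite mulr0 cos0 subrr.
have isin : eta.-integrable setT (EFin \o (fun x => sin (t * g x) - t * g x)).
  apply: integrableRB; last exact: integrableRZ block_integrable.
  apply: (@restr_integrable _ 1) => //.
    by move=> x; rewrite ler_norml sin_geN1 sin_le1.
  by move=> x /gE ->; rewrite mulr0 sin0.
have isqr c : eta.-integrable setT (EFin \o (fun x => c * g x ^+ 2)).
  exact: (integrableRZ c block_sqr_integrable).
have aE : a = - \int[eta]_x (1 - cos (t * g x)).
  rewrite -mulN1r -RintegralZl//; apply: eq_Rintegral => x _.
  by rewrite mulN1r opprB.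
have a0 : a <= 0.
  by rewrite aE oppr_le0; apply: Rintegral_ge0 => x _; exact: one_minus_cos_ge0.
have a1 : - a <= t ^+ 2 * v / 2.
  rewrite aE opprK mulrAC -RintegralZl//; last exact: block_sqr_integrable.
  apply: le_Rintegral => //.
  by move=> x _; apply: le_trans (one_minus_cos_le _) _; rewrite exprMn mulrAC.
have b1 : `|b| <= 2 * (t ^+ 2 * v).
  rewrite mulrA -RintegralZl//; last exact: block_sqr_integrable.
  apply: le_trans (le_normr_Rintegral _ _) _ => //.
  apply: le_Rintegral => //; first exact: integrable_norm isin.
  by move=> x _; apply: le_trans (norm_sinB_le _) _; rewrite exprMn mulrA.
have := expR_ge1Dx a; have := one_minus_cos_le b; have := one_minus_cos_ge0 b.
have : expR a <= 1 by rewrite -expR0 ler_expR.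
have : b ^+ 2 <= (t ^+ 2 * v).
  rewrite -(real_normK (num_real b)); have : 0 <= t ^+ 2 * v by rewrite mulr_ge0// sqr_ge0.
  move: (normr_ge0 b) b1 tv; move: (t ^+ 2 * v) `|b| => u y; nra.
rewrite -[n.+1%:R ^+ 2]invrK -exprVn -/t.
have := expR_gt0 a; nra.
Qed.

End one_block.

End poisson_shells.

Lemma cint_dominated d (T : measurableType d) (R : realType) (mu : {measure set T -> \bar R})
    (f_ : nat -> T -> R[i]) (f : T -> R[i]) (g : T -> R) :
  (forall n, cmeas (f_ n)) -> cmeas f ->
  {ae mu, forall x, (fun n => complex.Re (f_ n x)) @ \oo --> complex.Re (f x) /\
                    (fun n => complex.Im (f_ n x)) @ \oo --> complex.Im (f x)} ->
  mu.-integrable setT (EFin \o g) -> (forall n x, normc (f_ n x) <= g x) ->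
  (fun n => complex.Re (cint mu (f_ n))) @ \oo --> complex.Re (cint mu f) /\
  (fun n => complex.Im (cint mu (f_ n))) @ \oo --> complex.Im (cint mu f).
Proof.
move=> mf_ mf cv ig fg.
have key (r : R[i] -> R) : (forall z, `|r z| <= normc z) ->
    (forall n, measurable_fun setT (fun x => r (f_ n x))) ->
    measurable_fun setT (fun x => r (f x)) ->
    {ae mu, forall x, (fun n => r (f_ n x)) @ \oo --> r (f x)} ->
    (fun n => \int[mu]_x r (f_ n x)) @ \oo --> \int[mu]_x r (f x).
  move=> rn mr_ mr rcv.
  have bd n x : (`|(EFin \o (fun x => r (f_ n x))) x| <= (EFin \o g) x)%E.
    by rewrite /= lee_fin; exact: le_trans (rn _) (fg n x).
  have ecv : {ae mu, forall x, setT x -> (fun n => (EFin \o (fun x => r (f_ n x))) x) @ \oo -->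
      (EFin \o (fun x => r (f x))) x}.
    apply: filterS rcv => x rx _; apply/cvg_EFin; [by near=> n|exact: rx].
  have mr_' n : measurable_fun setT (EFin \o (fun x => r (f_ n x))) by exact/measurable_EFinP.
  have mr' : measurable_fun setT (EFin \o (fun x => r (f x))) by exact/measurable_EFinP.
  have [If _ Icv] := dominated_convergence measurableT mr_' mr' ecv ig
    (aeW _ (fun x n _ => bd n x)).
  apply: fine_cvg; rewrite fineK; last exact: integrable_fin_num.
  exact: Icv.
have m1 n := (mf_ n).1; have m2 n := (mf_ n).2; have [m3 m4] := mf.
split; [apply: (key (@complex.Re R)) => //|apply: (key (@complex.Im R)) => //].
- exact: normc_ge_absRe.
- by apply: filterS cv => x [].
- exact: normc_ge_absIm.
- by apply: filterS cv => x [].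
Unshelve. all: by end_near. Qed.

Lemma measurable_intD d (T : measurableType d) (f g : T -> int) :
  measurable_fun setT f -> measurable_fun setT g ->
  measurable_fun setT (fun t => f t + g t).
Proof.
move=> mf mg _ B _; rewrite setTI.
have -> : (fun t => f t + g t) @^-1` B =
    \bigcup_(a in [set ab : int * int | B (ab.1 + ab.2)]) (f @^-1` [set a.1] `&` g @^-1` [set a.2]).
  apply/seteqP; split => [t Bt|t [[a b] /= Bab [/= fa gb]]]; last by rewrite /preimage /= fa gb.
  by exists (f t, g t).
apply: bigcup_countType_measurable => -[a b] _.
by apply: measurableI; rewrite -[X in measurable X]setTI; [exact: mf|exact: mg].
Qed.

Lemma measurable_int_sum d (T : measurableType d) I (r : seq I) (f : I -> T -> int) :
  (forall i, measurable_fun setT (f i)) ->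
  measurable_fun setT (fun t => \sum_(i <- r) f i t).
Proof.
move=> mf; elim: r => [|i r IH].
  by under eq_fun do rewrite big_nil; exact: measurable_cst.
by under eq_fun do rewrite big_cons; exact: measurable_intD.
Qed.

(** * The shells of the solenoid *)

Section shells.
Context {R : realType} {p : nat} (pp : prime p).
Variable eta : {measure set (borel (solenoid R p)) -> \bar R}.
Hypothesis Heta : is_levy eta.
Let S := borel (solenoid R p).

Let small k : {j | (\int[eta]_(x in Vset j) (arg (scoord x 0) ^+ 2)%:E < (8^-1 ^+ k.+1)%:E)%E}.
Proof. by apply: cid; apply: (levy_small pp Heta); rewrite exprn_gt0. Qed.

(* The neighbourhoods are thinned out so that the variances of the compensated
   jumps decrease like [8^-k], which makes their sum converge almost surely. *)
Definition shell_index k := (\sum_(i < k.+1) (sval (small i)).+1)%N.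

(** Starting from the whole group makes the shells a partition of the solenoid without its identity;
    shell 0 is the only one on which [arg x_0] may be large. *)
Definition nested k : set S := if k is k'.+1 then Vset (shell_index k') else setT.

Definition solshell k : set S := nested k `\` nested k.+1.

Lemma shell_index_gt k : (k < shell_index k)%N.
Proof.
rewrite /shell_index; elim: k => [|k IH]; first by rewrite big_ord1.
by rewrite big_ord_recr /=; apply: leq_ltn_trans IH _; rewrite -[ltnLHS]addn0 ltn_add2l.
Qed.

Lemma nested_le k : nested k.+1 `<=` nested k.
Proof.
case: k => [|k] //=; apply: Vset_le.
by rewrite /shell_index [leqRHS]big_ord_recr /= leq_addr.
Qed.

Lemma measurable_nested k : measurable (nested k).
Proof. by case: k => [|k] //=; exact: measurable_Vset. Qed.

Lemma measurable_solshell k : measurable (solshell k).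
Proof. by apply: measurableD; exact: measurable_nested. Qed.

Lemma solshell_fin k : (eta (solshell k) < +oo)%E.
Proof.
apply: le_lt_trans (levy_Vset pp Heta (shell_index k)).
apply: le_measure; rewrite ?inE; first exact: measurable_solshell.
  by apply: measurableC; exact: measurable_Vset.
by move=> x [].
Qed.

Lemma nested0 k : nested k 0.
Proof.
case: k => [|k] //; have t0 := @tau0 R p.
by split; [rewrite -[arg _]/(tau (0 : solenoid R p)).1 t0 /= normr0|move=> i _; rewrite t0].
Qed.

Lemma solshell0 k : ~ solshell k 0.
Proof. by move=> [_]; apply; exact: nested0. Qed.

Lemma nested_cap (x : solenoid R p) : (forall k, nested k x) -> x = 0.
Proof.
move=> Nx; apply: (Vset_cap pp) => j; apply: Vset_le (Nx j.+1).
by rewrite ltnW// shell_index_gt.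
Qed.

Lemma nested_exit (x : solenoid R p) : x <> 0 -> exists K, forall k, (K <= k)%N -> ~ nested k x.
Proof.
move=> x0; have [K nK] : exists K, ~ nested K x.
  by apply/existsNP => H; apply: x0; exact: nested_cap.
exists K => k; elim: k => [|k IH]; first by rewrite leqn0 => /eqP <-.
by rewrite leq_eqVlt => /orP[/eqP <-//|Kk /nested_le]; exact: IH.
Qed.

Lemma sum_solshell (V : zmodType) (f : S -> V) K x :
  \sum_(k < K) (if x \in solshell k then f x else 0) = if x \in nested K then 0 else f x.
Proof.
elim: K => [|K IH]; first by rewrite big_ord0 ifT// inE.
rewrite big_ord_recr /= IH.
have [NK|NK] := pselect (nested K x); last first.
  rewrite (memNset NK) (memNset (_ : ~ solshell K x)); last by move=> [].
  by rewrite memNset ?addr0// => /nested_le.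
rewrite (mem_set NK) add0r.
have [NSK|NSK] := pselect (nested K.+1 x).
  by rewrite (mem_set NSK) memNset// => -[].
by rewrite (memNset NSK) mem_set.
Qed.

Lemma solshell_tau k x i : (i < k)%N -> solshell k x -> (tau x).2 i = 0.
Proof.
case: k => [//|k]; rewrite ltnS => ik [/= [_ t0] _]; apply: t0.
by apply: leq_ltn_trans ik _; exact: shell_index_gt.
Qed.

Lemma solshell_arg k x : solshell k.+1 x -> `|arg (scoord x 0)| < 1.
Proof.
move=> [/= [x1 _] _]; apply: lt_le_trans x1 _.
by rewrite invf_le1 ?ler1n// ltr0n.
Qed.

Definition shell_arg k (x : S) : R := if x \in solshell k then arg (scoord x 0) else 0.

Lemma measurable_shell (f : S -> R) k : measurable_fun setT f ->
  measurable_fun setT (fun x => if x \in solshell k then f x else 0).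
Proof.
move=> mf; rewrite (_ : (fun x => _) = f \_ (solshell k)); last first.
  by apply/funext => x; rewrite patchE.
by apply/(measurable_restrictT _ (measurable_solshell k)); exact: measurable_funTS.
Qed.

Lemma measurable_shell_arg k : measurable_fun setT (shell_arg k).
Proof. by apply: measurable_shell; exact: measurable_arg_scoord. Qed.

Lemma shell_argN k x : ~ solshell k x -> shell_arg k x = 0.
Proof. by move=> nx; rewrite /shell_arg memNset. Qed.

Lemma norm_shell_arg k x : `|shell_arg k x| <= pi.
Proof. by rewrite /shell_arg; case: ifP => _; [exact: norm_arg_le|rewrite normr0 pi_ge0]. Qed.

Lemma shell_arg_sqr k : \int[eta]_x shell_arg k.+1 x ^+ 2 <= 8^-1 ^+ k.+1.
Proof.
pose q (x : S) := (arg (scoord x 0) ^+ 2)%:E.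
have mq : measurable_fun setT q.
  by apply/measurable_EFinP; apply: measurable_funX; exact: measurable_arg_scoord.
have := proj2_sig (small k) => H; rewrite -lee_fin /Rintegral.
apply: (@le_trans _ _ (\int[eta]_(x in nested k.+1) q x)%E); last first.
  apply: le_trans (ltW H).
  apply: ge0_subset_integral.
  - exact: measurable_Vset.
  - exact: measurable_Vset.
  - exact: measurable_funTS.
  - by move=> x _; rewrite lee_fin sqr_ge0.
  - by apply: Vset_le; rewrite /shell_index big_ord_recr /= addnS ltnW// ltnS leq_addl.
rewrite [in leRHS]integral_mkcond.
have le1 : (\int[eta]_x (shell_arg k.+1 x ^+ 2)%:E <= \int[eta]_x (q \_ (nested k.+1)) x)%E.
  apply: ge0_le_integral => //.
  - by move=> x _; rewrite lee_fin sqr_ge0.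
  - by apply/measurable_EFinP; apply: measurable_funX; exact: measurable_shell_arg.
  - by apply/(measurable_restrictT _ (measurable_nested k.+1)); exact: measurable_funTS.
  - move=> x _; rewrite /shell_arg patchE.
    have [sx|sx] := pselect (solshell k.+1 x).
      by rewrite (mem_set sx) mem_set//; case: sx.
    by rewrite (memNset sx) expr0n; case: ifP => // _; rewrite lee_fin sqr_ge0.
by rewrite fineK//; apply: integrable_fin_num => //; exact: (@block_sqr_integrable _ S R eta
  solshell measurable_solshell solshell_fin 0 _ _ (measurable_shell_arg _) (@shell_argN _)
  (@norm_shell_arg _)).
Qed.

End shells.

Lemma measurable_mem d (T : measurableType d) (A : set T) : measurable A ->
  measurable_fun setT (fun x => x \in A).
Proof.
move=> mA; apply: (measurable_fun_bool true); rewrite setTI.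
by rewrite (_ : _ @^-1` _ = A)//; apply/seteqP; split => x /= xA; [rewrite -in_setE|rewrite mem_set].
Qed.

Section cint_if.
Context d (T : measurableType d) (R : realType) (mu : {measure set T -> \bar R}).
Variables (A : set T) (mA : measurable A).

Lemma cmeas_if (f g : T -> R[i]) : cmeas f -> cmeas g ->
  cmeas (fun x => if x \in A then f x else g x).
Proof.
move=> [f1 f2] [g1 g2]; have mb := measurable_mem mA.
split.
  rewrite (_ : (fun x => _) = fun x => if x \in A then complex.Re (f x) else complex.Re (g x)).
    exact: measurable_fun_ifT.
  by apply/funext => x; case: ifP.
rewrite (_ : (fun x => _) = fun x => if x \in A then complex.Im (f x) else complex.Im (g x)).
  exact: measurable_fun_ifT.
by apply/funext => x; case: ifP.
Qed.

Lemma cintble_if (f : T -> R[i]) : cintble mu f ->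
  cintble mu (fun x => if x \in A then f x else 0).
Proof.
move=> If; have [f1 f2] := If.
have [m1 m2] := cmeas_if (cintble_meas If) (@cmeas_cst _ _ _ 0).
by split; [apply: le_integrable f1|apply: le_integrable f2] => //;
  do ?[exact/measurable_EFinP]; move=> x _ /=; case: ifP => _ //; rewrite lee_fin normr0.
Qed.

Lemma cintble0 : cintble mu (fun=> 0).
Proof. by split; exact: integrable0. Qed.

Lemma cint0 : cint mu (fun=> 0) = 0.
Proof. by rewrite /cint /Rintegral /= integral0. Qed.

Lemma cintble_sum I (r : seq I) (F : I -> T -> R[i]) : (forall i, cintble mu (F i)) ->
  cintble mu (fun x => \sum_(i <- r) F i x).
Proof.
move=> IF; elim: r => [|i r IH].
  by under [X in cintble _ X]eq_fun do rewrite big_nil; exact: cintble0.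
by under [X in cintble _ X]eq_fun do rewrite big_cons; exact: cintbleD.
Qed.

Lemma cint_sum I (r : seq I) (F : I -> T -> R[i]) : (forall i, cintble mu (F i)) ->
  cint mu (fun x => \sum_(i <- r) F i x) = \sum_(i <- r) cint mu (F i).
Proof.
move=> IF; elim: r => [|i r IH].
  by rewrite big_nil -[RHS]cint0; apply: eq_cint => x; rewrite big_nil.
rewrite big_cons -IH -cintD//; last exact: cintble_sum.
by apply: eq_cint => x; rewrite big_cons.
Qed.

End cint_if.

(** * The Poisson integral of [tau] *)

Section levy_process.
Context {R : realType} {p : nat} (pp : prime p).
Variable eta : {measure set (borel (solenoid R p)) -> \bar R}.
Hypothesis Heta : is_levy eta.
Let S := borel (solenoid R p).
Let E k : set S := solshell pp Heta k.
Let mE k : measurable (E k) := measurable_solshell pp Heta k.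
Let finE k : (eta (E k) < +oo)%E := solshell_fin pp Heta k.
Let eE k : ~ E k 0 := @solshell0 R p pp eta Heta k.
Let sarg k := shell_arg pp Heta k.

Definition jump_space : measurableType _ := seqspace (nat * seqspace S)%type.

Definition jump_law : probability jump_space R := poisson_law eta mE 0.

(** Centring by [h] gives the limit exactly the compensator of [realZ_g]. Beyond shell 0, where
    [|arg x_0| < 1], [h] is the identity and this is the mean of the block. *)
Definition shell_center k : R := \int[eta]_x h (sarg k x).

Definition Y0_term k (w : jump_space) : R := block_sum (sarg k) k w - shell_center k.

Definition Y0_partial K w : R := \sum_(k < K) Y0_term k w.

(* A superior limit, to be measurable on the null set of divergence as well. *)
Definition Y0_limit w : R := fine (limn_esup (fun K => (Y0_partial K w)%:E)).

(* The sum is finite since the m-th integer coordinate of [tau] vanishes on the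
   shells of index larger than m. *)
Definition Y_coord m (w : jump_space) : int :=
  \sum_(k < m.+1) \sum_(i < (w k).1) (if (w k).2 i \in E k then (tau ((w k).2 i)).2 m else 0).

Lemma measurable_Y0_partial K : measurable_fun setT (Y0_partial K).
Proof.
apply: measurable_sum => k; apply: measurable_funB => //.
apply: measurable_block_sum; exact: measurable_shell_arg.
Qed.

Lemma measurable_Y0_limit : measurable_fun setT Y0_limit.
Proof.
have mfine : measurable_fun setT (@fine R) by exact: fine_measurable.
apply: (measurableT_comp mfine).
by apply: measurable_fun_limn_esup => K; apply/measurable_EFinP; exact: measurable_Y0_partial.
Qed.

Lemma measurable_Y_coord m : measurable_fun setT (Y_coord m).
Proof.
apply: measurable_int_sum => k.
have mg : measurable_fun setT (fun u : nat * seqspace S =>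
    \sum_(i < u.1) (if u.2 i \in E k then (tau (u.2 i)).2 m else 0)).
  apply: measurable_fun_nat_prod => n /=; apply: measurable_int_sum => i.
  have mb : measurable_fun setT (fun x : S => if x \in E k then (tau x).2 m else 0).
    by apply: measurable_fun_ifT => //; [exact: measurable_mem|exact: measurable_tau].
  exact: (measurableT_comp mb (measurable_coord i)).
exact: (measurableT_comp mg (measurable_coord k)).
Qed.

(** The term of shell 0 is set aside, since [h] need not be the identity there; all others are
    centred blocks, whose second moments decrease like [8 ^ -k] by the choice of the shells. *)
Lemma Y0_cvg : {ae jump_law, forall w, (Y0_partial ^~ w) @ \oo --> Y0_limit w}.
Proof.
have mz k : measurable_fun setT (Y0_term k).
  apply: measurable_funB => //; apply: measurable_block_sum; exact: measurable_shell_arg.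
have m2 k : (\int[jump_law]_w (Y0_term k.+1 w ^+ 2)%:E <= (4 * 8^-1 ^+ k)%:E)%E.
  have tE w : Y0_term k.+1 w = centered_block eta (sarg k.+1) k.+1 w.
    rewrite /Y0_term /centered_block; congr (_ - _); apply: eq_Rintegral => x _.
    rewrite /sarg /shell_arg; case: ifPn; last by rewrite h_id// normr0.
    by rewrite inE => /solshell_arg/h_id.
  under eq_integral do rewrite tE.
  apply: le_trans (second_moment_centered_block mE finE eE _ _ _) _.
  - exact: measurable_shell_arg.
  - exact: shell_argN.
  - exact: norm_shell_arg.
  rewrite lee_fin ler_pM2l//; apply: le_trans (shell_arg_sqr pp Heta k) _.
  by rewrite exprS ler_piMl ?exprn_ge0//; lra.
have := series_cvg_ae (fun k => mz k.+1) m2; apply: filterS => w /cvg_ex[l sl].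
have cv : (Y0_partial ^~ w) @ \oo --> Y0_term 0 w + l.
  rewrite -(cvg_shiftS (Y0_partial ^~ w)).
  rewrite (_ : (fun n => _) = (fun n => Y0_term 0 w + series (fun k => Y0_term k.+1 w) n)).
    by apply: cvgD => //; exact: cvg_cst.
  by apply/funext => n; rewrite /= /Y0_partial big_ord_recl /series /= big_mkord.
have ecv : (fun K => (Y0_partial K w)%:E) @ \oo --> (Y0_term 0 w + l)%:E.
  by apply/cvg_EFin; [near=> n|exact: cv].
rewrite /Y0_limit is_cvg_limn_esupE; last by apply/cvg_ex; eexists; exact: ecv.
by rewrite (cvg_lim _ ecv).
Unshelve. all: by end_near. Qed.

Section characteristic_function.
Variables (n : nat) (yz : R * ('I_n -> circle R)).

Let jump k (x : S) : realZ R n := if x \in E k then taun n x else 0.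

Let Yn w : realZ R n := (Y0_limit w, \row_(k < n) Y_coord k w).
Let YnK K w : realZ R n := (Y0_partial K w, \row_(k < n) Y_coord k w).

(** Once [K >= n], shells of index at least [K] do not touch the first [n] integer coordinates, so
    truncating all coordinates at [K] leaves these unchanged and yields one sum in R x Z^n. *)
Lemma partial_sum_jumps K w : (n <= K)%N ->
  YnK K w = \sum_(k < K) (\sum_(i < (w k).1) jump k ((w k).2 i) +
    (- shell_center k, 0 : 'rV[int]_n)).
Proof.
have pf I (r : seq I) (F : I -> realZ R n) : (\sum_(i <- r) F i).1 = \sum_(i <- r) (F i).1.
  by elim: r => [|i r IH]; rewrite ?big_nil// !big_cons /= -IH.
have ps I (r : seq I) (F : I -> realZ R n) : (\sum_(i <- r) F i).2 = \sum_(i <- r) (F i).2.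
  by elim: r => [|i r IH]; rewrite ?big_nil// !big_cons /= -IH.
move=> nK; rewrite [RHS]surjective_pairing pf ps; congr pair.
  apply: eq_bigr => k _ /=; rewrite pf /Y0_term /block_sum; congr (_ - _).
  by apply: eq_bigr => i _; rewrite /jump /sarg /shell_arg; case: ifP.
apply/rowP => m; rewrite mxE summxE /Y_coord.
have mK : (m.+1 <= K)%N by exact: leq_trans (ltn_ord m) nK.
rewrite -(subnKC mK) big_split_ord /= [X in _ = _ + X]big1 ?addr0; last first.
  move=> k _; rewrite addr0 ps summxE big1// => i _.
  rewrite /jump; case: ifPn; last by rewrite mxE.
  rewrite inE => /(solshell_tau (i := m)); rewrite mxE; apply.
  by rewrite ltnS leq_addr.
apply: eq_bigr => k _; rewrite addr0 ps summxE; apply: eq_bigr => i _.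
by rewrite /jump; case: ifP => _; rewrite mxE.
Qed.

Let Fk k (x : S) : R[i] := realZ_char yz (jump k x).

(** The factor coming from [shell_center k] subtracts [i y h] under the integral, so that the
    exponent of block [k] becomes the Levy integrand restricted to shell [k]; by [sum_solshell]
    these restrictions add up to the one outside [nested K]. *)
Lemma charfun_partial K : (n <= K)%N ->
  cint jump_law (fun w => realZ_char yz (YnK K w)) =
  cexp (cint eta (fun x => if x \in nested pp Heta K then 0 else realZ_levy_fun yz (taun n x))).
Proof.
move=> nK.
have FE k x : ~ E k x -> Fk k x = 1.
  by move=> nx; rewrite /Fk /jump (memNset nx) realZ_char0.
have Fcm k : cmeas (Fk k).
  have c1 : cmeas (fun x : S => realZ_char yz (taun n x)) by exact: (cmeas_taun (cmeas_realZ_char yz)).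
  have := cmeas_if (mE k) c1 (@cmeas_cst _ _ _ 1); congr cmeas; apply/funext => x.
  by rewrite /Fk /jump; case: ifP; rewrite ?realZ_char0.
transitivity (cint jump_law (fun w => (\prod_(k < K) cis (- (yz.1 * shell_center k))) *
   \prod_(k < K) \prod_(i < (w k).1) Fk k ((w k).2 i))).
  apply: eq_cint => w; rewrite partial_sum_jumps// realZ_char_sum -big_split /=.
  apply: eq_bigr => k _; rewrite realZ_charD realZ_char_sum mulrC; congr (_ * _).
  by rewrite /realZ_char /= mulrN big1 ?mulr1// => m _; rewrite mxE expr0z.
rewrite cintZ; last first.
  apply: (bounded_cintble (M := 1)); first exact: probability_lty.
    apply: cmeas_prod => k.
    apply: (@cmeas_comp _ _ _ _ _ _ (fun w : jump_space => w k) (cmeas_compound (Fcm k))).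
    exact: (measurable_coord k).
  by move=> w; apply: normc_prod_le1 => k; apply: normc_prod_le1 => i; rewrite normc_realZ_char.
rewrite (cint_poisson_blocks mE finE eE)//; last by move=> k x; rewrite normc_realZ_char.
rewrite -big_split /=.
pose L k (x : S) := if x \in E k then realZ_levy_fun yz (taun n x) else 0.
have Lint k : cintble eta (L k) by apply: cintble_if => //; exact: (cintble_levy_fun pp Heta).
have termE k : cis (- (yz.1 * shell_center k)) * cexp (cint eta (fun x => Fk k x - 1)) =
    cexp (cint eta (L k)).
  have ih : eta.-integrable setT (EFin \o (fun x => h (sarg k x))).
    apply: (@block_integrable _ S R eta E mE finE 0 (fun x => h (sarg k x)) k).
    - exact: (measurableT_comp measurable_h (measurable_shell_arg pp Heta k)).
    - by move=> x nx; rewrite /sarg shell_argN// h_id ?normr0.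
    - by move=> x; exact: norm_h_le.
  have -> : cint eta (fun x => Fk k x - 1) =
      cint eta (fun x => L k x + Complex 0 (yz.1 * h (sarg k x))).
    apply: eq_cint => x; rewrite /L /Fk /jump /sarg /shell_arg.
    case: ifPn => _; last by rewrite realZ_char0 subrr h_id ?normr0// mulr0 add0r.
    by rewrite /realZ_levy_fun subrK.
  rewrite cintD//; last first.
    by split; [exact: integrable0|exact: (integrableRZ yz.1 ih)].
  have -> : cint eta (fun x => Complex 0 (yz.1 * h (sarg k x))) = Complex 0 (yz.1 * shell_center k).
    by rewrite /cint /= RintegralZl//; congr Complex; rewrite /Rintegral integral0.
  by rewrite cexpD [X in _ * X]mulrC mulrA /cexp /= expR0 mul1r -cisD addNr cis0 mul1r.
under eq_bigr do rewrite termE.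
rewrite -(big_morph (@cexp R) (@cexpD R) (@cexp0 R)) -cint_sum//; congr cexp.
by apply: eq_cint => x; exact: (sum_solshell pp Heta (fun x => realZ_levy_fun yz (taun n x))).
Qed.

(** The bound is 1 under the jump law, and the integrable Levy integrand itself under [eta].
    Pointwise convergence of the latter also holds at the identity, which lies in every [nested K],
    because the integrand vanishes there. *)
Lemma charfun_limit : cint jump_law (fun w => realZ_char yz (Yn w)) =
  cexp (cint eta (fun x => realZ_levy_fun yz (taun n x))).
Proof.
have mYn (f : jump_space -> R) : measurable_fun setT f ->
    cmeas (fun w => realZ_char yz ((f w, \row_(k < n) Y_coord k w) : realZ R n)).
  move=> mf; apply: (@cmeas_comp _ _ _ _ _ _
    (fun w => (f w, \row_(k < n) Y_coord k w) : borel (realZ R n)) (cmeas_realZ_char yz)).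
  apply: measurable_realZ => //= l; apply: row_int_measurable.
  exact: measurable_Y_coord.
have [L1 L2] : (fun K => complex.Re (cint jump_law (fun w => realZ_char yz (YnK K w)))) @ \oo -->
    complex.Re (cint jump_law (fun w => realZ_char yz (Yn w))) /\
  (fun K => complex.Im (cint jump_law (fun w => realZ_char yz (YnK K w)))) @ \oo -->
    complex.Im (cint jump_law (fun w => realZ_char yz (Yn w))).
  apply: (cint_dominated (g := fun=> 1)).
  - by move=> K; apply: mYn; exact: measurable_Y0_partial.
  - by apply: mYn; exact: measurable_Y0_limit.
  - apply: filterS Y0_cvg => w cv; rewrite /realZ_char /=.
    have yc : (fun K => yz.1 * Y0_partial K w) @ \oo --> yz.1 * Y0_limit w.
      by apply: cvgM => //; exact: cvg_cst.
    have cc : (fun K => cos (yz.1 * Y0_partial K w)) @ \oo --> cos (yz.1 * Y0_limit w).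
      exact: (continuous_cvg _ (@continuous_cos R _) yc).
    have sc : (fun K => sin (yz.1 * Y0_partial K w)) @ \oo --> sin (yz.1 * Y0_limit w).
      exact: (continuous_cvg _ (@continuous_sin R _) yc).
    split; under eq_fun do rewrite ?creM ?cimM; rewrite ?creM ?cimM /=.
      by apply: cvgB; apply: cvgM => //; exact: cvg_cst.
    by apply: cvgD; apply: cvgM => //; exact: cvg_cst.
  - by apply: (bounded_integrable (M := 1)) => //; [exact: probability_lty|rewrite normr1].
  - by move=> K w; rewrite normc_realZ_char.
pose L (x : S) := realZ_levy_fun yz (taun n x).
have iL : cintble eta L by exact: (cintble_levy_fun pp Heta).
have [M1 M2] : (fun K => complex.Re (cint eta (fun x => if x \in nested pp Heta K then 0 else L x))) @ \oo -->
    complex.Re (cint eta L) /\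
  (fun K => complex.Im (cint eta (fun x => if x \in nested pp Heta K then 0 else L x))) @ \oo -->
    complex.Im (cint eta L).
  apply: (cint_dominated (g := fun x => `|complex.Re (L x)| + `|complex.Im (L x)|)).
  - by move=> K; apply: cmeas_if; [exact: measurable_nested|exact: cmeas_cst|exact: cintble_meas iL].
  - exact: cintble_meas iL.
  - apply: aeW => x.
    have [->|/eqP x0] := eqVneq x 0.
      have L0 : L 0 = 0 by rewrite /L taun0 realZ_levy_fun0.
      by rewrite L0; split; under eq_fun do rewrite if_same; exact: cvg_cst.
    have [K nK] := nested_exit pp Heta x0.
    by split; apply: cvg_near_cst; exists K => // k /= Kk; rewrite memNset//; exact: nK.
  - by have [i1 i2] := iL; apply: integrableRD; [exact: integrable_norm i1|exact: integrable_norm i2].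
  - move=> K x; case: ifP => _; last exact: normc_le.
    by rewrite normc0 addr_ge0.
have cf : \forall K \near \oo, cint jump_law (fun w => realZ_char yz (YnK K w)) =
    cexp (cint eta (fun x => if x \in nested pp Heta K then 0 else L x)).
  by exists n => // K /= nK; exact: charfun_partial.
have ec : (fun K => expR (complex.Re (cint eta (fun x => if x \in nested pp Heta K then 0 else L x)))) @ \oo -->
    expR (complex.Re (cint eta L)).
  exact: (continuous_cvg _ (@continuous_expR R _) M1).
have cc : (fun K => cos (complex.Im (cint eta (fun x => if x \in nested pp Heta K then 0 else L x)))) @ \oo -->
    cos (complex.Im (cint eta L)).
  exact: (continuous_cvg _ (@continuous_cos R _) M2).
have sc : (fun K => sin (complex.Im (cint eta (fun x => if x \in nested pp Heta K then 0 else L x)))) @ \oo -->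
    sin (complex.Im (cint eta L)).
  exact: (continuous_cvg _ (@continuous_sin R _) M2).
apply/eqP; rewrite eq_complex Re_cexp Im_cexp; apply/andP; split; apply/eqP.
  apply: (@cvg_unique _ (@Rhausdorff R) _ _ _ _ L1).
  apply: cvg_trans; last exact: (cvgM ec cc).
  by apply: near_eq_cvg; apply: filterS cf => K ->; rewrite Re_cexp.
apply: (@cvg_unique _ (@Rhausdorff R) _ _ _ _ L2).
apply: cvg_trans; last exact: (cvgM ec sc).
by apply: near_eq_cvg; apply: filterS cf => K ->; rewrite Im_cexp.
Qed.

End characteristic_function.

End levy_process.

Section random_variable_of_measurable.
Context {R : realType} d (T : measurableType d) (P : probability T R) d' (T' : measurableType d').

Definition rv_of (f : T -> T') (mf : measurable_fun setT f) : {RV P >-> T'} :=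
  mfun_Sub (mem_set mf).

Lemma rv_ofE f mf : @rv_of f mf = f :> (T -> T').
Proof. by rewrite /rv_of mfun_valP. Qed.

End random_variable_of_measurable.

Section normal_law_probability.
Context {R : realType} (b : R).

Let gaussian : probability (measurableTypeR R) R := normal_prob 0 (Num.sqrt b).

Let measurable_idR : measurable_fun setT (id : measurableTypeR R -> R).
Proof. by move=> _ B mB; rewrite setTI preimage_id. Qed.

(* The library's normal law lives on another copy of the Borel space R. *)
Definition normal_law_prob : probability R R :=
  if b == 0 then (dirac (0 : R) : probability R R)
  else distribution gaussian (rv_of gaussian measurable_idR).

Lemma normal_law_probE A : normal_law_prob A = normal_law b A.
Proof.
by rewrite /normal_law_prob /normal_law; case: ifP.
Qed.

End normal_law_probability.

(** * Existence of representing variables *)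

Section existence.
Context {R : realType} {p : nat} (pp : prime p).
Variable eta : {measure set (borel (solenoid R p)) -> \bar R}.
Hypothesis Heta : is_levy eta.
Variable etan : forall n, {measure set (borel (realZ R n)) -> \bar R}.
Hypothesis etanE : forall n, is_tau_image eta (etan n).

Let J := @jump_space R p.
Let Q : probability J R := jump_law pp Heta.

(** The space is the product of the normal law with the jump law; [pi_n] is defined as the law of
    the first coordinates, and [charfun_limit] shows that it has the required transform. *)
Lemma representing_exists (b : R) :
  exists (d : measure_display) (T : measurableType d) (P : probability T R)
        (X0 Y0 : {RV P >-> R}) (Y : nat -> {RV P >-> int}),
      representing_variables b etan X0 Y0 Y.
Proof.
pose P : probability (R * J)%type R := prodprob (normal_law_prob b) Q.
have mX : measurable_fun setT (fst : R * J -> R) by exact: measurable_fst.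
have mY0 : measurable_fun setT (fun z : R * J => Y0_limit pp Heta z.2).
  exact: (measurableT_comp (measurable_Y0_limit pp Heta) measurable_snd).
have mY k : measurable_fun setT (fun z : R * J => Y_coord pp Heta k z.2).
  exact: (measurableT_comp (measurable_Y_coord pp Heta k) measurable_snd).
pose X0 := rv_of P mX; pose Y0 := rv_of P mY0; pose Y k := rv_of P (mY k).
have PX (A : set R) (B : set J) : measurable A -> measurable B ->
    (P (fst @^-1` A `&` snd @^-1` B) = normal_law_prob b A * Q B)%E.
  move=> mA mB; transitivity (P (A `*` B)); first by [].
  exact: product_measure1E.
have PX1 (A : set R) : measurable A -> (P (fst @^-1` A) = normal_law_prob b A)%E.
  move=> mA; have := PX A setT mA measurableT; rewrite preimage_setT setIT.
  by move=> ->; have -> : Q setT = 1%E; [rewrite probability_setT|rewrite mule1].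
have PX2 (B : set J) : measurable B -> (P (snd @^-1` B) = Q B)%E.
  move=> mB; have := PX setT B measurableT mB; rewrite preimage_setT setTI.
  by move=> ->; have -> : normal_law_prob b setT = 1%E; [rewrite probability_setT|rewrite mul1e].
exists _, _, P, X0, Y0, Y; split.
- move=> A B [A' mA' <-] HB.
  have [B' mB' <-] : exists2 B', measurable B' & snd @^-1` B' = B.
    (* Instantiating the generated sigma-algebra at the one induced by the second projection: every
       event of the sequence [Y0], [Y] depends on the jumps only. *)
    have [|B' mB' <-] := HB (preimage_set_system setT (snd : R * J -> J) measurable); last first.
      by exists B' => //; rewrite setTI.
    split; first by apply: sigma_algebra_preimage; exact: sigma_algebra_measurable.
    move=> C [[|k] _ [D mD <-]].
      exists (Y0_limit pp Heta @^-1` D); last by rewrite /Y0 rv_ofE.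
      by rewrite -[X in measurable X]setTI; exact: measurable_Y0_limit.
    exists (Y_coord pp Heta k @^-1` D); last by rewrite /Y rv_ofE.
    by rewrite -[X in measurable X]setTI; exact: measurable_Y_coord.
  rewrite setTI /X0 rv_ofE PX//; congr (_ * _)%E; [by rewrite PX1|by rewrite PX2].
- split; first by rewrite /X0 rv_ofE.
  by move=> A mA; rewrite /X0 rv_ofE PX1// normal_law_probE.
- move=> n.
  pose F (w : J) : borel (realZ R n) := (Y0_limit pp Heta w, \row_(k < n) Y_coord pp Heta k w).
  have mF : measurable_fun setT F.
    apply: measurable_realZ => [|l /=]; first exact: measurable_Y0_limit.
    by apply: row_int_measurable; exact: measurable_Y_coord.
  pose pin : probability (borel (realZ R n)) R := distribution Q (rv_of Q mF).
  have pinE A : measurable A -> pin A = Q (F @^-1` A).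
    by move=> mA; rewrite /pin /distribution /pushforward rv_ofE.
  have FE : (fun w : R * J => (Y0 w, \row_(k < n) Y k w) : borel (realZ R n)) = F \o snd.
    by apply/funext => w; rewrite /F; congr pair.
  exists pin; split; last first.
    rewrite FE; split; first exact: (measurableT_comp mF measurable_snd).
    move=> A mA; rewrite comp_preimage PX2 ?pinE//.
    by rewrite -[X in measurable X]setTI; exact: (mF measurableT).
  split; first exact: (tau_image_levy pp Heta (@etanE n)).
  move=> yz; transitivity (cint pin (realZ_char yz)); first by [].
  rewrite (cint_transfer mF pinE (cmeas_realZ_char yz)) charfun_limit; congr cexp.
  transitivity (cint (etan n) (realZ_levy_fun yz)); last by [].
  rewrite (cint_tau_image (@etanE n) (cmeas_realZ_levy_fun yz))//.
  exact: realZ_levy_fun0.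
Qed.

End existence.

(** * Characteristic function of the normal law *)

Section derivative_integral.
Context {R : realType}.
Notation mu := (@lebesgue_measure R).

Lemma Rintegral_derivative_eq0 (u u' : R -> R) :
  (forall x, is_derive x (1 : R) u (u' x)) -> continuous u' ->
  mu.-integrable setT (EFin \o u') ->
  (fun n : nat => u n.+1%:R - u (- n.+1%:R)) @ \oo --> (0 : R) ->
  \int[mu]_x u' x = 0.
Proof.
move=> du cu' iu' u0.
pose D n : set R := `[- n.+1%:R, n.+1%:R]%classic.
have FTC n : (\int[mu]_(x in D n) (u' x)%:E = (u n.+1%:R - u (- n.+1%:R))%:E)%E.
  have cu : continuous u.
    by move=> x; apply/differentiable_continuous/derivable1_diffP; have [] := du x.
  rewrite (@continuous_FTC2 _ u' u)//.
  - by rewrite -subr_gt0 opprK addr_gt0.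
  - by apply: continuous_subspaceT => x; exact: cu'.
  - split; first by move=> x _; have [] := du x.
      by apply: cvg_at_right_filter; exact: cu.
    by apply: cvg_at_left_filter; exact: cu.
  - by move=> x _; rewrite derive1E; have [_ ->] := du x.
have mD n : measurable (D n) by exact: measurable_itv.
have mu' : measurable_fun setT (EFin \o u') by exact: measurable_int iu'.
pose f n := (EFin \o u') \_ (D n).
have mf n : measurable_fun setT (f n).
  by apply/(measurable_restrictT _ (mD n)); exact: measurable_funTS.
have fcv : {ae mu, forall x, setT x -> f ^~ x @ \oo --> (EFin \o u') x}.
  apply: aeW => x _; apply: cvg_near_cst; exists (Num.truncn `|x|) => // n /= xn.
  rewrite /f patchE ifT// inE /D /= in_itv /= -ler_norml ltW//.
  by apply: lt_le_trans (truncnS_gt _) _; rewrite ler_nat ltnS.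
have fb : {ae mu, forall x n, setT x -> (`|f n x| <= `|(EFin \o u') x|)%E}.
  by apply: aeW => x n _; rewrite /f patchE; case: ifP => // _; rewrite abse0.
have [_ _] := @dominated_convergence _ (measurableTypeR R) R mu setT measurableT f (EFin \o u') _
  mf mu' fcv (integrable_abse iu') fb.
rewrite (_ : (fun n => _) = EFin \o (fun n : nat => u n.+1%:R - u (- n.+1%:R))); last first.
  by apply/funext => n; rewrite /f /= -integral_mkcond FTC.
move=> H.
have H0 : (EFin \o (fun n : nat => u n.+1%:R - u (- n.+1%:R))) @ \oo --> (0%:E : \bar R).
  by apply/cvg_EFin; [near=> n|exact: u0].
by rewrite /Rintegral (cvg_unique _ H H0).
Unshelve. all: by end_near. Qed.

End derivative_integral.

Section gauss_charfun.
Context {R : realType} (s : R).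
Hypothesis s0 : 0 < s.
Notation mu := (@lebesgue_measure R).

Let e (x : R) := expR (- x ^+ 2 / (s ^+ 2 *+ 2)).

Let s2 : 0 < s ^+ 2 *+ 2.
Proof. by rewrite pmulrn_lgt0// exprn_gt0. Qed.

Lemma gauss_integrable : forall r : R, 0 < r -> mu.-integrable setT
  (EFin \o (fun x => expR (- x ^+ 2 / (r ^+ 2 *+ 2)))).
Proof.
move=> r r0.
have := @integrable_normal_pdf R 0 r; rewrite normal_pdfE ?gt_eqF// => I.
have np := normal_peak_gt0 (lt0r_neq0 r0).
have := integrableRZ (normal_peak r)^-1 I; congr (_.-integrable _ _).
apply/funext => x /=; rewrite mulrA mulVf ?gt_eqF// mul1r /normal_fun subr0//.
Qed.

Let ce : continuous e.
Proof.
move=> x; apply: continuous_comp; last exact: continuous_expR.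
apply: cvgM; last exact: cvg_cst.
by apply: cvgN; exact: sqr_continuous.
Qed.

Let e_derive x : is_derive x (1 : R) e (- (x / s ^+ 2) * e x).
Proof.
rewrite /e.
have -> : - (x / s ^+ 2) * expR (- x ^+ 2 / (s ^+ 2 *+ 2)) =
  expR (- x ^+ 2 / (s ^+ 2 *+ 2)) * (- (x / s ^+ 2)) by rewrite mulrC.
apply: (@is_derive1_comp _ expR (fun x => - x ^+ 2 / (s ^+ 2 *+ 2))).
apply: is_derive_eq; rewrite scaler0 add0r.
by rewrite /GRing.scale /=; field; rewrite gt_eqF.
Qed.

Let ixe : mu.-integrable setT (EFin \o (fun x => `|x| * e x)).
Proof.
(* The standard deviation [s sqrt 2] halves the Gaussian exponent; the other half absorbs the factor
   [|x|]. *)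
have sr0 : 0 < s * Num.sqrt 2 by rewrite mulr_gt0// sqrtr_gt0.
have me : measurable_fun setT (fun x : R => `|x| * e x).
  apply: measurable_funM; first by apply: continuous_measurable_fun; exact: norm_continuous.
  by apply: continuous_measurable_fun; exact: ce.
apply: le_integrable (integrableRZ s (gauss_integrable sr0)) => //; first exact/measurable_EFinP.
move=> x _ /=; rewrite lee_fin [leRHS]ger0_norm ?mulr_ge0 ?expR_ge0 ?(ltW s0)//.
rewrite ger0_norm ?mulr_ge0 ?expR_ge0//.
have -> : e x = expR (- (x ^+ 2 / (s ^+ 2 *+ 4))) * expR (- (x ^+ 2 / (s ^+ 2 *+ 4))).
  by rewrite -expRD /e; congr expR; field; rewrite gt_eqF.
have -> : - x ^+ 2 / ((s * Num.sqrt 2) ^+ 2 *+ 2) = - (x ^+ 2 / (s ^+ 2 *+ 4)).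
  by rewrite exprMn sqr_sqrtr//; field; rewrite gt_eqF.
rewrite mulrA ler_pM2r ?expR_gt0// expRN ler_pdivrMr ?expR_gt0//.
(* [|x| <= s (1 + (x / (2 s)) ^ 2)], the difference being [s (1 - |x| / (2 s)) ^ 2]. *)
apply: le_trans (_ : s * (1 + x ^+ 2 / (s ^+ 2 *+ 4)) <= _); last first.
  by rewrite ler_pM2l// expR_ge1Dx.
have -> : s * (1 + x ^+ 2 / (s ^+ 2 *+ 4)) = `|x| + s * (1 - `|x| / (2 * s)) ^+ 2.
  by rewrite -(real_normK (num_real x)); field; rewrite gt_eqF.
by rewrite lerDl mulr_ge0 ?sqr_ge0// ltW.
Qed.

Let bound_integrable (f g : R -> R) : measurable_fun setT f -> (forall x, `|f x| <= g x) ->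
  mu.-integrable setT (EFin \o g) -> mu.-integrable setT (EFin \o f).
Proof.
move=> mf fg ig; apply: le_integrable ig => //; first exact/measurable_EFinP.
by move=> x _; rewrite /= lee_fin; apply: le_trans (fg x) (ler_norm _).
Qed.

Let e_le (x : R) : 0 < x -> e x <= (s ^+ 2 *+ 2) / x ^+ 2.
Proof.
move=> x0; rewrite /e mulNr expRN -[leRHS]invf_div lef_pV2 ?posrE ?expR_gt0 ?divr_gt0// ?exprn_gt0//.
by apply: le_trans (expR_ge1Dx _); rewrite lerDr.
Qed.

Let e_cvg0 : (fun n : nat => (s ^+ 2 *+ 2) * n.+1%:R^-1) @ \oo --> (0 : R).
Proof.
rewrite -[X in _ --> X](mulr0 (s ^+ 2 *+ 2)); apply: cvgM; first exact: cvg_cst.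
exact: cvg_harmonic.
Qed.

Let e_le1 n : e n.+1%:R <= (s ^+ 2 *+ 2) * n.+1%:R^-1.
Proof.
apply: le_trans (e_le _) _; first by [].
rewrite ler_pM2l// lef_pV2 ?posrE ?exprn_gt0// expr2 ler_peMl// ler1n//.
Qed.

Variable th : R.

(** The phase treats both parts of the transform together: [th = 0] gives the cosine and
    [th = - pi / 2] the sine. *)
Let F (t : R) := \int[mu]_x (cos (t * x + th) * e x).

Let cos_derive x t : is_derive t (1 : R) (fun t => cos (t * x + th)) (- (x * sin (t * x + th))).
Proof.
have -> : - (x * sin (t * x + th)) = - sin (t * x + th) * x by ring.
apply: (@is_derive1_comp _ cos (fun t => t * x + th)).
by apply: is_derive_eq; rewrite /GRing.scale /=; ring.
Qed.

Let sin_derive t x : is_derive x (1 : R) (fun x => sin (t * x + th)) (t * cos (t * x + th)).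
Proof.
have -> : t * cos (t * x + th) = cos (t * x + th) * t by ring.
apply: (@is_derive1_comp _ sin (fun x => t * x + th)).
by apply: is_derive_eq; rewrite /GRing.scale /=; ring.
Qed.

Let caff (t : R) : continuous (fun x : R => t * x + th).
Proof.
move=> x; apply: cvgD; last exact: cvg_cst.
by apply: cvgM; [exact: cvg_cst|exact: cvg_id].
Qed.

Let ccos (t : R) : continuous (fun x : R => cos (t * x + th)).
Proof. by move=> x; apply: continuous_comp; [exact: caff|exact: continuous_cos]. Qed.

Let csin (t : R) : continuous (fun x : R => sin (t * x + th)).
Proof. by move=> x; apply: continuous_comp; [exact: caff|exact: continuous_sin]. Qed.

Let ie : mu.-integrable setT (EFin \o e).
Proof. exact: gauss_integrable. Qed.

Lemma gauss_cos_integrable t : mu.-integrable setT (EFin \o (fun x => cos (t * x + th) * e x)).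
Proof.
apply: bound_integrable ie.
  apply: continuous_measurable_fun => x; apply: cvgM; [exact: ccos|exact: ce].
move=> x; rewrite normrM [`|e x|]ger0_norm ?expR_ge0// ler_piMl ?expR_ge0//.
by rewrite ler_norml cos_geN1 cos_le1.
Qed.

Let ixsine t : mu.-integrable setT (EFin \o (fun x => x * (sin (t * x + th) * e x))).
Proof.
apply: bound_integrable ixe.
  apply: continuous_measurable_fun => x; apply: cvgM; first exact: cvg_id.
  by apply: cvgM; [exact: csin|exact: ce].
move=> x; rewrite normrM ler_wpM2l// normrM [`|e x|]ger0_norm ?expR_ge0// ler_piMl ?expR_ge0//.
by rewrite ler_norml sin_geN1 sin_le1.
Qed.

(* Stein's identity, the integral of a derivative vanishing at infinity. *)
Let by_parts t : \int[mu]_x (x * (sin (t * x + th) * e x)) = s ^+ 2 * t * F t.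
Proof.
pose u x := sin (t * x + th) * e x.
pose u' x := t * (cos (t * x + th) * e x) - (s ^+ 2)^-1 * (x * (sin (t * x + th) * e x)).
have u'0 : \int[mu]_x u' x = 0.
  apply: (@Rintegral_derivative_eq0 _ u u').
  - move=> x; rewrite /u /u'.
    have -> : t * (cos (t * x + th) * e x) - (s ^+ 2)^-1 * (x * (sin (t * x + th) * e x)) =
      sin (t * x + th) *: (- (x / s ^+ 2) * e x) + e x *: (t * cos (t * x + th)).
      by rewrite /GRing.scale /=; ring.
    by apply: is_deriveM; [exact: sin_derive|exact: e_derive].
  - move=> x; apply: cvgB; (apply: cvgM; first exact: cvg_cst).
      by apply: cvgM; [exact: ccos|exact: ce].
    apply: cvgM; first exact: cvg_id.
    by apply: cvgM; [exact: csin|exact: ce].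
  - by apply: integrableRB; apply: integrableRZ; [exact: gauss_cos_integrable|exact: ixsine].
  - apply: norm_cvg0.
    have cv2 : (fun n : nat => (s ^+ 2 *+ 2) * n.+1%:R^-1 + (s ^+ 2 *+ 2) * n.+1%:R^-1) @ \oo --> (0 : R).
      by rewrite -[X in _ --> X]addr0; apply: cvgD; exact: e_cvg0.
    apply: (@squeeze_cvgr _ _ _ _ (cst 0) _ _ _ _ _ cv2); last exact: cvg_cst.
    apply: nearW => n; rewrite normr_ge0 /=; apply: le_trans (ler_normB _ _) _.
    have ub x : `|u x| <= e x.
      rewrite /u normrM [`|e x|]ger0_norm ?expR_ge0// ler_piMl ?expR_ge0//.
      by rewrite ler_norml sin_geN1 sin_le1.
    apply: lerD; first exact: le_trans (ub _) (e_le1 n).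
    apply: le_trans (ub _) _; apply: le_trans (e_le1 n).
    by rewrite /e sqrrN.
move: u'0; rewrite /u' RintegralB//; last 2 first.
- exact: (integrableRZ t (gauss_cos_integrable t)).
- exact: (integrableRZ _ (ixsine t)).
rewrite (RintegralZl t measurableT (gauss_cos_integrable t)).
rewrite (RintegralZl (s ^+ 2)^-1 measurableT (ixsine t)) => /eqP; rewrite subr_eq0 => /eqP H.
by rewrite -mulrA -/(F t) H mulrA mulfV ?mul1r// gt_eqF// exprn_gt0.
Qed.

(** Differentiation under the integral, dominated by [|x| e x], produces the integral of
    [x sin (t x + th) e x], which Stein's identity expresses through [F t] again. *)
Let F_derive t : is_derive t (1 : R) F (- (s ^+ 2 * t) * F t).
Proof.
pose f (t : R) (x : measurableTypeR R) := cos (t * x + th) * e x.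
have fd x r : is_derive r (1 : R) (f ^~ x) (- (x * (sin (r * x + th) * e x))).
  have -> : - (x * (sin (r * x + th) * e x)) =
      cos (r * x + th) *: 0 + e x *: (- (x * sin (r * x + th))).
    by rewrite /GRing.scale /=; ring.
  by apply: is_deriveM; exact: cos_derive.
have H1 : forall x, `]t - 1, t + 1[%classic x -> mu.-integrable setT (EFin \o f x) by move=> x _; exact: gauss_cos_integrable.
have Ia : `]t - 1, t + 1[%classic t by rewrite /= in_itv /=; apply/andP; split; lra.
have H2 : forall r x, `]t - 1, t + 1[%classic r -> setT x -> derivable (f ^~ x) r 1.
  by move=> r x _ _; have [] := fd x r.
have G0 (x : measurableTypeR R) : 0 <= `|x| * e x by rewrite mulr_ge0// expR_ge0.
have H3 : forall r x, `]t - 1, t + 1[%classic r -> setT x -> `|partial1of2 f r x| <= `|x| * e x.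
  move=> r x _ _; rewrite partial1of2E; have [_ ->] := fd x r.
  rewrite normrN normrM ler_wpM2l// normrM [`|e x|]ger0_norm ?expR_ge0// ler_piMl ?expR_ge0//.
  by rewrite ler_norml sin_geN1 sin_le1.
apply: DeriveDef.
  exact: (derivable_under_integral measurableT Ia H1 H2 G0 ixe H3).
rewrite -derive1E (differentiation_under_integral measurableT Ia H1 H2 G0 ixe H3).
transitivity (\int[mu]_x (-1 * (x * (sin (t * x + th) * e x)))).
  apply: eq_Rintegral => x _; rewrite mulN1r.
  by change (partial1of2 f t x = - (x * (sin (t * x + th) * e x))); rewrite partial1of2E; have [_ ->] := fd x t.
by rewrite (RintegralZl (-1) measurableT (ixsine t)) by_parts; ring.
Qed.

(** The differential equation of [F_derive] makes [F t] times [expR (s ^ 2 t ^ 2 / 2)] constant. *)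
Lemma gauss_integral_cos t : F t = cos th * \int[mu]_x e x * expR (- (s ^+ 2 * t ^+ 2 / 2)).
Proof.
pose G r := F r * expR (s ^+ 2 * r ^+ 2 / 2).
have dG r : is_derive r (1 : R) G 0.
  have de : is_derive r (1 : R) (fun r => expR (s ^+ 2 * r ^+ 2 / 2)) (expR (s ^+ 2 * r ^+ 2 / 2) * (s ^+ 2 * r)).
    apply: (@is_derive1_comp _ expR (fun r => s ^+ 2 * r ^+ 2 / 2)).
    by apply: is_derive_eq; rewrite /GRing.scale /=; field.
  have -> : 0 = F r *: (expR (s ^+ 2 * r ^+ 2 / 2) * (s ^+ 2 * r)) +
     expR (s ^+ 2 * r ^+ 2 / 2) *: (- (s ^+ 2 * r) * F r) by rewrite /GRing.scale /=; ring.
  by apply: is_deriveM; exact: F_derive.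
have := is_derive_0_is_cst t 0 dG; rewrite /G expr0n /= mulr0 mul0r expR0 mulr1.
have -> : F 0 = cos th * \int[mu]_x e x.
  rewrite -RintegralZl//; apply: eq_Rintegral => x _; by rewrite mul0r add0r.
by move=> <-; rewrite expRN mulfK// gt_eqF// expR_gt0.
Qed.

End gauss_charfun.

Section normal_law_charfun.
Context {R : realType}.
Notation mu := (@lebesgue_measure R).

Lemma Rintegral_normal_prob (s : R) (f : R -> R) (M : R) : 0 < s ->
  measurable_fun setT f -> (forall x, `|f x| <= M) ->
  \int[(normal_prob 0 s : probability (measurableTypeR R) R)]_x f x =
  \int[mu]_x (f x * normal_pdf 0 s x).
Proof.
move=> s0 mf fM; rewrite /Rintegral; congr fine.
pose nu : probability (measurableTypeR R) R := normal_prob 0 s.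
have If : nu.-integrable setT (EFin \o f) by exact: (bounded_integrable (probability_lty nu) mf fM).
have dom : nu `<< mu := @normal_prob_dominates R 0 s.
have mf' : measurable_fun setT (EFin \o f) by exact: measurable_int If.
transitivity (\int[mu]_x ((f x)%:E * (normal_pdf 0 s x)%:E))%E; last by apply: eq_integral => x _; rewrite EFinM.
rewrite -(Radon_Nikodym_change_of_variables dom measurableT If).
apply: ae_eq_integral => //.
- apply: emeasurable_funM; first exact: mf'.
  by apply: (measurable_int mu); apply: Radon_Nikodym_integrable; exact: dom.
- by apply: emeasurable_funM => //; apply/measurable_EFinP; exact: measurable_normal_pdf.
- apply: ae_eqe_mul2l => /=; rewrite Radon_NikodymE//=.
  case: cid => /= g [h1 h2 h3]; apply: integral_ae_eq => //=.
    by apply/measurable_EFinP; exact: measurable_normal_pdf.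
  by move=> A _ mA; rewrite -h3.
Qed.

Lemma normal_law_charfun (b t : R) : 0 <= b ->
  cint (normal_law_prob b) (fun x => cis (t * x)) = (expR (- (b * t ^+ 2 / 2)))%:C%C.
Proof.
move=> b0; have mcis : cmeas (fun x : R => cis (t * x)).
  by apply: cmeas_cis; apply: measurable_funM.
rewrite /normal_law_prob; case: eqVneq => [->|bn0].
  rewrite mul0r mul0r oppr0 expR0.
  have -> : cint (dirac (0 : R)) (fun x => cis (t * x)) = cis (t * 0).
    have [m1 m2] := mcis; rewrite /cint /Rintegral !integral_dirac ?diracT ?mul1e//.
    - exact/measurable_EFinP.
    - exact/measurable_EFinP.
  by rewrite mulr0 cis0.
set s := Num.sqrt b.
have s0 : 0 < s by rewrite sqrtr_gt0 lt_neqAle eq_sym bn0.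
have sb : s ^+ 2 = b by rewrite sqr_sqrtr.
pose e (x : R) := expR (- x ^+ 2 / (s ^+ 2 *+ 2)).
have ptE x : normal_pdf 0 s x = normal_peak s * e x.
  by rewrite normal_pdfE ?gt_eqF// /normal_fun subr0.
have ie1 : normal_peak s * \int[mu]_x e x = 1.
  have := @integral_normal_pdf R 0 s => /(congr1 fine); rewrite /= => <-.
  have := @integrable_normal_pdf R 0 s => I.
  rewrite -[fine _]/(\int[mu]_x normal_pdf 0 s x); under [RHS]eq_Rintegral do rewrite ptE.
  by rewrite RintegralZl//; exact: gauss_integrable.
have key th : \int[mu]_x (cos (t * x + th) * normal_pdf 0 s x) = cos th * expR (- (b * t ^+ 2 / 2)).
  under eq_Rintegral do rewrite ptE mulrCA.
  rewrite RintegralZl//; last exact: gauss_cos_integrable.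
  rewrite (gauss_integral_cos s0) -/e sb mulrA mulrCA.
  by rewrite ie1 mulr1.
have mid : measurable_fun setT (id : measurableTypeR R -> R).
  by move=> _ B mB; rewrite setTI preimage_id.
pose N : probability (measurableTypeR R) R := normal_prob 0 s.
rewrite (cint_transfer mid (mu := N) _ mcis); last by [].
have [m1 m2] := mcis.
have e1 : \int[(normal_prob 0 s : probability (measurableTypeR R) R)]_x complex.Re (cis (t * x)) =
    expR (- (b * t ^+ 2 / 2)).
  rewrite (Rintegral_normal_prob s0 m1 (M := 1)); last first.
    by move=> x; apply: le_trans (normc_ge_absRe _) _; rewrite normc_cis.
  have := key 0; rewrite cos0 mul1r => <-; apply: eq_Rintegral => x _.
  by rewrite addr0.
have e2 : \int[(normal_prob 0 s : probability (measurableTypeR R) R)]_x complex.Im (cis (t * x)) = 0.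
  rewrite (Rintegral_normal_prob s0 m2 (M := 1)); last first.
    by move=> x; apply: le_trans (normc_ge_absIm _) _; rewrite normc_cis.
  have k := key (- (pi / 2)); rewrite cosN cos_pihalf mul0r in k; rewrite -[RHS]k; apply: eq_Rintegral => x _.
  by rewrite /= cosD cosN sinN cos_pihalf sin_pihalf mulr0 add0r mulrN1 opprK.
by rewrite /cint e1 e2.
Qed.

End normal_law_charfun.

(** * Distribution of phi *)

Lemma cisMz (R : realType) (t : R) (l : int) : cis t ^ l = cis (l%:~R * t).
Proof.
case: l => n; first by rewrite -pmulrn mulr_natl cisMn.
by rewrite NegzE -invr_expz -exprnP -cisMn mulrNz mulNr cisN -pmulrn mulr_natl.
Qed.

Section solenoid_convolution.
Context {R : realType} {p : nat}.
Notation S := (borel (solenoid R p)).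

Lemma measurable_solenoidD d (T : measurableType d) (f g : T -> S) :
  measurable_fun setT f -> measurable_fun setT g ->
  measurable_fun setT (fun t => (f t : solenoid R p) + g t : S).
Proof.
move=> mf mg; apply: measurable_solenoid => j; apply: cmeasM.
  exact: (cmeas_comp (@cmeas_scoord R p j) mf).
exact: (cmeas_comp (@cmeas_scoord R p j) mg).
Qed.

Lemma convolution_distribution d (T : measurableType d) (P : probability T R)
    (V W : T -> S) (mu nu : probability S R) :
  has_distribution P V mu -> has_distribution P W nu ->
  (forall A B, measurable A -> measurable B ->
     P (V @^-1` A `&` W @^-1` B) = (P (V @^-1` A) * P (W @^-1` B))%E) ->
  has_distribution P (fun t => (V t : solenoid R p) + W t : S) (convolution mu nu).
Proof.
move=> [mV VE] [mW WE] ind; split; first exact: measurable_solenoidD.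
move=> A mA.
pose B : set (S * S) := [set z | A ((z.1 : solenoid R p) + z.2)].
have mB : measurable B.
  rewrite -[B]setTI; apply: (measurable_solenoidD measurable_fst measurable_snd) => //.
have mVW : measurable_fun setT (fun t => (V t, W t)) by exact: measurable_fun_pair.
transitivity (distribution P (rv_of P mVW) B); first by [].
rewrite -(@product_measure_unique _ _ _ _ R mu nu (distribution P (rv_of P mVW))) => //.
  apply: eq_integral => x _ /=; congr (nu _).
  by apply/seteqP; split => y; rewrite /xsection /= inE.
move=> C D mC mD; rewrite /distribution /pushforward rv_ofE.
by transitivity (P (V @^-1` C) * P (W @^-1` D))%E; [exact: ind|rewrite VE// WE].
Qed.

Lemma convolution_dirac (a : S) (mu : probability S R) (A : set S) : measurable A ->
  convolution (\d_a) mu A = mu [set y | A ((a : solenoid R p) + y)].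
Proof.
move=> mA; rewrite /convolution integral_dirac ?diracT ?mul1e//.
pose B : set (S * S) := [set z | A ((z.1 : solenoid R p) + z.2)].
have mB : measurable B.
  by rewrite -[B]setTI; apply: (measurable_solenoidD measurable_fst measurable_snd).
have := measurable_fun_xsection mu mB; congr measurable_fun.
apply/funext => x /=; congr (mu _).
by apply/seteqP; split => y; rewrite /xsection /= inE.
Qed.

End solenoid_convolution.

Section solenoid_characters.
Context {R : realType} {p : nat} (pp : prime p).

(* The parameter of the character of [R x Z^d] obtained by composing [chi_{d,l}]
   with [phi]. *)
Definition char_param (dl : nat * int) : R * ('I_dl.1 -> circle R) :=
  (dl.2%:~R / p%:R ^+ dl.1, fun k : 'I_dl.1 => expi (dl.2%:~R * (2 * pi * p%:R ^+ k) / p%:R ^+ dl.1)).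

Lemma solenoid_char_phi (dl : nat * int) (y : R * (nat -> int)) :
  solenoid_char dl (phi pp y) =
  realZ_char (char_param dl) ((y.1, \row_(k < dl.1) y.2 k) : realZ R dl.1).
Proof.
rewrite /solenoid_char /realZ_char /= cisMz.
under eq_bigr do rewrite mxE cisMz.
rewrite -cis_sum -cisD; congr cis; rewrite /phi_angle mulrA mulrDr mulrDl mulr_sumr mulr_suml.
congr (_ + _); first by rewrite mulrAC.
by apply: eq_bigr => k _; ring.
Qed.

Lemma solenoid_charE (dl : nat * int) (x : solenoid R p) :
  solenoid_char dl x = realZ_char (char_param dl) (taun dl.1 x).
Proof. by rewrite -{1}(phi_tauK pp x) solenoid_char_phi. Qed.

(** Both compensators involve only [h (arg x_0)], with the same coefficient; hence the Levy
    exponents on the two groups coincide without a shift. *)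
Lemma solenoid_gE (dl : nat * int) (x : solenoid R p) :
  solenoid_g x dl = realZ_g (taun dl.1 x) (char_param dl).
Proof. by rewrite /solenoid_g /realZ_g /= mulrAC. Qed.

Lemma cmeas_solenoid_char dl : cmeas (solenoid_char dl : borel (solenoid R p) -> R[i]).
Proof.
rewrite (_ : solenoid_char dl = fun x => realZ_char (char_param dl) (taun dl.1 x)).
  exact: (cmeas_taun (cmeas_realZ_char _)).
by apply/funext => x; rewrite solenoid_charE.
Qed.

End solenoid_characters.

(** * The law of [phi] applied to representing variables *)

Section distribution_of_representation.
Context {R : realType} {p : nat} (pp : prime p).
Variables (b : R) (eta : {measure set (borel (solenoid R p)) -> \bar R}).
Variable etan : forall n, {measure set (borel (realZ R n)) -> \bar R}.
Hypotheses (b0 : 0 <= b) (Heta : is_levy eta) (etanE : forall n, is_tau_image eta (etan n)).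
Context d (T : measurableType d) (P : probability T R).
Variables (X0 Y0 : {RV P >-> R}) (Y : nat -> {RV P >-> int}).
Hypothesis rep : representing_variables b etan X0 Y0 Y.
Let S := borel (solenoid R p).

Let W1 w : S := phi pp (X0 w, fun=> 0).
Let W2 w : S := phi pp (Y0 w, fun k => Y k w).

Let mW1 : measurable_fun setT W1.
Proof. by apply: measurable_phi. Qed.

Let mW2 : measurable_fun setT W2.
Proof. by apply: measurable_phi. Qed.

Definition gauss_factor : probability S R := distribution P (rv_of P mW1).
Definition poisson_factor : probability S R := distribution P (rv_of P mW2).

Lemma gauss_factorP : is_gauss solenoid_char (solenoid_psi p b) gauss_factor.
Proof.
move=> dl; have [_ [mX XE] _] := rep.
transitivity (cint gauss_factor (solenoid_char dl)); first by [].
rewrite (cint_transfer mW1 (mu := P) _ (cmeas_solenoid_char pp dl)); last by [].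
pose t : R := dl.2%:~R / p%:R ^+ dl.1.
transitivity (cint P (fun w => cis (t * X0 w))).
  apply: eq_cint => w; rewrite solenoid_char_phi /realZ_char /= big1 ?mulr1// => k _.
  by rewrite mxE expr0z.
have mc : cmeas (fun x : R => cis (t * x)) by apply: cmeas_cis; exact: measurable_funM.
have := normal_law_charfun t b0.
rewrite (cint_transfer (nu := normal_law_prob b) mX (mu := P) _ mc); last first.
  by move=> A mA; exact: (etrans (normal_law_probE b A) (esym (XE A mA))).
move=> ->; congr ((expR _)%:C)%C; rewrite /solenoid_psi /t expr_div_n -exprM [(_ * 2)%N]mulnC.
by rewrite mulrA mulNr.
Qed.

(** After composition with [phi], the character [chi_{d,l}] sees only [Y_0], ..., [Y_d], so the law
    [pi_d] determines the transform; [cint_tau_image] then carries its exponent from [etan] back to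
    [eta]. *)
Lemma poisson_factorP : is_generalized_poisson solenoid_char solenoid_g eta poisson_factor.
Proof.
split=> // dl; have [_ _ /(_ dl.1)[pin [[_ pinE] [mF FE]]]] := rep.
transitivity (cint poisson_factor (solenoid_char dl)); first by [].
rewrite (cint_transfer mW2 (mu := P) _ (cmeas_solenoid_char pp dl)); last by [].
transitivity (cint P (fun w => realZ_char (@char_param R p dl)
    ((Y0 w, \row_(k < dl.1) Y k w) : realZ R dl.1))).
  by apply: eq_cint => w; rewrite solenoid_char_phi.
rewrite -(cint_transfer (nu := pin) mF (mu := P) _ (cmeas_realZ_char (@char_param R p dl))); last first.
  by move=> A mA; exact: (esym (FE A mA)).
transitivity (cintegral pin (realZ_char (@char_param R p dl))); first by [].
rewrite pinE; congr cexp.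
transitivity (cint (etan dl.1) (realZ_levy_fun (@char_param R p dl))); first by [].
rewrite (cint_tau_image (@etanE _) (cmeas_realZ_levy_fun _)); last exact: realZ_levy_fun0.
by apply: eq_cint => x; rewrite /realZ_levy_fun -solenoid_charE// -solenoid_gE.
Qed.

Lemma factors_independent A B : measurable A -> measurable B ->
  P (W1 @^-1` A `&` W2 @^-1` B) = (P (W1 @^-1` A) * P (W2 @^-1` B))%E.
Proof.
move=> mA mB; have [ind _ _] := rep; apply: ind.
  exists [set x : R | A (phi pp (x, fun=> 0) : S)]; last by rewrite setTI.
  rewrite -[X in measurable X]setTI.
  by apply: (@measurable_phi R p pp _ R (fun x => x) (fun _ _ => 0)).
pose G := \bigcup_n sigma_seq Y0 (fun k => Y k : T -> int) n.
have m0 : measurable_fun [set: g_sigma_algebraType G] (Y0 : g_sigma_algebraType G -> R).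
  move=> _ C mC; apply: sub_sigma_algebra; exists 0%N => //.
  by exists C.
have mk k : measurable_fun [set: g_sigma_algebraType G] (Y k : g_sigma_algebraType G -> int).
  move=> _ C mC; apply: sub_sigma_algebra; exists k.+1 => //.
  by exists C.
have := measurable_phi pp m0 mk measurableT mB; rewrite setTI; exact.
Qed.

Lemma representation_distribution (a : solenoid R p) :
  has_distribution P
    (fun w => phi pp ((tau a).1 + X0 w + Y0 w, fun k => (tau a).2 k + Y k w) : S)
    (convolution (\d_(a : S)) (convolution gauss_factor poisson_factor)).
Proof.
have WE : has_distribution P (fun t => (W1 t : solenoid R p) + W2 t : S)
    (convolution gauss_factor poisson_factor).
  by apply: convolution_distribution => //; exact: factors_independent.
have ZE w : phi pp ((tau a).1 + X0 w + Y0 w, fun k => (tau a).2 k + Y k w) =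
    a + (phi pp (X0 w, fun=> 0) + phi pp (Y0 w, fun k => Y k w)).
  transitivity (phi pp ((tau a).1, (tau a).2) +
      (phi pp (X0 w, fun=> 0) + phi pp (Y0 w, fun k => Y k w))); last first.
    by rewrite -surjective_pairing phi_tauK.
  rewrite -!phiD addrA; congr (phi pp (_, _)); apply/funext => k; by rewrite add0r.
have [mW WA] := WE; pose Q : probability S R := distribution P (rv_of P mW).
split.
  have -> : (fun w => phi pp ((tau a).1 + X0 w + Y0 w, fun k => (tau a).2 k + Y k w) : S) =
    (fun w => a + (W1 w + W2 w : solenoid R p) : S).
    by apply/funext => w; rewrite ZE.
  exact: (measurable_solenoidD (measurable_cst (a : S)) mW).
move=> A mA.
have mAx (x : S) : measurable ([set y | A ((x : solenoid R p) + y)] : set S).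
  have := measurable_solenoidD (measurable_cst x) (@measurable_id _ S setT) measurableT mA.
  by rewrite setTI.
have -> : convolution (\d_(a : S)) (convolution gauss_factor poisson_factor) A =
   convolution (\d_(a : S)) Q A.
  by apply: eq_integral => x _; rewrite -WA.
rewrite convolution_dirac//; congr (P _); apply/seteqP; split => w /=.
  by rewrite ZE.
by rewrite ZE.
Qed.

Lemma representation_coordinate (a : solenoid R p) (w : T) (j : nat) :
  val (scoord (phi pp ((tau a).1 + X0 w + Y0 w, fun k => (tau a).2 k + Y k w)) j) =
    val (scoord a j) *
    cis ((X0 w + Y0 w + \sum_(k < j) 2 * pi * (Y k w)%:~R * p%:R ^+ k) / p%:R ^+ j).
Proof.
transitivity (cis (phi_angle p ((tau a).1 + (X0 w + Y0 w), fun k => (tau a).2 k + Y k w) j)).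
  by rewrite addrA.
rewrite phi_angleD -surjective_pairing phi_angle_tau// cisD expi_val.
by congr (_ * cis _).
Qed.

End distribution_of_representation.

(** * Haar measure *)

Section lebesgue_periodic.
Context {R : realType}.
Notation mu := (@lebesgue_measure R).

Lemma measurable_translate (A : set R) s : measurable A -> measurable [set t | A (t + s)].
Proof.
move=> mA; have mf : measurable_fun setT (fun t : R => t + s) by exact: measurable_funD.
by have := mf measurableT A mA; rewrite setTI.
Qed.

Lemma lebesgue_translate (A : set R) s : measurable A -> mu [set t | A (t + s)] = mu A.
Proof.
move=> mA; pose f (t : measurableTypeR R) : measurableTypeR R := t + s.
have mf : measurable_fun setT f.
  by move=> _ B mB; rewrite setTI; exact: (measurable_translate s mB).
apply/esym; transitivity (pushforward mu f A); last by [].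
apply: (lebesgue_measure_unique (mu := pushforward mu f)) => //.
move=> _ [[a b] /= _ <-].
rewrite -[RHS]/(mu [set t | `]a, b]%classic (t + s)]).
have -> : [set t | `]a, b]%classic (t + s)] = `]a - s, b - s]%classic.
  by apply/seteqP; split => t /=; rewrite !in_itv /= ltrBlDr lerBrDr.
by rewrite !lebesgue_measure_itv /= !lte_fin ltrD2r -!EFinD opprB addrA subrK.
Qed.

Lemma lebesgue_split (A : set R) a b c : measurable A -> a <= b -> b <= c ->
  mu (A `&` `[a, c[) = (mu (A `&` `[a, b[) + mu (A `&` `[b, c[))%E.
Proof.
move=> mA ab bc.
have mI x y : measurable (A `&` `[x, y[ : set (measurableTypeR R)) by apply: measurableI => //; exact: measurable_itv.
rewrite -measureU//.
  congr (mu _); rewrite -setIUr; congr (_ `&` _); apply/seteqP; split => t /=; rewrite !in_itv /=.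
    by move=> /andP[at1 tc]; have [tb|tb] := ltP t b; [left; rewrite at1|right].
  by move=> [/andP[at1 tb]|/andP[bt tc]]; apply/andP; split => //; [exact: lt_le_trans bc|exact: le_trans bt].
rewrite -subset0 => t /= [[_ H1] [_ H2]]; move: H1 H2; rewrite !in_itv /= => /andP[_ tb] /andP[bt _].
by move: (lt_le_trans tb bt); rewrite ltxx.
Qed.

Lemma lebesgue_translate_itv (A : set R) s a b : measurable A ->
  mu ([set t | A (t + s)] `&` `[a, b[) = mu (A `&` `[a + s, b + s[).
Proof.
move=> mA; rewrite -(lebesgue_translate s (A := A `&` _)); last first.
  by apply: measurableI => //; exact: measurable_itv.
by congr (mu _); apply/seteqP; split => t /=; rewrite !in_itv /= lerD2r ltrD2r.
Qed.

Lemma lebesgue_sum_translates (A : set R) L n : measurable A -> 0 <= L ->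
  (\sum_(k < n) mu ([set t | A (t + k%:R * L)%R] `&` `[0%R, L[) = mu (A `&` `[0%R, (n%:R * L)%R[))%E.
Proof.
move=> mA L0; elim: n => [|n IH].
  by rewrite big_ord0 mul0r set_itvE setI0 measure0.
rewrite big_ord_recr /= IH lebesgue_translate_itv// add0r.
rewrite [in RHS](@lebesgue_split _ _ (n%:R * L))// ?mulr_ge0//.
  by rewrite -[in RHS]natr1 mulrDl mul1r addrC [L + _]addrC addrC.
by rewrite ler_wpM2r// ler_nat.
Qed.

(** Reduce the shift modulo [L] to some [r] in [[0, L]] and cut [[r, L + r[] at [L]: by periodicity
    the second piece has the same measure as the part of [A] in [[0, r[]. *)
Lemma lebesgue_periodic (A : set R) L s : measurable A -> 0 < L ->
  (forall t, A (t + L) <-> A t) ->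
  mu ([set t | A (t + s)] `&` `[0, L[) = mu (A `&` `[0, L[).
Proof.
move=> mA L0 AL.
have ALn n t : A (t + n%:R * L) <-> A t.
  elim: n => [|n IH]; first by rewrite mul0r addr0.
  by rewrite -natr1 mulrDl mul1r addrA AL.
have ALz (z : int) t : A (t + z%:~R * L) <-> A t.
  case: z => n; first exact: ALn.
  by rewrite NegzE mulrNz mulNr -(ALn n.+1 (t - _)) subrK.
pose k := Num.floor (s / L); pose r := s - k%:~R * L.
have /andP[k1 k2] := floor_itv (s / L); rewrite -/k in k1 k2.
have r0 : 0 <= r by rewrite subr_ge0 -ler_pdivlMr.
have rL : r <= L.
  by rewrite lerBlDl -{2}[L]mul1r -mulrDl -ler_pdivrMr// -[1]/(1%:~R) -intrD ltW.
have -> : [set t | A (t + s)] = [set t | A (t + r)].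
  apply/seteqP; split => t /=; rewrite /r addrA.
    by move=> Ats; rewrite -(ALz k) subrK.
  by rewrite -(ALz k) subrK.
rewrite lebesgue_translate_itv// add0r (@lebesgue_split _ _ L)//; last by rewrite lerDl.
rewrite -{2}[L]add0r [L + r]addrC -lebesgue_translate_itv//.
have -> : [set t | A (t + L)] = A by apply/seteqP; split => t /=; rewrite AL.
by rewrite [in RHS](@lebesgue_split _ _ r)// addeC.
Qed.

End lebesgue_periodic.

Lemma probability_partition d (T : measurableType d) (R : realType) (P : probability T R)
    (E : nat -> set T) n X :
  (forall k, measurable (E k)) -> trivIset setT E -> (\sum_(k < n) P (E k) = 1)%E ->
  measurable X -> (P X = \sum_(k < n) P (X `&` E k))%E.
Proof.
move=> mE tE E1 mX; set F := \big[setU/set0]_(k < n) E k.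
have mF : measurable F by exact: bigsetU_measurable.
have PF : P F = 1%E.
  rewrite -E1; apply: measure_semi_additive_ord_I => //.
  exact: sub_trivIset tE.
have -> : (P X = P (X `\` F) + P (X `&` F))%E by rewrite (measureDI P mX mF).
have -> : P (X `\` F) = 0%E.
  apply/eqP; rewrite eq_le measure_ge0 andbT.
  have <- : P (~` F) = 0%E by rewrite probability_setC// PF subee.
  by apply: le_measure; rewrite ?inE; [exact: measurableD|exact: measurableC|move=> x []].
rewrite add0e -(@measure_semi_additive_ord_I _ _ _ P (fun k => X `&` E k))//.
- by congr (P _); rewrite /F -(bigcup_mkord n E) -(bigcup_mkord n (fun k => X `&` E k)) setI_bigcupr.
- by move=> k _; exact: measurableI.
- by apply: sub_trivIset (@subsetT _ _) _; exact: trivIset_setIl.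
- by apply: bigsetU_measurable => k _; exact: measurableI.
Qed.

Lemma bigcap_cons (T : Type) (I : eqType) (A : I -> set T) i (J : seq I) :
  \bigcap_(j in [set` i :: J]) A j = A i `&` \bigcap_(j in [set` J]) A j.
Proof.
apply/seteqP; split => x Ax.
  by split; [apply: Ax => /=; rewrite mem_head|move=> j /= jJ; apply: Ax => /=; rewrite inE jJ orbT].
by move=> j /=; rewrite inE => /orP[/eqP ->|jJ]; [exact: Ax.1|exact: Ax.2].
Qed.

(** * Sums of uniform digits and the Haar measure *)

Section uniform_digits.
Context {R : realType} {p : nat} (pp : prime p).
Context d (T : measurableType d) (P : probability T R).
Variables (U0 : {RV P >-> R}) (U : nat -> {RV P >-> int}).
Hypothesis ind : mutually_independent P (sigma_seq U0 (fun k => U k : T -> int)).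
Hypothesis unif0 : has_distribution P U0 (uniform_prob (pi2_gt0 R)).
Hypothesis unif : forall k, uniform_digit P p (U k).
Notation mu := (@lebesgue_measure R).

Let L n : R := 2 * pi * p%:R ^+ n.

Let p0 : 0 < p%:R :> R. Proof. by rewrite ltr0n prime_gt0. Qed.

Let L0 n : 0 < L n. Proof. by rewrite mulr_gt0 ?pi2_gt0// exprn_gt0. Qed.

(* [phi_angle p (U0 w, U w) n] multiplied by [p ^ n]. *)
Definition digit_sum n (w : T) : R := U0 w + \sum_(k < n) 2 * pi * (U k w)%:~R * p%:R ^+ k.

Lemma measurable_digit_sum n : measurable_fun setT (digit_sum n).
Proof.
apply: measurable_funD => //; apply: measurable_sum => k.
apply: measurable_funM => //; apply: measurable_funM => //.
exact: (measurable_int_fun (fun z => z%:~R)).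
Qed.

Definition uniform_itv n (D : set R) : \bar R := ((L n)^-1%:E * mu (D `&` `[0%R, L n[))%E.

Let sigma_measurable n A : sigma_seq U0 (fun k => U k : T -> int) n A -> measurable A.
Proof.
case: n => [|n] [B mB <-]; exact: measurable_funPT.
Qed.

(** The library's uniform law lives on the closed interval; its right end point is a null set. *)
Let uniform0 (D : set R) : measurable D -> P (U0 @^-1` D) = uniform_itv 0 D.
Proof.
move=> mD; rewrite (unif0.2 D mD) /uniform_itv /L expr0 mulr1 /uniform_prob integral_uniform_pdf.
have pi20 := pi2_gt0 R.
have mI : measurable (D `&` `[0, 2 * pi] : set (measurableTypeR R)).
  by apply: measurableI => //; exact: measurable_itv.
have mIo : measurable (D `&` `[0, 2 * pi[ : set (measurableTypeR R)).
  by apply: measurableI => //; exact: measurable_itv.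
rewrite (eq_integral (cst ((2 * pi)^-1)%:E)); last first.
  by move=> x; rewrite inE /= in_itv /= /uniform_pdf => -[_ ->]; rewrite subr0.
rewrite integral_cst//; congr (_ * _)%E; apply/eqP; rewrite eq_le; apply/andP; split; last first.
  apply: le_measure; rewrite ?inE// => x /=; rewrite !in_itv /= => -[? /andP[-> /ltW ->]] //.
have m1 : measurable ([set 2 * pi] : set (measurableTypeR R)) by exact: measurable_set1.
apply: (@le_trans _ _ (mu ((D `&` `[0, 2 * pi[) `|` [set 2 * pi]))).
  apply: le_measure; rewrite ?inE//; first exact: measurableU.
  move=> x /=; rewrite !in_itv /= => -[Dx /andP[x0 x2]].
  by move: x2; rewrite le_eqVlt => /orP[/eqP ->|x2]; [right|left; rewrite x0].
apply: le_trans (measureU2 _ _ _) _ => //.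
rewrite -[leRHS]adde0; apply: leeD; first by [].
by have e0 := lebesgue_measure_set1 (2 * pi : R); rewrite le_eqVlt; apply/orP; left; apply/eqP; exact: e0.
Qed.

(** The events of later variables are carried along because the induction needs the partial sum to
    be independent of the next digit. Fixing that digit at [k] shifts the partial sum by [k L n],
    and the [p] translates of [[0, L n[] tile [[0, L n.+1[]. *)
Lemma digit_sum_law n (D : set R) (J : seq nat) (A : nat -> set T) :
  measurable D -> uniq J -> (forall j, j \in J -> (n < j)%N) ->
  (forall j, j \in J -> sigma_seq U0 (fun k => U k : T -> int) j (A j)) ->
  P (digit_sum n @^-1` D `&` \bigcap_(j in [set` J]) A j) =
  (uniform_itv n D * \prod_(j <- J) P (A j))%E.
Proof.
elim: n D J A => [|n IH] D J A mD uJ nJ JA.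
  pose A' j := if j is 0 then U0 @^-1` D else A j.
  have J0 : 0%N \notin J by apply/negP => /nJ.
  have A'E j : j \in J -> A' j = A j by case: j => // /nJ.
  have := @ind (0%N :: J) A'; rewrite bigcap_cons /= => H.
  have -> : digit_sum 0 @^-1` D = U0 @^-1` D.
    by apply/seteqP; split => w; rewrite /digit_sum /= big_ord0 addr0.
  have -> : \bigcap_(j in [set` J]) A j = \bigcap_(j in [set` J]) A' j.
    by apply: eq_bigcapr => j /= jJ; rewrite A'E.
  rewrite H ?J0//.
    rewrite big_cons /= uniform0//; congr (_ * _)%E.
    by rewrite [LHS]big_seq [RHS]big_seq; apply: eq_bigr => j jJ; rewrite A'E.
  move=> j; rewrite inE => /orP[/eqP ->|jJ]; last by rewrite A'E//; exact: JA.
  by exists D => //; rewrite setTI.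
pose E k := U n @^-1` [set (k : nat)%:Z].
have mE k : measurable (E k) by exact: measurable_funPTI.
have mX : measurable (digit_sum n.+1 @^-1` D `&` \bigcap_(j in [set` J]) A j).
  apply: measurableI.
    by have := measurable_digit_sum n.+1 measurableT mD; rewrite setTI.
  apply: bigcap_measurableType => j jJ; apply: (@sigma_measurable j); exact: JA.
rewrite (probability_partition (n := p) mE)//; last 2 first.
- by apply/trivIsetP => i j _ _ ij; rewrite -subset0 => w [/= Ui Uj]; move/eqP : ij; apply; have [] := etrans (esym Ui) Uj.
- under eq_bigr => k _ do rewrite (unif n (ltn_ord k)).
  by rewrite sumEFin sumr_const card_ord -[_ *+ p]mulr_natr mulVf// gt_eqF.
pose Dk k := [set t | D (t + k%:R * L n)].
have mDk k : measurable (Dk k) by exact: measurable_translate.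
have step (k : 'I_p) : P ((digit_sum n.+1 @^-1` D `&` \bigcap_(j in [set` J]) A j) `&` E k) =
    (uniform_itv n (Dk k) * ((p%:R^-1)%:E * \prod_(j <- J) P (A j)))%E.
  (* The digit [U n] has index [n.+1] in [sigma_seq], hence its event joins the later ones in the
     induction hypothesis for [n]. *)
  pose A' j := if j == n.+1 then E k else A j.
  have nJ' : n.+1 \notin J by apply/negP => /nJ; rewrite ltnn.
  have A'E j : j \in J -> A' j = A j by rewrite /A'; case: eqP => // -> jJ; rewrite jJ in nJ'.
  have -> : digit_sum n.+1 @^-1` D `&` \bigcap_(j in [set` J]) A j `&` E k =
     digit_sum n @^-1` (Dk k) `&` \bigcap_(j in [set` (n.+1 :: J)]) A' j.
    rewrite bigcap_cons {1}/A' eqxx.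
    have -> : \bigcap_(j in [set` J]) A' j = \bigcap_(j in [set` J]) A j.
      by apply: eq_bigcapr => j /= jJ; rewrite A'E.
    rewrite setIA setIAC; congr (_ `&` _).
    apply/seteqP; split => w [/= Dw Ek]; split => //; move: Dw.
      rewrite /digit_sum big_ord_recr /= Ek /Dk /= /L addrA; congr D.
      by rewrite mulrAC [in X in _ + X]mulrC.
    rewrite /digit_sum big_ord_recr /= Ek /Dk /= /L addrA; congr D.
    by rewrite [in RHS]mulrAC [in X in _ = _ + X]mulrC.
  rewrite IH//.
  - rewrite big_cons {1}/A' eqxx -(unif n (ltn_ord k)); congr (_ * (_ * _))%E.
    by rewrite [LHS]big_seq [RHS]big_seq; apply: eq_bigr => j jJ; rewrite A'E.
  - by rewrite /= nJ'.
  - by move=> j; rewrite inE => /orP[/eqP ->//|/nJ]; exact: ltnW.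
  - move=> j; rewrite inE => /orP[/eqP ->|jJ]; last by rewrite A'E//; exact: JA.
    by rewrite /A' eqxx; exists [set (k : nat)%:Z] => //; rewrite setTI.
under eq_bigr do rewrite step.
rewrite -ge0_sume_distrl; last first.
  by move=> k _; rewrite /uniform_itv mule_ge0// lee_fin invr_ge0 ltW.
rewrite muleA; congr (_ * _)%E; rewrite /uniform_itv -ge0_sume_distrr; last first.
  by move=> k _; exact: measure_ge0.
rewrite (@lebesgue_sum_translates R D (L n) p)//; last exact: ltW.
rewrite muleAC -EFinM -invfM.
have -> : L n.+1 = L n * p%:R by rewrite /L exprSr mulrA.
by rewrite [L n * _]mulrC.
Qed.

Lemma digit_sum_uniform n (D : set R) : measurable D ->
  P (digit_sum n @^-1` D) = uniform_itv n D.
Proof.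
move=> mD; have := @digit_sum_law n D [::] (fun=> setT) mD erefl.
rewrite big_nil mule1 => <- //; congr (P _).
by apply/seteqP; split => w // [].
Qed.

Let S := borel (solenoid R p).

Let V w : S := phi pp (U0 w, fun k => U k w).

Let mV : measurable_fun setT V.
Proof. by apply: measurable_phi. Qed.

Let G : set (set S) := [set A | exists n (C : set R), measurable C /\
  A = [set y : S | C (arg (scoord y n))]].

Let argf (t : R) : R := arg (expi t).

Let measurable_argf (c q : R) : measurable_fun setT (fun t : R => argf (c * t + q)).
Proof.
apply: measurable_arg; apply: cmeas_cis; by apply: measurable_funD => //; apply: measurable_funM.
Qed.

(** For [n <= m] the coordinate [n] is the [p ^ (m - n)]-th power of the coordinate [m], so both
    conditions can be read on the latter. *)
Let G_setI : setI_closed G.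
Proof.
move=> _ _ [n [C [mC ->]]] [m [C' [mC' ->]]].
wlog nm : n m C C' mC mC' / (n <= m)%N => [hw|].
  by have [/hw|/ltnW/hw] := leqP n m; [exact|rewrite setIC; exact].
exists m, (C' `&` [set t | C (argf ((p%:R ^+ (m - n)) * t + 0))]); split.
  apply: measurableI => //.
  by have := measurable_argf (p%:R ^+ (m - n)) 0 measurableT mC; rewrite setTI.
have key (y : S) : arg (scoord y n) = argf (p%:R ^+ (m - n) * arg (scoord y m) + 0).
  congr arg; apply: val_inj; rewrite /= addr0 -natrX mulr_natl cisMn expi_val.
  rewrite -{1}(subnK nm); elim: (m - n)%N => [|k IH]; first by rewrite add0n expn0 expr1.
  by rewrite IH addSn [in LHS]scoordE -exprM -expnS.
by apply/seteqP; split => y /=; rewrite key => -[].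
Qed.

(** [measurable_solenoid] is applied to the identity map, with [G] generating the sigma-algebra of
    the source. *)
Let G_generates : measurable = <<s G >> :> set (set S).
Proof.
apply/seteqP; split => A.
  have mid : measurable_fun [set: g_sigma_algebraType G] (id : g_sigma_algebraType G -> S).
    apply: measurable_solenoid => j.
    rewrite (_ : (fun t => _) = fun y : S => cis (arg (scoord y j))); last first.
      by apply/funext => y; rewrite expi_val.
    apply: cmeas_cis => _ C mC; apply: sub_sigma_algebra.
    by exists j, C; split => //; rewrite setTI.
  by move=> /(mid measurableT); rewrite setTI.
apply: smallest_sub; first exact: sigma_algebra_measurable.
move=> _ [n [C [mC ->]]].
by have := @measurable_arg_scoord R p n measurableT C mC; rewrite setTI.
Qed.

Definition solenoid_haar : probability S R := distribution P (rv_of P mV).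

(** Subtracting [x] shifts the digit sum by [p ^ n arg x_n]. The event is periodic in the digit sum
    with period [L n], and the digit sum is uniform over one period, so the shift leaves its
    probability unchanged. *)
Lemma solenoid_haar_coord n (C : set R) (x : solenoid R p) : measurable C ->
  P [set w | C (arg (scoord ((V w : solenoid R p) - x) n))] =
  P [set w | C (arg (scoord (V w) n))].
Proof.
move=> mC; have pn0 : p%:R ^+ n != 0 :> R by rewrite gt_eqF// exprn_gt0.
pose c : R := arg (scoord x n).
pose D q := [set t : R | C (argf ((p%:R ^+ n)^-1 * t + q))].
have mD q : measurable (D q).
  by have := measurable_argf (p%:R ^+ n)^-1 q measurableT mC; rewrite setTI.
have argf_per t : argf (t + 2 * pi) = argf t.
  congr arg; apply: val_inj; rewrite /= cisD.
  by have := @cis_2pi R 1; rewrite mul1r => ->; rewrite mulr1.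
have VE q w : D q (digit_sum n w) <-> C (argf (phi_angle p (U0 w, fun k => U k w) n + q)).
  by rewrite /D /= /digit_sum /phi_angle mulrC.
have -> : [set w | C (arg (scoord ((V w : solenoid R p) - x) n))] = digit_sum n @^-1` (D (- c)).
  apply/seteqP; split => w.
    move=> Cw; apply/VE; move: Cw => /=; congr C; congr arg; apply: val_inj => /=.
    by rewrite cisD cisN expi_val.
  move=> /VE; rewrite /=; congr C; congr arg; apply: val_inj => /=.
  by rewrite cisD cisN expi_val.
have -> : [set w | C (arg (scoord (V w) n))] = digit_sum n @^-1` (D 0).
  by apply/seteqP; split => w; [move=> Cw; apply/VE; rewrite addr0|move=> /VE; rewrite addr0].
rewrite !digit_sum_uniform// /uniform_itv; congr (_ * _)%E.
have -> : D (- c) = [set t | D 0 (t - p%:R ^+ n * c)].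
  by apply/seteqP; split => t; rewrite /D /= mulrBr mulKf// addr0.
apply: lebesgue_periodic => // t.
by rewrite /D /= !addr0 mulrDr /L [2 * pi * _]mulrC mulKf// argf_per.
Qed.

Lemma solenoid_haarP : is_normalized_haar solenoid_haar.
Proof.
move=> x A mA.
have mVx : measurable_fun setT (fun w => (V w : solenoid R p) - x : S).
  exact: (measurable_solenoidD mV (measurable_cst (- x : S))).
pose omega_x : probability S R := distribution P (rv_of P mVx).
have -> : [set x + (y : solenoid R p) | y in A] = [set z : S | A ((z : solenoid R p) - x)].
  apply/seteqP; split => [_ [y Ay <-]|z Az] /=; first by rewrite addrC addKr.
  by exists (z - x) => //; rewrite addrC subrK.
transitivity (omega_x A); first by [].
apply: (measure_unique G (fun=> setT)) => //.
- by move=> _; exists 0%N, setT; split => //; apply/seteqP; split.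
- by apply/seteqP; split => // y _; exists 0%N.
- move=> _ [n [C [mC ->]]]; exact: solenoid_haar_coord.
- by move=> _; exact: probability_lty.
Qed.

End uniform_digits.

Theorem theorem5p1 (R : realType) (p : nat) (pp : prime p) :
  (forall (a : solenoid R p) (b : R)
      (eta : {measure set (borel (solenoid R p)) -> \bar R})
      (etan : forall n, {measure set (borel (realZ R n)) -> \bar R}),
    0 <= b -> is_levy eta -> (forall n, is_tau_image eta (etan n)) ->
    (exists (d : measure_display) (T : measurableType d) (P : probability T R)
        (X0 Y0 : {RV P >-> R}) (Y : nat -> {RV P >-> int}),
      representing_variables b etan X0 Y0 Y) /\
    (forall (d : measure_display) (T : measurableType d) (P : probability T R)
        (X0 Y0 : {RV P >-> R}) (Y : nat -> {RV P >-> int}),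
      representing_variables b etan X0 Y0 Y ->
      let Z (w : T) : solenoid R p :=
        phi pp ((tau a).1 + X0 w + Y0 w, fun k => (tau a).2 k + Y k w) in
      (forall (w : T) (j : nat),
        val (scoord (Z w) j) =
          val (scoord a j) *
          cis ((X0 w + Y0 w + \sum_(k < j) 2 * pi * (Y k w)%:~R * p%:R ^+ k)
               / p%:R ^+ j)) /\
      exists gamma pi_eta : probability (borel (solenoid R p)) R,
        [/\ is_gauss solenoid_char (solenoid_psi p b) gamma,
            is_generalized_poisson solenoid_char solenoid_g eta pi_eta
          & has_distribution P (Z : T -> borel (solenoid R p))
              (convolution (\d_(a : borel (solenoid R p)))
                 (convolution gamma pi_eta))])) /\
  (forall (d : measure_display) (T : measurableType d) (P : probability T R)
      (U0 : {RV P >-> R}) (U : nat -> {RV P >-> int}),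
    mutually_independent P (sigma_seq U0 (fun k => U k : T -> int)) ->
    has_distribution P U0 (uniform_prob (pi2_gt0 R)) ->
    (forall k, uniform_digit P p (U k)) ->
    exists omega : probability (borel (solenoid R p)) R,
      is_normalized_haar omega /\
      has_distribution P
        (fun w => phi pp (U0 w, fun k => U k w) : borel (solenoid R p)) omega).
Proof.
split.
  move=> a b eta etan b0 Heta etanE; split.
    exact: (representing_exists pp Heta etanE b).
  move=> d T P X0 Y0 Y rep Z; split.
    by move=> w j; exact: representation_coordinate.
  (* Both measures are determined by their transforms, so exhibiting them as the laws of [phi] at
     [(X_0, 0, 0, ...)] and at [(Y_0, Y_1, ...)] identifies them. *)
  exists (gauss_factor pp X0), (poisson_factor pp Y0 Y); split.
  - exact: (gauss_factorP pp b0 rep).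
  - exact: (poisson_factorP pp Heta etanE rep).
  - exact: (representation_distribution pp rep).
move=> d T P U0 U ind unif0 unif; exists (solenoid_haar pp U0 U); split.
  exact: solenoid_haarP.
by split => //; exact: measurable_phi.
Qed.
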